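(* Suppose $E[\sup_{x\in\mathcal X}|h(x,\xi)|^2]<\infty$ and, for some constant $\delta>0$, $E[\sup_{x\in\mathcal X}|h(x,\xi)-h(x,\xi')|^{2+\delta}]<\infty$, where $\xi,\xi'$ are i.i.d. from $F$. Let the resample size $k=k_n\in\{1,\dots,n\}$ satisfy $k=o(n)$ as $n\to\infty$. Then there exist random variables $\mathcal Z_{n,k}$, each of mean $0$ and variance $1$, such that $$\sqrt n\,(U_{n,k}-W_k)=k\sqrt{Var(g_k(\xi))}\cdot\mathcal Z_{n,k}+o_p(1)\quad\text{as }n\to\infty,$$ and every subsequence of $\{\mathcal Z_{n,k}\}$ along which $k^2Var(g_k(\xi))\cdot n^{\frac{\delta}{2+\delta}}\to\infty$ converges in distribution to the standard normal.
   Context: $F$ is a probability distribution on a measurable space $\Xi$, $\mathcal X$ is a decision space, $h:\mathcal X\times\Xi\to\mathbb R$ is a cost function (all functions and suprema involved are assumed measurable), and $\xi,\xi_1,\xi_2,\ldots$ are i.i.d. from $F$. For $k\ge1$, $H_k(\xi_1,\ldots,\xi_k)=\min_{x\in\mathcal X}\frac1k\sum_{i=1}^kh(x,\xi_i)$ is the sample average approximation (SAA) optimal value, $W_k=E[H_k(\xi_1,\ldots,\xi_k)]$, and $g_k(z)=E[H_k(\xi_1,\ldots,\xi_k)\mid\xi_1=z]$. For $k\le n$, the $U$-statistic is $U_{n,k}=\binom nk^{-1}\sum_{(i_1,\ldots,i_k)\in\mathcal C_k}H_k(\xi_{i_1},\ldots,\xi_{i_k})$, where $\mathcal C_k$ is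 the collection of all size-$k$ subsets of $\{1,\ldots,n\}$. The variables $\mathcal Z_{n,k}$ live on the probability space of the data, enlarged if necessary by auxiliary randomness. *)

(* Defs.v *)
From HB Require Import structures.
From mathcomp Require Import all_boot all_order all_algebra finmap.
From mathcomp Require Import all_classical all_reals all_analysis.
From mathcomp Require Import measurable_realfun.

Set Implicit Arguments.
Unset Strict Implicit.
Unset Printing Implicit Defensive.

Import Order.TTheory GRing.Theory Num.Theory.
Import numFieldNormedType.Exports.

Local Open Scope classical_set_scope.
Local Open Scope ring_scope.

(* Independence of the whole sequence: product rule over every finite set of
   indices. *)
Definition mutually_independent (d d' : measure_display)
    (T : measurableType d) (T' : measurableType d') (R : realType)
    (P : probability T R) (xi : nat -> {RV P >-> T'}) : Prop :=
  forall (J : {fset nat}) (B : nat -> set T'),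
    (forall j, measurable (B j)) ->
    P (\bigcap_(j in [set` J]) (xi j @^-1` B j))
    = \big[*%E/1%E]_(j <- J) P (xi j @^-1` B j).

Definition iid (d d' : measure_display)
    (T : measurableType d) (T' : measurableType d') (R : realType)
    (P : probability T R) (F : probability T' R)
    (xi : nat -> {RV P >-> T'}) : Prop :=
  mutually_independent xi /\
  forall i (B : set T'), measurable B -> distribution P (xi i) B = F B.

(* [g] is a version of z |-> E[Y | Z = z]. *)
Definition is_cond_expectation (d d' : measure_display)
    (T : measurableType d) (T' : measurableType d') (R : realType)
    (P : probability T R) (Y : T -> R) (Z : {RV P >-> T'}) (g : T' -> R)
    : Prop :=
  [/\ measurable_fun [set: T'] g,
      (distribution P Z).-integrable [set: T'] (EFin \o g) &
      forall B : set T', measurable B ->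
        (\int[distribution P Z]_(z in B) (g z)%:E
         = \int[P]_(w in Z @^-1` B) (Y w)%:E)%E].

(* X_n = o_p(1) *)
Definition little_op1 (d : measure_display) (T : measurableType d)
    (R : realType) (P : probability T R) (X : nat -> T -> R) : Prop :=
  forall e : R, 0 < e -> P [set w | e <= `|X n w|] @[n --> \oo] --> 0%E.

Definition cvg_in_distribution (d : measure_display) (T : measurableType d)
    (R : realType) (P : probability T R) (X : nat -> {RV P >-> R})
    (mu : set R -> \bar R) : Prop :=
  forall x : R, {for x, continuous (fun t : R => mu `]-oo, t]%classic)} ->
    cdf (X n) x @[n --> \oo] --> mu `]-oo, x]%classic.

(* The SAA optimal value H_k(z_1, ..., z_k), with k the length of the list z.
   [inf] is the minimum whenever the latter is attained, and it takes the
   conventional value 0 when the objective is unbounded below in x. *)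
Definition saa_value (Xi X : Type) (R : realType) (h : X -> Xi -> R)
    (z : seq Xi) : R :=
  inf [set (size z)%:R^-1 * \sum_(y <- z) h x y | x in [set: X]].

(* U_{n,k} at the data y 0, ..., y n.-1, for a kernel H evaluated on lists of
   length k; the points of each subset are listed by increasing index. *)
Definition ustatistic (Xi : Type) (R : realType) (H : seq Xi -> R)
    (n k : nat) (y : nat -> Xi) : R :=
  'C(n, k)%:R^-1 *
  \sum_(A : {set 'I_n} | #|A| == k) H [seq y (val i) | i <- enum A].

(* sup_x f x, which may be +oo *)
Definition esup (X : Type) (R : realType) (f : X -> R) : \bar R :=
  ereal_sup [set (f x)%:E | x in [set: X]].

(* Main.v *)
(* Hoeffding projection of the U-statistic.  Write phi(z) = g_k(z) - W_k for the
   centred first-order projection of H_k.  The kernel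
   K(z_1..z_k) = H_k(z_1..z_k) - W_k - sum_i phi(z_i) is degenerate, and its
   covariances zeta(c) = E[K(A) K(B)] for |A| = |B| = k, #|A :&: B| = c satisfy
   zeta(0) = zeta(1) = 0 and have nonnegative finite differences of all orders.
   Replacing one sample point moves H_k by at most sup_x |h(x,z) - h(x,z')| / k,
   which bounds the last difference zeta(k) - zeta(k-1) by O(k^-2); positivity of
   the differences turns this into E[(U_n,k - W_k - (k/n) sum_i phi(xi_i))^2] =
   O((k/n)^2 / k), so sqrt n times the remainder has second moment O(k/n).

   The same Lipschitz estimate gives E|phi(xi)|^(2+delta) = O(k^-(2+delta)), and
   Lindeberg's replacement argument, run on smoothed indicators of half-lines,
   shows that the normalised sum of the phi(xi_i) is close to normal when
   k^2 Var(g_k) n^(delta/(2+delta)) is large.  When Var(g_k) = 0 the variable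
   Z_n,k is an auxiliary standard normal one. *)
Require Import Defs.
From HB Require Import structures.
From mathcomp Require Import all_boot all_order all_algebra finmap.
From mathcomp Require Import all_classical all_reals all_analysis.
From mathcomp Require Import measurable_realfun.
From mathcomp Require Import ring lra zify.

Set Implicit Arguments.
Unset Strict Implicit.
Unset Printing Implicit Defensive.

Import Order.TTheory GRing.Theory Num.Theory.
Import numFieldNormedType.Exports.

Local Open Scope classical_set_scope.
Local Open Scope ring_scope.

(** * Covariances of symmetric kernels *)

(** The kernel changes with [n], so every constant must be explicit in k. The numbers V_j, the j-th
    differences of zeta at 0, are classically the variances of the Hoeffding components, but these
    components are never built: (A, B) -> zeta(#|A :&: B|) is a positive semidefinite kernel on the
    k-subsets of an infinite index set, and the difference of such a zeta is again one, for k - 1.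
    Newton's formula writes zeta(c) as the sum of 'C(c, j) V_j. Averaging over pairs of subsets of
    an n-set turns 'C(k, j) into 'C(k, j)^2 / 'C(n, j), and degeneracy leaves only j >= 2, hence the
    factor (k/n)^2. The last difference weighs V_j by (j/k) 'C(k, j), which costs the factor k. The
    score has only 2 + delta moments, so Taylor remainders are measured by min(y^2, |y|^3) and not
    by a cube. The exponent delta / (2 + delta) is 1 - 2/q with q = 2 + delta; it appears when the
    Lyapunov ratio is raised to the power 2/q. As g_k is given only up to null sets, the Lipschitz
    estimate is proved for an explicit version and transferred almost everywhere. *)

Section subset_kernels.
Variable R : realType.
Implicit Types (zeta : nat -> R) (k n c j : nat).

(** Weighted k-element index sets are the test vectors, and [count [in p.2] q.2] is the size of the
    intersection of two duplicate-free lists. Indices range over all of nat, so fresh indices and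
    arbitrarily many disjoint sets are available. *)
Definition subset_psd k zeta := forall L : seq (R * seq nat),
  (forall p, p \in L -> uniq p.2 /\ size p.2 = k) ->
  0 <= \sum_(p <- L) \sum_(q <- L) p.1 * q.1 * zeta (count [in p.2] q.2).

Definition fdiff zeta : nat -> R := fun c => zeta c.+1 - zeta c.

(** Shifting every set by 2 frees the indices 0 and 1. Each set is tested once with 0 added and
    weight w, once with 1 added and weight -w. Intersections have size c + 1 for equal tags and c
    for different ones, so the four cross terms add up to twice the difference at c. *)
Lemma subset_psd_fdiff k zeta : subset_psd k.+1 zeta ->
  subset_psd k (fdiff zeta).
Proof.
move=> psd L Lk.
pose L' := [seq (p.1, 0%N :: map (addn 2) p.2) | p <- L] ++
           [seq (- p.1, 1%N :: map (addn 2) p.2) | p <- L].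
have /psd : forall p, p \in L' -> uniq p.2 /\ size p.2 = k.+1.
  move=> p; rewrite mem_cat => /orP[] /mapP[q /Lk[uq sq] ->] /=;
    rewrite size_map sq map_inj_uniq ?uq ?andbT//; try exact: addnI;
    by split => //; apply/mapP => -[].
have cM A B : count [in map (addn 2) A] (map (addn 2) B) = count [in A] B.
  rewrite count_map; apply: eq_count => i /=.
  by rewrite mem_map//; exact: addnI.
have n0 A : (0%N \in map (addn 2) A) = false by apply/negP => /mapP[].
have n1 A : (1%N \in map (addn 2) A) = false by apply/negP => /mapP[].
have c2 i A B : (i < 2)%N ->
    count [in i :: map (addn 2) A] (map (addn 2) B) = count [in A] B.
  move=> i2; rewrite -[RHS]cM; apply: eq_in_count => x /mapP[y _ ->] /=.
  by rewrite in_cons; case: i i2 => [|[]].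
have cc i j A B : (i < 2)%N -> (j < 2)%N ->
    count [in i :: map (addn 2) A] (j :: map (addn 2) B) =
    ((i == j) + count [in A] B)%N.
  move=> i2 j2; rewrite -[count _ (_ :: _)]/(_ + count _ _)%N (c2 _ _ _ i2).
  congr (nat_of_bool _ + _)%N.
  by rewrite in_cons; case: i j i2 j2 => [|[]//] [|[]//]; rewrite ?n0 ?n1.
have term (p q : R * seq nat) :
    p.1 * q.1 * zeta (count [in 0%N :: map (addn 2) p.2]
      (0%N :: map (addn 2) q.2)) +
    p.1 * - q.1 * zeta (count [in 0%N :: map (addn 2) p.2]
      (1%N :: map (addn 2) q.2)) +
    (- p.1 * q.1 * zeta (count [in 1%N :: map (addn 2) p.2]
      (0%N :: map (addn 2) q.2)) +
    - p.1 * - q.1 * zeta (count [in 1%N :: map (addn 2) p.2]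
      (1%N :: map (addn 2) q.2))) =
    2 * (p.1 * q.1 * fdiff zeta (count [in p.2] q.2)).
  by rewrite !cc//= add0n add1n /fdiff; ring.
have sumL' (f : R * seq nat -> R) : \sum_(p <- L') f p = \sum_(p <- L)
    (f (p.1, 0%N :: map (addn 2) p.2) + f (- p.1, 1%N :: map (addn 2) p.2)).
  by rewrite big_cat/= !big_map -big_split.
suff -> : \sum_(p <- L') \sum_(q <- L')
      p.1 * q.1 * zeta (count [in p.2] q.2) =
    2 * \sum_(p <- L) \sum_(q <- L)
      p.1 * q.1 * fdiff zeta (count [in p.2] q.2) by rewrite pmulr_rge0.
rewrite sumL' mulr_sumr; apply: eq_bigr => p _.
by rewrite !sumL' mulr_sumr -big_split; apply: eq_bigr => q _; rewrite -term.
Qed.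

(** For k > 0, m + 1 pairwise disjoint sets of weight 1 give (m + 1)(zeta(k) + m zeta(0)) >= 0, and
    letting m grow excludes a negative zeta(0). For k = 0 the empty set alone is a test vector. *)
Lemma subset_psd_ge0 k zeta : subset_psd k zeta -> 0 <= zeta 0%N.
Proof.
move=> psd; case: k psd => [|k] psd.
  have := psd [:: (1, [::])]; rewrite !big_seq1/= !mul1r; apply.
  by move=> p; rewrite inE => /eqP ->.
suff key (m : nat) : 0 <= zeta k.+1 + m%:R * zeta 0%N.
  rewrite leNgt; apply/negP => z0.
  have := Num.Theory.archi_boundP (normr_ge0 (zeta k.+1 / zeta 0%N)).
  set m := Num.Def.archi_bound _ => mb; have := key m; rewrite leNgt => /negP; apply.
  move: mb; rewrite normrM normfV (ltr0_norm z0) ltr_pdivrMr ?oppr_gt0// => zk.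
  have := le_lt_trans (ler_norm _) zk; lra.
pose L := [seq (1 : R, iota (l * k.+1) k.+1) | l <- iota 0 m.+1].
have /psd : forall p, p \in L -> uniq p.2 /\ size p.2 = k.+1.
  by move=> p /mapP[l _ ->]/=; split; [exact: (iota_uniq _ k.+1)|rewrite size_iota].
have cnt i l : count [in iota (i * k.+1) k.+1] (iota (l * k.+1) k.+1) =
    (if l == i then k.+1 else 0)%N.
  move: k.+1 => K; case: eqVneq => [->|li].
    rewrite -[RHS](size_iota (i * K)); apply/eqP; rewrite -all_count.
    exact/allP.
  apply/eqP; rewrite -leqn0 leqNgt -has_count; apply/hasPn => x /=.
  by rewrite !mem_iota; nia.
rewrite /L big_map; under eq_bigr do rewrite big_map.
rewrite (eq_big_seq (fun=> zeta k.+1 + m%:R * zeta 0%N)).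
  by rewrite big_const_seq count_predT size_iota iter_addr_0 pmulrn_lge0.
move=> i im; under eq_bigr do rewrite !mul1r cnt.
rewrite (bigD1_seq i) ?iota_uniq//= eqxx; congr (_ + _).
rewrite (eq_bigr (fun=> zeta 0%N)); last by move=> l /negbTE ->.
rewrite big_const_seq iter_addr_0 mulr_natl; congr (_ *+ _).
have := count_predC (pred1 i) (iota 0 m.+1).
by rewrite count_uniq_mem ?iota_uniq// im size_iota add1n => -[].
Qed.

Lemma subset_psd_iter_fdiff k zeta j : (j <= k)%N -> subset_psd k zeta ->
  0 <= iter j fdiff zeta 0%N.
Proof.
move=> jk psd; apply: (@subset_psd_ge0 (k - j)%N).
elim: j jk => [|j ih] jk; first by rewrite subn0.
by apply: subset_psd_fdiff; rewrite subnSK//; apply/ih/ltnW.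
Qed.

(** Newton's forward difference formula. The range may end at any m >= c, the extra binomials being
    zero, so that one range of j serves all intersection sizes c <= k at once. *)
Lemma newton_forward zeta c m : (c <= m)%N ->
  zeta c = \sum_(j < m.+1) 'C(c, j)%:R * iter j fdiff zeta 0%N.
Proof.
have main c' z : z c' = \sum_(j < c'.+1) 'C(c', j)%:R * iter j fdiff z 0%N.
  elim: c' z => [|c' ih] z; first by rewrite big_ord1 bin0 mul1r.
  have -> : z c'.+1 = z c' + fdiff z c' by rewrite /fdiff; ring.
  rewrite (ih z) (ih (fdiff z)) [RHS]big_ord_recl/= bin0.
  under [X in _ = _ + X]eq_bigr do rewrite binS natrD mulrDl -iterS iterSr.
  rewrite big_split/= addrA; congr (_ + _).
  rewrite [in RHS]big_ord_recr/= bin_small// mul0r addr0 big_ord_recl bin0.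
  by congr (_ + _); apply: eq_bigr => j _; rewrite -iterSr.
move=> cm; rewrite {1}main (big_ord_widen m.+1 (fun j => 'C(c, j)%:R * iter j fdiff zeta 0%N))//.
rewrite [RHS](bigID (fun i : 'I_m.+1 => (i < c.+1)%N))/= [X in _ = _ + X]big1 ?addr0//.
by move=> i; rewrite -leqNgt => ci; rewrite bin_small// mul0r.
Qed.

(** Complementation maps these sets onto the subsets of [~: J] of size #|T| - k. *)
Lemma card_supersets (T : finType) (J : {set T}) k : (k <= #|T|)%N ->
  (#|J| <= k)%N ->
  #|[set A : {set T} | (#|A| == k) && (J \subset A)]%SET| =
  'C(#|T| - #|J|, k - #|J|).
Proof.
move=> kT Jk; rewrite -bin_sub; last exact: leq_sub2r.
rewrite subnBA// subnK ?(leq_trans Jk)//.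
have -> : (#|T| - #|J| = #|~: J|)%N by rewrite [in RHS]cardsCs finset.setCK.
rewrite -cards_draws -(card_imset _ (@finset.setC_inj T)); apply: eq_card => A.
rewrite [in RHS]inE; apply/imsetP/andP => [[B]|[AJ /eqP cA]].
  rewrite inE => /andP[/eqP cB JB] ->.
  by rewrite finset.setCS cardsCs finset.setCK cB.
exists (~: A); last by rewrite finset.setCK.
rewrite inE -finset.setCS finset.setCK AJ andbT cardsCs finset.setCK cA subKn//.
Qed.

(** Double counting: 'C(#|A :&: B|, j) is the number of j-sets J inside both A and B. Summing over J
    last, each J leaves 'C(#|T| - j, k - j) choices for A and as many for B. *)
Lemma sum_bin_setI (T : finType) k j : (j <= k)%N -> (k <= #|T|)%N ->
  (\sum_(A : {set T} | #|A| == k) \sum_(B : {set T} | #|B| == k)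
    'C(#|A :&: B|, j) = 'C(#|T|, j) * 'C(#|T| - j, k - j) ^ 2)%N.
Proof.
move=> jk kT.
transitivity (\sum_(A : {set T} | #|A| == k) \sum_(B : {set T} | #|B| == k)
    \sum_(J : {set T} | #|J| == j) ((J \subset A) * (J \subset B)))%N.
  apply: eq_bigr => A _; apply: eq_bigr => B _.
  rewrite -cards_draws -sum1_card big_mkcond [RHS]big_mkcond/=.
  apply: eq_bigr => J _; rewrite inE finset.subsetI.
  by do 3![case: (_ \subset _) || case: (_ == _)].
under eq_bigr do rewrite exchange_big/=.
rewrite exchange_big/= -card_draws -[in RHS]sum1_card big_distrl/=.
rewrite [RHS]big_mkcond [LHS]big_mkcond/=; apply: eq_bigr => J _; rewrite inE.
case: eqP => // cJ; rewrite mul1n.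
under eq_bigr do rewrite -big_distrr/=.
rewrite -big_distrl/= -mulnn -cJ -card_supersets ?cJ// -sum1_card.
by congr (_ * _)%N; rewrite [LHS]big_mkcond [RHS]big_mkcond/=;
  apply: eq_bigr => A _; rewrite inE; case: (_ == _); case: (_ \subset _).
Qed.

(** The ratio 'C(k, j) / 'C(n, j) is the product of (k - i) / (n - i) over i < j. The first two
    factors are at most k/n and the others at most 1. *)
Lemma bin_ratio_le n k j : (2 <= j <= k)%N -> (k <= n)%N ->
  ('C(k, j) * n ^ 2 <= k ^ 2 * 'C(n, j))%N.
Proof.
move=> /andP[j2 jk] kn; elim: j j2 jk => // j ih; rewrite ltnS => j1 jk.
move: j1; rewrite leq_eqVlt => /predU1P[<-|j2].
  rewrite -(leq_pmul2l (m := 2))//.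
  have e m : (2 * 'C(m, 2) = m * m.-1)%N by rewrite mul_bin_left bin1 subn1 mulnC.
  rewrite mulnA e mulnCA e -!mulnn.
  have -> : (k * k.-1 * (n * n) = (k * n) * (k.-1 * n))%N by ring.
  have -> : (k * k * (n * n.-1) = (k * n) * (k * n.-1))%N by ring.
  by rewrite leq_mul2l; apply/orP; right; nia.
have {}ih := ih j2 (ltnW jk).
rewrite -(leq_pmul2l (m := j.+1))// mulnA mul_bin_left -mulnA.
apply: (leq_trans (leq_mul (leqnn _) ih)).
rewrite [leqRHS]mulnCA mul_bin_left mulnCA leq_mul2l.
by rewrite leq_mul ?orbT// leq_sub2r.
Qed.

(** The average equals the sum over j of 'C(k, j)^2 / 'C(n, j) times V_j, while zeta(k) is the sum
    of 'C(k, j) V_j. As V_0 and V_1 are nonnegative with sum zeta(1) = 0, only j >= 2 remains, and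
    there the quotient of the two weights is at most (k/n)^2. *)
Lemma subset_psd_avg k n zeta : (0 < k <= n)%N -> subset_psd k zeta ->
  zeta 1%N = 0 ->
  ('C(n, k)%:R ^+ 2)^-1 *
    (\sum_(A : {set 'I_n} | #|A| == k) \sum_(B : {set 'I_n} | #|B| == k)
      zeta #|A :&: B|) <= (k%:R / n%:R) ^+ 2 * zeta k.
Proof.
move=> /andP[k0 kn] psd z1.
pose V j := iter j fdiff zeta 0%N.
have V0 j : (j <= k)%N -> 0 <= V j by move=> jk; exact: subset_psd_iter_fdiff psd.
have n0 : (0 < n)%N by exact: leq_trans kn.
have z0 : V 0%N = 0.
  apply/eqP; rewrite eq_le V0// andbT.
  by have := V0 1%N k0; rewrite /V/= /fdiff z1 sub0r oppr_ge0.
have v1 : V 1%N = 0.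
  by rewrite /V/= /fdiff z1 -[zeta 0%N]/(V 0%N) z0 subrr.
have C0 : 'C(n, k)%:R != 0 :> R by rewrite pnatr_eq0 -lt0n bin_gt0.
rewrite ler_pdivrMl ?exprn_gt0 ?lt0r ?C0 ?ler0n//.
under eq_bigr => A /eqP cA.
  under eq_bigr => B cB do rewrite (@newton_forward zeta _ k)
    ?(leq_trans (subset_leq_card (finset.subsetIl A B))) ?cA//.
  over.
under eq_bigr do rewrite exchange_big/=.
rewrite exchange_big/= [in leRHS](@newton_forward zeta k k)//.
rewrite !mulr_sumr; apply: ler_sum => j _; rewrite -/(V j).
under eq_bigr do rewrite -mulr_suml -natr_sum.
rewrite -mulr_suml -natr_sum sum_bin_setI ?card_ord//; last first.
  by rewrite -ltnS.
have [j2|] := leqP 2 j; last first.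
  by case: (j : nat) => [|[]]// _; rewrite ?z0 ?v1 !mulr0.
have jk : (j <= k)%N by rewrite -ltnS.
have -> : 'C(n, k)%:R ^+ 2 * ((k%:R / n%:R) ^+ 2 * ('C(k, j)%:R * V j)) =
    'C(n, k)%:R ^+ 2 * k%:R ^+ 2 * 'C(k, j)%:R / n%:R ^+ 2 * V j.
  by field; rewrite pnatr_eq0 -lt0n.
apply: ler_wpM2r; first exact: V0.
rewrite ler_pdivlMr ?exprn_gt0 ?ltr0n//.
rewrite -!natrX -!natrM ler_nat.
(* Both sides count the pairs of a k-subset of an n-set and a j-subset of it. *)
have e : ('C(n, j) * 'C(n - j, k - j) = 'C(n, k) * 'C(k, j))%N.
  have [jn] : (j <= n)%N by exact: leq_trans jk kn.
  apply/eqP; rewrite -(eqn_pmul2r (_ : 0 < j`! * (k - j)`! * (n - k)`!))%N; last first.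
    by rewrite !muln_gt0 !fact_gt0.
  have := bin_fact jn; have := bin_fact kn; have := bin_fact jk.
  have knj : (k - j <= n - j)%N by exact: leq_sub2r.
  have := bin_fact knj; rewrite subnBA// subnK//.
  move=> e1 e2 e3 e4; apply/eqP.
  transitivity ('C(n, j) * (j`! * ('C(n - j, k - j) * ((k - j)`! * (n - k)`!))))%N; first ring.
  rewrite e1 e4 -e3 -e2; ring.
have r := @bin_ratio_le n k j (introT andP (conj j2 jk)) kn.
have Cnj : (0 < 'C(n, j))%N by rewrite bin_gt0 (leq_trans jk).
rewrite -(leq_pmul2l Cnj).
have -> : ('C(n, j) * ('C(n, j) * 'C(n - j, k - j) ^ 2 * n ^ 2) =
  (('C(n, j) * 'C(n - j, k - j)) ^ 2 * n ^ 2))%N by ring.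
rewrite e.
have -> : (('C(n, k) * 'C(k, j)) ^ 2 * n ^ 2 =
   'C(n, k) ^ 2 * 'C(k, j) * ('C(k, j) * n ^ 2))%N by ring.
have -> : ('C(n, j) * ('C(n, k) ^ 2 * k ^ 2 * 'C(k, j)) =
  'C(n, k) ^ 2 * 'C(k, j) * (k ^ 2 * 'C(n, j)))%N by ring.
by rewrite leq_mul2l r orbT.
Qed.

(** The right-hand side is the sum over j >= 1 of k 'C(k - 1, j - 1) V_j = j 'C(k, j) V_j. It
    dominates the Newton sum of zeta(k) because V_0 = 0 and the other V_j are nonnegative. *)
Lemma subset_psd_top k zeta : (0 < k)%N -> subset_psd k zeta ->
  zeta 1%N = 0 -> zeta k <= k%:R * (zeta k - zeta k.-1).
Proof.
case: k => // k _ psd z1.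
pose V j := iter j fdiff zeta 0%N.
have V0 j : (j <= k.+1)%N -> 0 <= V j by move=> jk; exact: subset_psd_iter_fdiff psd.
have z0 : V 0%N = 0.
  apply/eqP; rewrite eq_le V0// andbT.
  by have := V0 1%N isT; rewrite /V/= /fdiff z1 sub0r oppr_ge0.
rewrite (@newton_forward zeta k.+1 k.+1)// (@newton_forward zeta k k.+1)//=.
rewrite -sumrB mulr_sumr; apply: ler_sum => j _; rewrite -/(V j) -mulrBl mulrA.
case: j => -[|j] /= jk; first by rewrite z0 !mulr0.
apply: ler_wpM2r; first exact: V0.
rewrite binS natrD addrAC subrr add0r -natrM -natrD -binS.
by rewrite (mul_bin_diag k.+1) ler_nat leq_pmull.
Qed.

End subset_kernels.

Lemma cvg_pinfty0 (R : realType) (f : R -> R) (C : R) :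
  (forall x, 1 <= x -> `|f x| <= C / x) -> f x @[x --> +oo] --> (0 : R).
Proof.
move=> fC; apply/cvgrPdist_le => e e0; near=> x.
have x1 : 1 <= x by near: x; exact: nbhs_pinfty_ge.
rewrite sub0r normrN (le_trans (fC _ x1))// ler_pdivrMr ?(lt_le_trans ltr01)//.
by rewrite mulrC -ler_pdivrMr//; near: x; exact: nbhs_pinfty_ge.
Unshelve. all: by end_near. Qed.

(** * Moments and convolution of normal laws *)

Section normal_moments.
Variable R : realType.
Notation mu := (@lebesgue_measure R).

Lemma ge0_integral_normal_probe (m s : R) (f : R -> \bar R) :
  measurable_fun setT f -> (forall x, 0 <= f x)%E ->
  (\int[normal_prob m s]_x f x =
   \int[mu]_x (f x * (normal_pdf m s x)%:E))%E.
Proof.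
move=> mf f0; have dom := normal_prob_dominates m s.
rewrite -(@Radon_Nikodym_SigmaFinite.change_of_variables _ _ _
  (normal_prob m s) mu dom f)//=.
have mpdf : measurable_fun setT (fun x => (normal_pdf m s x)%:E).
  by apply/measurable_EFinP; exact: measurable_normal_pdf.
apply: ae_eq_integral => //.
- apply: emeasurable_funM => //.
  exact: measurable_int (Radon_Nikodym_SigmaFinite.f_integrable dom).
- exact: emeasurable_funM.
- apply: ae_eqe_mul2l; apply: integral_ae_eq => //.
  + exact: Radon_Nikodym_SigmaFinite.f_integrable.
  + by move=> E _ mE; rewrite -Radon_Nikodym_SigmaFinite.f_integral.
Qed.

Lemma ge0_integral_normal_prob (m s : R) (f : R -> R) :
  measurable_fun setT f -> (forall x, 0 <= f x) ->
  (\int[normal_prob m s]_x (f x)%:E =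
   \int[mu]_x (f x * normal_pdf m s x)%:E)%E.
Proof.
move=> mf f0; rewrite ge0_integral_normal_probe//.
- exact/measurable_EFinP.
Qed.

Variables (s : R).
Hypothesis s0 : 0 < s.

Let E (x : R) := expR (- (x ^+ 2 / (s ^+ 2 *+ 2))).

Let s2 : s ^+ 2 *+ 2 != 0.
Proof. by rewrite mulrn_eq0/= expf_eq0/= gt_eqF. Qed.

Let E0 x : 0 < E x. Proof. exact: expR_gt0. Qed.

Let Ege0 x : 0 <= E x. Proof. exact: expR_ge0. Qed.

Let dE (x : R) : is_derive x 1 E (- (x / s ^+ 2) * E x).
Proof.
have h : is_derive x 1 (fun x : R => - (x ^+ 2 / (s ^+ 2 *+ 2))) (- (x / s ^+ 2)).
  apply: is_derive_eq.
  rewrite /GRing.scale/=.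
  field; rewrite gt_eqF//.
apply: is_derive_eq.
by rewrite mulrC.
Qed.

Let cE : continuous E.
Proof. by move=> x; apply/differentiable_continuous/derivable1_diffP; exact: ex_derive. Qed.

(** With a = x^2 / (2 s^2), exp(a) >= a^2 / 2 = x^4 / (8 s^4). This decay makes the boundary terms
    at infinity vanish. *)
Let E_le (x : R) : 0 < x -> E x <= 8 * s ^+ 4 / x ^+ 4.
Proof.
move=> x0; rewrite /E expRN.
have a0 : 0 < x ^+ 2 / (s ^+ 2 *+ 2) by rewrite divr_gt0 ?mulrn_wgt0 ?exprn_gt0.
have : (x ^+ 2 / (s ^+ 2 *+ 2)) ^+ 2 / 2 <= expR (x ^+ 2 / (s ^+ 2 *+ 2)).
  apply: le_trans (expR_ge1Dxn 1 (ltW a0)); rewrite (_ : 2`! = 2%N)//.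
  by rewrite lerDr.
rewrite -lef_pV2 ?posrE ?expR_gt0 ?divr_gt0 ?exprn_gt0//.
move=> /le_trans; apply; rewrite le_eqVlt; apply/orP; left; apply/eqP.
by field; rewrite !gt_eqF.
Qed.

Let cvg_at_right_cont (f : R -> R) a : continuous f -> f x @[x --> a^'+] --> f a.
Proof. by move=> cf; apply: cvg_at_right_filter; exact: cf. Qed.

Let cvg_at_left_cont (f : R -> R) a : continuous f -> f x @[x --> a^'-] --> f a.
Proof. by move=> cf; apply: cvg_at_left_filter; exact: cf. Qed.

Let continuous_of_derive (f df : R -> R) :
  (forall x : R, is_derive x 1 f (df x)) -> continuous f.
Proof.
move=> h x; apply/differentiable_continuous/derivable1_diffP.
by case: (h x).
Qed.

Let ftc2y (f F : R -> R) a : (forall x, a <= x -> 0 <= f x) -> continuous f ->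
  (forall x : R, is_derive x 1 F (f x)) -> F x @[x --> +oo] --> 0 ->
  (\int[mu]_(x in `[a, +oo[) (f x)%:E = (- F a)%:E)%E.
Proof.
move=> f0 cf dF F0; rewrite (ge0_continuous_FTC2y f0 _ F0) ?sub0e//.
- exact: continuous_subspaceT.
- by apply: cvg_at_right_cont; exact: continuous_of_derive dF.
- by move=> x _; rewrite derive1E; case: (dF x).
Qed.

Let ftc2 (f F : R -> R) a b : a < b -> continuous f ->
  (forall x : R, is_derive x 1 F (f x)) ->
  (\int[mu]_(x in `[a, b]) (f x)%:E = (F b - F a)%:E)%E.
Proof.
move=> ab cf dF; have cF := continuous_of_derive dF.
rewrite (@continuous_FTC2 _ f F) ?EFinB//.
- exact: continuous_subspaceT.
- split; [|exact: cvg_at_right_cont|exact: cvg_at_left_cont].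
  by move=> x _; case: (dF x).
- by move=> x _; rewrite derive1E; case: (dF x).
Qed.

Let cxE n : continuous (fun x : R => x ^+ n * E x).
Proof. by move=> x; apply: cvgM; [exact: exprn_continuous|exact: cE]. Qed.

Let dF1 (x : R) : is_derive x 1 (fun x => - (s ^+ 2 * (x * E x)))
  ((x ^+ 2 - s ^+ 2) * E x).
Proof.
apply: is_derive_eq; rewrite /GRing.scale/= -/(E x).
by field; rewrite gt_eqF.
Qed.

Let dF3 (x : R) : is_derive x 1
  (fun x => - (s ^+ 2 * ((x ^+ 2 + 2 * s ^+ 2) * E x))) (x ^+ 3 * E x).
Proof.
apply: is_derive_eq; rewrite /GRing.scale/= -/(E x).
by field; rewrite gt_eqF.
Qed.

Let sqrE0 : x ^+ 2 * E x @[x --> +oo] --> (0 : R).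
Proof.
apply: (@cvg_pinfty0 _ _ (8 * s ^+ 4)) => x x1; have x0 := lt_le_trans ltr01 x1.
rewrite ger0_norm; last by rewrite mulr_ge0 ?sqr_ge0.
apply: (le_trans (ler_wpM2l (sqr_ge0 _) (E_le x0))).
have -> : x ^+ 2 * (8 * s ^+ 4 / x ^+ 4) = 8 * s ^+ 4 * (x^-1 * x^-1).
  by field; rewrite gt_eqF.
apply: ler_wpM2l; first by rewrite mulr_ge0// exprn_ge0// ltW.
by rewrite ler_piMr ?invr_ge0 ?(ltW x0)// invf_le1.
Qed.

Let xE0 n : (n <= 2)%N -> x ^+ n * E x @[x --> +oo] --> (0 : R).
Proof.
move=> n2; apply: (@squeeze_cvgr _ _ _ _ (fun=> 0) (fun x => x ^+ 2 * E x)).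
- near=> x; have x1 : 1 <= x by near: x; exact: nbhs_pinfty_ge.
  have x0 := le_trans ler01 x1.
  by rewrite mulr_ge0 ?exprn_ge0 ?Ege0//= ler_wpM2r ?Ege0// ler_weXn2l.
- exact: cvg_cst.
- exact: sqrE0.
Unshelve. all: by end_near. Qed.

Let m0y := (\int[mu]_(x in `[0%R, +oo[) (E x)%:E)%E.

Let meas (f : R -> R) A : continuous f -> measurable A ->
  measurable_fun A (fun x : R => (f x)%:E).
Proof.
move=> cf mA; apply/measurable_funTS/measurable_EFinP.
exact: continuous_measurable_fun.
Qed.

Let split0y (f : R -> R) : continuous f -> (forall x, 0 <= x -> 0 <= f x) ->
  (\int[mu]_(x in `[0%R, +oo[) (f x)%:E = \int[mu]_(x in `[0%R, s]) (f x)%:E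
    + \int[mu]_(x in `[s, +oo[) (f x)%:E)%E.
Proof.
move=> cf f0.
rewrite -[X in (_ + X)%E]integral_itv_obnd_cbnd; last exact: meas.
have -> : `[0, +oo[%classic = `[0, s]%classic `|` `]s, +oo[%classic.
  apply/seteqP; split => x /=; rewrite !in_itv/= ?andbT.
    by case: (leP x s) => xs x0; [left; rewrite x0|right].
  by case=> [/andP[]//|/ltW]; exact/le_trans/ltW.
rewrite ge0_integral_setU//=.
- by apply: meas => //; exact: measurableU.
- move=> x; rewrite !in_itv/= andbT lee_fin => -[/andP[x0 _]|/ltW sx].
    exact: f0.
  exact/f0/(le_trans _ sx)/ltW.
- apply/disj_setPS => x [] /=; rewrite !in_itv/= andbT => /andP[_ xs].
  by rewrite ltNge xs.
Qed.

(** The function (x^2 - s^2) E(x) has the antiderivative - s^2 x E(x) but changes sign at s, whereas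
    the fundamental theorem on a half-line is applied to nonnegative integrands. Hence the split at
    s: both pieces produce the same k = s^3 E(s), which lands once on each side of the equation. *)
Let sqr_half : (\int[mu]_(x in `[0%R, +oo[) (x ^+ 2 * E x)%:E =
  (s ^+ 2)%:E * m0y)%E.
Proof.
have cM : continuous (fun x : R => s ^+ 2 * E x).
  by move=> x; apply: cvgM; [exact: cvg_cst|exact: cE].
have cp : continuous (fun x : R => (x ^+ 2 - s ^+ 2) * E x).
  move=> x; under eq_fun do rewrite mulrBl.
  by apply: cvgB; [exact: cxE|exact: cM].
have cn : continuous (fun x : R => (s ^+ 2 - x ^+ 2) * E x).
  move=> x; under eq_fun do rewrite mulrBl.
  by apply: cvgB; [exact: cM|exact: cxE].
rewrite /m0y -ge0_integralZl//=; first last.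
- by rewrite lee_fin sqr_ge0.
- by move=> x _; rewrite lee_fin Ege0.
- exact: meas.
under [RHS]eq_integral do rewrite -EFinM.
rewrite !split0y//; [|by move=> *; rewrite mulr_ge0 ?sqr_ge0 ?Ege0..].
pose k := (s ^+ 2 * (s * E s))%:E.
have -> : (\int[mu]_(x in `[0%R, s]) (s ^+ 2 * E x)%:E =
    k + \int[mu]_(x in `[0%R, s]) (x ^+ 2 * E x)%:E)%E.
  have -> : k = (\int[mu]_(x in `[0%R, s]) ((s ^+ 2 - x ^+ 2) * E x)%:E)%E.
    have d (x : R) : is_derive x 1 (fun x => s ^+ 2 * (x * E x))
        ((s ^+ 2 - x ^+ 2) * E x).
      have := is_deriveN (dF1 x); rewrite -mulNr opprB; congr is_derive.
      by apply/funext => y /=; rewrite opprK.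
    by rewrite (ftc2 _ cn d)// mul0r mulr0 subr0.
  rewrite -ge0_integralD//=.
  - by apply: eq_integral => x _; rewrite -EFinD -mulrDl subrK.
  - move=> x; rewrite in_itv/= => /andP[x0 xs].
    by rewrite lee_fin mulr_ge0 ?Ege0// subr_ge0 ler_sqr// nnegrE ltW.
  - exact: meas.
  - by move=> x _; rewrite lee_fin mulr_ge0 ?sqr_ge0 ?Ege0.
  - exact: meas.
have -> : (\int[mu]_(x in `[s, +oo[) (x ^+ 2 * E x)%:E =
    k + \int[mu]_(x in `[s, +oo[) (s ^+ 2 * E x)%:E)%E.
  have p0 x : s <= x -> 0 <= (x ^+ 2 - s ^+ 2) * E x.
    move=> sx; rewrite mulr_ge0 ?Ege0// subr_ge0 ler_sqr// nnegrE ltW//.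
    exact: lt_le_trans sx.
  have -> : k = (\int[mu]_(x in `[s, +oo[) ((x ^+ 2 - s ^+ 2) * E x)%:E)%E.
    rewrite (ftc2y p0 cp dF1) ?opprK//.
    rewrite -oppr0; apply: cvgN; rewrite -(mulr0 (s ^+ 2)).
    by apply: cvgM; [exact: cvg_cst|exact: (@xE0 1)].
  rewrite -ge0_integralD//=.
  - by apply: eq_integral => x _; rewrite -EFinD -mulrDl subrK.
  - by move=> x; rewrite in_itv/= andbT => /p0; rewrite lee_fin.
  - exact: meas.
  - by move=> x _; rewrite lee_fin mulr_ge0 ?sqr_ge0 ?Ege0.
  - exact: meas.
by rewrite addeCA addeA.
Qed.

Let cube_half : (\int[mu]_(x in `[0%R, +oo[) (x ^+ 3 * E x)%:E =
  (2 * s ^+ 4)%:E)%E.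
Proof.
rewrite (ftc2y _ (@cxE 3) dF3).
- by rewrite opprK /E expr0n/= mul0r oppr0 expR0; congr EFin; ring.
- by move=> x x0; rewrite mulr_ge0 ?exprn_ge0 ?Ege0.
- rewrite -oppr0; apply: cvgN; rewrite -[X in _ --> X](mulr0 (s ^+ 2)).
  apply: cvgM; first exact: cvg_cst.
  have -> : (fun x => (x ^+ 2 + 2 * s ^+ 2) * E x) =
      (fun x => x ^+ 2 * E x + 2 * s ^+ 2 * (x ^+ 0 * E x)).
    by apply/funext => x; rewrite expr0 mul1r mulrDl.
  rewrite -[X in _ --> X](addr0 0); apply: cvgD; first exact: sqrE0.
  rewrite -[X in _ --> X](mulr0 (2 * s ^+ 2)).
  by apply: cvgM; [exact: cvg_cst|exact: xE0].
Qed.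

Let pdfE (x : R) : normal_pdf 0 s x = normal_peak s * E x.
Proof.
by rewrite normal_pdfE ?gt_eqF// /normal_fun /E subr0 mulNr.
Qed.

Let integral_normal_even (f : R -> R) : continuous f -> (forall x, 0 <= f x) ->
  f =1 f \o -%R ->
  (\int[normal_prob 0 s]_x (f x)%:E =
   (2 * normal_peak s)%:E * \int[mu]_(x in `[0%R, +oo[) (f x * E x)%:E)%E.
Proof.
move=> cf f0 fN; rewrite ge0_integral_normal_prob//; last first.
  exact: continuous_measurable_fun.
have cp : continuous (fun x => f x * normal_pdf 0 s x).
  by move=> x; apply: cvgM; [exact: cf|exact/continuous_normal_pdf/lt0r_neq0].
rewrite ge0_symfun_integralT//; first last.
- by move=> x /=; have /= <- := fN x; rewrite !pdfE /E sqrrN.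
- by move=> x; rewrite mulr_ge0// normal_pdf_ge0.
rewrite -set_itvcy EFinM -muleA; congr (_ * _)%E.
rewrite -ge0_integralZl//=.
- by apply: eq_integral => x _; rewrite -EFinM pdfE mulrCA.
- apply: meas => //.
  by move=> x; apply: cvgM; [exact: cf|exact: cE].
- by move=> x _; rewrite lee_fin mulr_ge0.
- by rewrite lee_fin normal_peak_ge0.
Qed.

Lemma integral_normal_sqr :
  (\int[normal_prob 0 s]_x (x ^+ 2)%:E = (s ^+ 2)%:E)%E.
Proof.
rewrite integral_normal_even; first last.
- by move=> x /=; rewrite sqrrN.
- exact: sqr_ge0.
- exact: exprn_continuous.
rewrite sqr_half muleCA -[RHS]mule1; congr (_ * _)%E.
(* The same formula at f = 1 identifies 2 [normal_peak s] times [m0y] with the total mass 1, so the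
   Gaussian integral need not be evaluated. *)
have := @integral_normal_even (fun=> 1) (fun=> cvg_cst _) (fun=> ler01) (fun=> erefl).
rewrite integral_cst//= probability_setT mule1 => ->; congr (_ * _)%E.
by apply: eq_integral => x _; rewrite mul1r.
Qed.

(** The exact value is 4 s^4 [normal_peak s], and s [normal_peak s] = 1 / sqrt(2 pi) <= 1. *)
Lemma integral_normal_norm3 :
  (\int[normal_prob 0 s]_x (`|x| ^+ 3)%:E <= (4 * s ^+ 3)%:E)%E.
Proof.
rewrite integral_normal_even; first last.
- by move=> x /=; rewrite normrN.
- by move=> x; rewrite exprn_ge0.
- move=> x; apply: (@continuous_comp _ _ _ (fun x : R => `|x|) (fun x => x ^+ 3)).
    exact: norm_continuous.
  exact: exprn_continuous.
under eq_integral.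
  move=> x; rewrite inE/= in_itv/= andbT => x0; rewrite ger0_norm//; over.
rewrite cube_half -EFinM lee_fin.
have -> : 2 * normal_peak s * (2 * s ^+ 4) = (4 * s ^+ 3) * (s * normal_peak s).
  by ring.
rewrite ler_piMr ?mulr_ge0 ?exprn_ge0 ?(ltW s0)//.
rewrite /normal_peak ler_pdivrMr; last first.
  by rewrite sqrtr_gt0 mulrn_wgt0// mulr_gt0 ?exprn_gt0 ?pi_gt0.
rewrite mul1r -[leLHS]ger0_norm ?(ltW s0)// -sqrtr_sqr ler_wsqrtr//.
rewrite -mulrnAr ler_peMr ?sqr_ge0// -mulr_natr.
by have := @pi_ge2 R; lra.
Qed.

Lemma integrable_normal_id :
  (normal_prob 0 s).-integrable setT (fun x : R => x%:E).
Proof.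
apply/integrableP; split.
  by apply/measurable_EFinP; exact: measurable_id.
apply: (@le_lt_trans _ _ (\int[normal_prob 0 s]_x (1%:E + (x ^+ 2)%:E))%E).
  apply: ge0_le_integral => //=.
  - by apply/measurable_EFinP; exact: normr_measurable.
  - apply: emeasurable_funD => //; apply/measurable_EFinP.
    exact: measurable_funX.
  - move=> x _; rewrite -EFinD lee_fin.
    by have := sqr_ge0 (`|x| - 1); rewrite sqrrB1 real_normK ?num_real//; nra.
rewrite ge0_integralD//=.
- by rewrite integral_cst//= probability_setT mul1e integral_normal_sqr -EFinD ltry.
- by move=> x _; rewrite lee_fin sqr_ge0.
- by apply/measurable_EFinP; exact: measurable_funX.
Qed.

Lemma integral_normal_id : (\int[normal_prob 0 s]_x x%:E = 0)%E.
Proof.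
have fin := integrable_normal_id.
rewrite integralE.
suff -> : (\int[normal_prob 0 s]_x (EFin^\+ x) =
    \int[normal_prob 0 s]_x (EFin^\- x))%E.
  rewrite subee// ge0_fin_numE; last exact: integral_ge0.
  exact: integral_funeneg_lt_pinfty fin.
have e1 : (EFin : R -> \bar R)^\+%E = (fun x : R => (Num.max x 0)%:E).
  by apply/funext => x; rewrite funeposE EFin_max.
have e2 : (EFin : R -> \bar R)^\-%E = (fun x : R => (Num.max (- x) 0)%:E).
  by apply/funext => x; rewrite funenegE EFin_max.
rewrite e1 e2 !ge0_integral_normal_prob//; first last.
- by move=> x; rewrite le_max lexx orbT.
- exact: measurable_funrpos (@measurable_id _ _ _).
- by move=> x; rewrite le_max lexx orbT.
- exact: measurable_funrneg (@measurable_id _ _ _).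
transitivity (\int[mu]_(x in `[0%R, +oo[) (x * normal_pdf 0 s x)%:E)%E.
  rewrite [RHS]integral_mkcond; apply: eq_integral => x _.
  rewrite patchE; case: ifPn; rewrite ?inE ?notin_setE/= in_itv/= andbT.
    by move=> x0; rewrite max_l.
  by move=> /negP; rewrite -ltNge => /ltW x0; rewrite max_r// mul0r.
transitivity (\int[mu]_(x in `]-oo, 0%R]) (- x * normal_pdf 0 s x)%:E)%E; last first.
  rewrite [LHS]integral_mkcond; apply: eq_integral => x _.
  rewrite patchE; case: ifPn; rewrite ?inE ?notin_setE/= in_itv/=.
    by move=> x0; rewrite max_l// oppr_ge0.
  by move=> /negP; rewrite -ltNge => x0; rewrite max_r ?mul0r// oppr_le0 ltW.
rewrite -[X in `]-oo, X]]oppr0 ge0_integration_by_substitutionNy.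
- by apply: eq_integral => x _ /=; rewrite opprK !pdfE /E sqrrN.
- apply: continuous_subspaceT => x; apply: cvgM; first exact: oppr_continuous.
  exact/continuous_normal_pdf/lt0r_neq0.
- move=> x; rewrite oppr0 in_itv/= => /ltW x0.
  by rewrite mulr_ge0 ?normal_pdf_ge0// oppr_ge0.
Qed.

End normal_moments.

Section normal_convolution.
Variable R : realType.
Notation mu := (@lebesgue_measure R).
Variables s t r : R.
Hypotheses (s0 : 0 < s) (t0 : 0 < t) (r0 : 0 < r) (rE : r ^+ 2 = s ^+ 2 + t ^+ 2).

(** Completing the square: the joint density of u and w - u is the density of their sum w times the
    conditional density of u given w, which is normal with mean w s^2 / r^2 and deviation s t / r.
    The latter integrates to 1 in u, which proves the convolution formula. *)
Let pdf_mul (w u : R) : normal_pdf 0 t (w - u) * normal_pdf 0 s u =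
  normal_pdf 0 r w * normal_pdf (w * s ^+ 2 / r ^+ 2) (s * t / r) u.
Proof.
have q0 : 0 < s * t / r by rewrite divr_gt0// mulr_gt0.
rewrite !normal_pdfE ?gt_eqF// mulrACA [RHS]mulrACA; congr (_ * _).
  have p0 (x : R) : 0 <= x ^+ 2 * pi *+ 2.
    by rewrite mulrn_wge0// mulr_ge0 ?sqr_ge0 ?pi_ge0.
  rewrite /normal_peak -!invfM -!sqrtrM//.
  have -> // : t ^+ 2 * pi *+ 2 * (s ^+ 2 * pi *+ 2) =
    r ^+ 2 * pi *+ 2 * ((s * t / r) ^+ 2 * pi *+ 2).
  by move: (@pi R) => p; field; rewrite gt_eqF.
rewrite /normal_fun -!expRD; congr expR; rewrite !mulNr.
have e : t ^+ 2 = r ^+ 2 - s ^+ 2 by rewrite rE; ring.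
have d : r ^+ 2 - s ^+ 2 != 0 by rewrite -e expf_eq0/= gt_eqF.
have -> : (s * t / r) ^+ 2 = s ^+ 2 * t ^+ 2 / r ^+ 2.
  by field; rewrite gt_eqF.
rewrite e; field.
by rewrite !(gt_eqF s0) !(gt_eqF r0) /= ?andbT.
Qed.

Let shift1 u : (+%R u : R -> R)^`()%classic = cst 1.
Proof.
apply/funext => y; rewrite derive1E deriveD// derive_cst add0r.
exact: derive_id.
Qed.

Lemma normal_convolution (f : R -> R) : continuous f -> (forall x, 0 <= f x) ->
  (\int[normal_prob 0 s]_u \int[normal_prob 0 t]_v (f (u + v))%:E =
   \int[normal_prob 0 r]_w (f w)%:E)%E.
Proof.
move=> cf f0; have mf := continuous_measurable_fun cf.
have mpdf m q := @measurable_normal_pdf R m q.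
transitivity (\int[normal_prob 0 s]_u
    \int[mu]_w (f w * normal_pdf 0 t (w - u))%:E)%E.
  apply: eq_integral => u _.
  have mfu : measurable_fun setT (fun v => f (u + v)).
    by apply: measurableT_comp => //; exact: measurable_funD.
  rewrite (ge0_integral_normal_prob 0 t mfu (fun v => f0 (u + v))).
  have -> : (\int[mu]_w (f w * normal_pdf 0 t (w - u))%:E =
      \int[mu]_v (((fun w => f w * normal_pdf 0 t (w - u)) \o +%R u) v *
        (+%R u : R -> R)^`()%classic v)%:E)%E.
    apply: increasing_ge0_integration_by_substitutionT.
    - by move=> x y; rewrite ltrD2l.
    - by rewrite shift1 => x; exact: cvg_cst.
    - by rewrite shift1; exact: is_cvg_cst.
    - by rewrite shift1; exact: is_cvg_cst.
    - by move=> x; apply: derivableD.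
    - exact: cvg_addrl_Ny.
    - exact: cvg_addrl.
    - move=> x; apply: cvgM; first exact: cf.
      apply: (@continuous_comp _ _ _ (fun x : R => x - u) (normal_pdf 0 t)).
        by apply: cvgB; [exact: cvg_id|exact: cvg_cst].
      exact/continuous_normal_pdf/lt0r_neq0.
    - by move=> x; rewrite mulr_ge0// normal_pdf_ge0.
  by apply: eq_integral => v _; rewrite shift1 /cst/= mulr1 addrAC subrr add0r.
have mfw : measurable_fun setT (fun p : R * R => f p.2).
  exact: measurableT_comp.
have mpt : measurable_fun setT (fun p : R * R => normal_pdf 0 t (p.2 - p.1)).
  apply: measurableT_comp => //; exact: measurable_funB.
rewrite ge0_integral_normal_probe; first last.
- move=> u; apply: integral_ge0 => w _.
  by rewrite lee_fin mulr_ge0// normal_pdf_ge0.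
- apply: (measurable_fun_fubini_tonelli_F (m2 := mu)
    (fun p : R * R => (f p.2 * normal_pdf 0 t (p.2 - p.1))%:E)).
    by apply/measurable_EFinP; exact: measurable_funM.
  by move=> p; rewrite lee_fin mulr_ge0// normal_pdf_ge0.
transitivity (\int[mu]_u \int[mu]_w
    (f w * normal_pdf 0 t (w - u) * normal_pdf 0 s u)%:E)%E.
  apply: eq_integral => u _; rewrite -ge0_integralZr//=.
  - apply/measurable_EFinP/measurable_funM => //.
    by apply: measurableT_comp => //; exact: measurable_funB.
  - by move=> w _; rewrite lee_fin mulr_ge0// normal_pdf_ge0.
  - by rewrite lee_fin normal_pdf_ge0.
have /= -> := @fubini_tonelli _ _ _ _ R mu mu (fun p : R * R =>
    (f p.2 * normal_pdf 0 t (p.2 - p.1) * normal_pdf 0 s p.1)%:E); first last.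
- by move=> p; rewrite lee_fin !mulr_ge0// normal_pdf_ge0.
- apply/measurable_EFinP/measurable_funM; first exact: measurable_funM.
  exact: measurableT_comp.
rewrite ge0_integral_normal_prob//.
apply: eq_integral => w _ /=.
under eq_integral => u _ do rewrite -mulrA pdf_mul mulrA EFinM.
rewrite ge0_integralZl//=.
- by rewrite integral_normal_pdf mule1.
- by apply/measurable_EFinP; exact: mpdf.
- by move=> u _; rewrite lee_fin normal_pdf_ge0.
- by rewrite lee_fin mulr_ge0// normal_pdf_ge0.
Qed.

End normal_convolution.

(** * Smoothed indicators and Lindeberg replacement *)

Section cubic_spline.
Variable R : realType.
Implicit Types t x y a b : R.

Definition cubp t := Num.max t 0 ^+ 3.

(** A C^2 cubic spline climbing from 0 to 1 on [0, 4]. The weights 1, -2, 2, -1 at the knots a = 0,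
    1, 3, 4 sum to zero against 1, a and a^2, so that for t >= 4 all powers of t cancel; against a^3
    they sum to -12, whence the divisor 12. *)
Definition spline t : R :=
  (cubp t - 2 * cubp (t - 1) + 2 * cubp (t - 3) - cubp (t - 4)) / 12.

Let cubp_pos t : 0 <= t -> cubp t = t ^+ 3.
Proof. by move=> t0; rewrite /cubp max_l. Qed.

Let cubp_neg t : t <= 0 -> cubp t = 0.
Proof. by move=> t0; rewrite /cubp max_r// expr0n. Qed.

Lemma spline_le0 t : t <= 0 -> spline t = 0.
Proof. by move=> t0; rewrite /spline !cubp_neg; lra. Qed.

Lemma spline_ge4 t : 4 <= t -> spline t = 1.
Proof. by move=> t4; rewrite /spline !cubp_pos; [field|lra..]. Qed.

Let case_spline (P : R -> Prop) : (forall t, t <= 0 -> P t) ->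
  (forall t, 0 <= t <= 1 -> P t) -> (forall t, 1 <= t <= 3 -> P t) ->
  (forall t, 3 <= t <= 4 -> P t) -> (forall t, 4 <= t -> P t) -> forall t, P t.
Proof.
move=> h0 h1 h2 h3 h4 t; have [/h0//|t0] := lerP t 0.
have [t1|t1] := lerP t 1; first by apply: h1; rewrite ltW.
have [t2|t2] := lerP t 3; first by apply: h2; rewrite ltW.
have [t3|t3] := lerP t 4; first by apply: h3; rewrite ltW.
by apply: h4; rewrite ltW.
Qed.

Lemma spline_itv t : 0 <= spline t <= 1.
Proof.
move: t; apply: case_spline => t.
- by move/spline_le0 => ->; rewrite lexx ler01.
- move=> ht; have [t0 t1] := andP ht.
  by rewrite /spline cubp_pos// !(@cubp_neg (_ - _)); [nra|lra..].
- move=> ht; have [t0 t1] := andP ht.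
  rewrite /spline (@cubp_neg (t - 3)) ?(@cubp_neg (t - 4)) ?cubp_pos; [|lra..].
  have : 0 <= (t - 1) ^+ 2 * (4 - t) by apply: mulr_ge0; [exact: sqr_ge0|lra].
  have : 0 <= (3 - t) * (3 + t * (3 - t)) by apply: mulr_ge0; nra.
  by move=> *; nra.
- move=> ht; have [t0 t1] := andP ht.
  rewrite /spline (@cubp_neg (t - 4)) ?cubp_pos; [|lra..].
  have -> : t ^+ 3 - 2 * (t - 1) ^+ 3 + 2 * (t - 3) ^+ 3 - 0 = 12 - (4 - t) ^+ 3.
    by ring.
  have v0 : 0 <= 4 - t by lra.
  have : (4 - t) ^+ 3 <= 1 by rewrite exprn_ile1//; lra.
  have := exprn_ge0 3 v0; lra.
- by move/spline_ge4 => ->; rewrite lexx ler01.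
Qed.

(** The derivative of [cubp] and, in [d2], half of its second derivative: the coefficients of y and
    y^2 in the Taylor expansion. *)
Let d1 t := 3 * Num.max t 0 ^+ 2.
Let d2 t := 3 * Num.max t 0.

Let cubp_taylor x y :
  `|cubp (x + y) - cubp x - d1 x * y - d2 x * y ^+ 2| <= `|y| ^+ 3.
Proof.
rewrite /cubp /d1 /d2.
have [x0|x0] := leP x 0; have [xy|xy] := leP (x + y) 0.
- by rewrite !expr0n/= !(mulr0, mul0r) !subr0 normr0 exprn_ge0.
- have y0 : 0 < y by lra.
  rewrite !expr0n/= !(mulr0, mul0r) !subr0 normrX lerXn2r ?nnegrE//.
  by rewrite !gtr0_norm//; lra.
- have y0 : y < 0 by lra.
  have -> : 0 ^+ 3 - x ^+ 3 - 3 * x ^+ 2 * y - 3 * x * y ^+ 2 =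
    (- (x + y)) ^+ 3 - (- y) ^+ 3 by ring.
  have w0 : 0 <= - (x + y) by lra.
  have : (- (x + y)) ^+ 3 <= (- y) ^+ 3 by rewrite lerXn2r ?nnegrE//; lra.
  have := exprn_ge0 3 w0.
  by rewrite (ltr0_norm y0) ler_norml => ? ?; apply/andP; split; lra.
- rewrite (_ : _ - _ = y ^+ 3) ?normrX//; ring.
Qed.

Let D1 t := (d1 t - 2 * d1 (t - 1) + 2 * d1 (t - 3) - d1 (t - 4)) / 12.
Let D2 t := (d2 t - 2 * d2 (t - 1) + 2 * d2 (t - 3) - d2 (t - 4)) / 12.

Let D1_le1 t : `|D1 t| <= 1.
Proof.
rewrite /D1 /d1; move: t; apply: case_spline => t ht; rewrite ler_norml.
- by rewrite !max_r; [rewrite !expr0n/=; lra|lra..].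
- have [t0 t1] := andP ht.
  rewrite (@max_l _ _ t)// !max_r; [rewrite !expr0n/=|lra..]; nra.
- have [t0 t1] := andP ht.
  rewrite (@max_r _ _ (t - 3)) ?(@max_r _ _ (t - 4)) ?max_l; [|lra..].
  rewrite !expr0n/=; nra.
- have [t0 t1] := andP ht.
  rewrite (@max_r _ _ (t - 4)) ?max_l; [|lra..].
  rewrite !expr0n/=; nra.
- rewrite !max_l; [|lra..]; nra.
Qed.

Let D2_le1 t : `|D2 t| <= 1.
Proof.
rewrite /D2 /d2; move: t; apply: case_spline => t ht; rewrite ler_norml.
- by rewrite !max_r; lra.
- have [t0 t1] := andP ht.
  rewrite (@max_l _ _ t)// !max_r; lra.
- have [t0 t1] := andP ht.
  rewrite (@max_r _ _ (t - 3)) ?(@max_r _ _ (t - 4)) ?max_l; lra.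
- have [t0 t1] := andP ht.
  rewrite (@max_r _ _ (t - 4)) ?max_l; lra.
- rewrite !max_l; lra.
Qed.

(** The cubic remainder has constant (1 + 2 + 2 + 1) / 12 = 1/2. For |y| > 1 the increment of the
    spline, the linear term and the quadratic term are each at most y^2, whence the factor 3. *)
Lemma spline_taylor x : exists A B, forall y,
  `|spline (x + y) - spline x - A * y - B * y ^+ 2| <=
  3 * Num.min (y ^+ 2) (`|y| ^+ 3).
Proof.
exists (D1 x), (D2 x) => y; rewrite minr_pMr//.
set r := (X in `|X|).
have r3 : `|r| <= `|y| ^+ 3.
  pose r0 x := cubp (x + y) - cubp x - d1 x * y - d2 x * y ^+ 2.
  have -> : r = (r0 x - 2 * r0 (x - 1) + 2 * r0 (x - 3) - r0 (x - 4)) / 12.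
    by rewrite /r /r0 /spline /D1 /D2 !(addrAC x y); field.
  have := cubp_taylor (x - 4) y; have := cubp_taylor (x - 3) y.
  have := cubp_taylor (x - 1) y; have := cubp_taylor x y.
  rewrite -!/(r0 _) !ler_norml => /andP[? ?] /andP[? ?] /andP[? ?] /andP[? ?].
  by apply/andP; split; lra.
have y3 : 0 <= `|y| ^+ 3 by rewrite exprn_ge0.
rewrite le_min; apply/andP; split; last by lra.
have [y1|y1] := lerP `|y| 1.
  apply: (le_trans r3); rewrite -(real_normK (num_real y)).
  have : `|y| ^+ 3 <= `|y| ^+ 2 by rewrite ler_wiXn2l.
  by have := sqr_ge0 `|y|; lra.
have := spline_itv (x + y); have := spline_itv x.
move=> /andP[? ?] /andP[? ?].
have h1 : `|D1 x * y| <= `|y| by rewrite normrM ler_piMl.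
have h2 : `|D2 x * y ^+ 2| <= y ^+ 2.
  by rewrite normrM (ger0_norm (sqr_ge0 y)) ler_piMl// sqr_ge0.
have h3 : `|y| <= y ^+ 2 by rewrite -(real_normK (num_real y)) expr2 ler_peMl// ltW.
move: h1 h2; rewrite !ler_norml /r => /andP[? ?] /andP[? ?].
by apply/andP; split; lra.
Qed.

Lemma continuous_spline : continuous spline.
Proof.
have cc a : continuous (fun t => cubp (t - a)).
  move=> t; apply: (@continuous_comp _ _ _ (fun t => Num.max (t - a) 0) (fun t => t ^+ 3)).
    apply: continuous_max; last exact: cvg_cst.
    by apply: cvgB; [exact: cvg_id|exact: cvg_cst].
  exact: exprn_continuous.
have c0 : continuous cubp by move=> t; have := cc 0 t; under eq_fun do rewrite subr0.
move=> t; apply: cvgM; last exact: cvg_cst.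
apply: cvgB; last exact: cc.
apply: cvgD; last by apply: cvgM; [exact: cvg_cst|exact: cc].
apply: cvgB; first exact: c0.
by apply: cvgM; [exact: cvg_cst|exact: cc].
Qed.

(** A smoothed indicator of the half-line t <= a. The parameter b is the steepness: the descent from
    1 to 0 takes place on [a, a + 4/b]. *)
Definition smooth_step a b t : R := 1 - spline (b * (t - a)).

Lemma smooth_step_itv a b t : 0 <= smooth_step a b t <= 1.
Proof. by rewrite /smooth_step; have := spline_itv (b * (t - a)); lra. Qed.

Lemma smooth_step_le a b t : 0 <= b -> t <= a -> smooth_step a b t = 1.
Proof.
by move=> b0 ta; rewrite /smooth_step spline_le0 ?subr0// mulr_ge0_le0// subr_le0.
Qed.

Lemma smooth_step_ge a b t : 0 < b -> a + 4 / b <= t -> smooth_step a b t = 0.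
Proof.
move=> b0 ta; rewrite /smooth_step spline_ge4 ?subrr// -ler_pdivrMl//.
by rewrite mulrC lerBrDl.
Qed.

Lemma continuous_smooth_step a b : continuous (smooth_step a b).
Proof.
move=> t; apply: cvgB; first exact: cvg_cst.
apply: (@continuous_comp _ _ _ (fun t => b * (t - a)) spline).
  by apply: cvgM; [exact: cvg_cst|apply: cvgB; [exact: cvg_id|exact: cvg_cst]].
exact: continuous_spline.
Qed.

Lemma smooth_step_taylor a b x : 0 < b -> exists A B, forall y,
  `|smooth_step a b (x + y) - smooth_step a b x - A * y - B * y ^+ 2| <=
  (3 * (b ^+ 2 + b ^+ 3)) * Num.min (y ^+ 2) (`|y| ^+ 3).
Proof.
move=> b0; have [A [B AB]] := spline_taylor (b * (x - a)).
exists (- (A * b)), (- (B * b ^+ 2)) => y.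
have -> : smooth_step a b (x + y) - smooth_step a b x - - (A * b) * y -
    - (B * b ^+ 2) * y ^+ 2 = - (spline (b * (x - a) + b * y) -
    spline (b * (x - a)) - A * (b * y) - B * (b * y) ^+ 2).
  by rewrite /smooth_step -mulrDr (addrAC x); ring.
rewrite normrN; apply: (le_trans (AB _)); rewrite -mulrA ler_pM2l//.
have b2 : 0 < b ^+ 2 by rewrite exprn_gt0.
have b3 : 0 < b ^+ 3 by rewrite exprn_gt0.
have y2 := sqr_ge0 y; have y3 : 0 <= `|y| ^+ 3 by rewrite exprn_ge0.
rewrite normrM !exprMn (gtr0_norm b0) minr_pMr; last by rewrite addr_ge0 ?ltW.
by rewrite le_min !ge_min; apply/andP; split; apply/orP; [left|right];
  rewrite ler_wpM2r// ?lerDl ?lerDr ltW.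
Qed.

End cubic_spline.

(** * Averaging over a random shift *)

Section shift_average.
Variable R : realType.

Definition unit_valued (f : R -> R) :=
  measurable_fun setT f /\ forall x, 0 <= f x <= 1.

(** Adding one more independent copy of phi to a sum amounts to applying this operator once more to
    f. Lindeberg's replacement thereby becomes a comparison of powers of two such operators. *)
Definition shift_avg d (T : measurableType d) (P : probability T R)
  (phi : T -> R) (f : R -> R) (x : R) : R := \int[P]_z f (x + phi z).

Lemma Rintegral_probability_cst d (T : measurableType d) (P : probability T R)
  (c : R) : \int[P]_z c = c.
Proof. by rewrite /Rintegral integral_cst//= probability_setT mule1. Qed.

Section shift_average_step.
Context d (T : measurableType d) (P : probability T R) (phi : T -> R).
Hypothesis mphi : measurable_fun setT phi.

Lemma unit_valued_integrable (f : R -> R) x : unit_valued f ->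
  P.-integrable setT (fun z => (f (x + phi z))%:E).
Proof.
move=> [mf f01].
have mfx : measurable_fun setT (fun z => f (x + phi z)).
  by apply: measurableT_comp => //; exact: measurable_funD.
apply: (@le_integrable _ _ _ P _ measurableT _ (cst 1%E)).
- exact/measurable_EFinP.
- move=> z _ /=; rewrite lee_fin normr1 ger0_norm.
    by have /andP[] := f01 (x + phi z).
  by have /andP[] := f01 (x + phi z).
- exact: finite_measure_integrable_cst.
Qed.

Lemma shift_avgE f x : unit_valued f ->
  (shift_avg P phi f x)%:E = (\int[P]_z (f (x + phi z))%:E)%E.
Proof.
move=> uf; rewrite /shift_avg /Rintegral fineK//.
exact: integrable_fin_num (unit_valued_integrable x uf).
Qed.

Lemma unit_valued_shift_avg f : unit_valued f -> unit_valued (shift_avg P phi f).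
Proof.
move=> uf; have [mf f01] := uf; split; last first.
  move=> x; apply/andP; split.
    by apply: Rintegral_ge0 => z _; have /andP[] := f01 (x + phi z).
  rewrite -[leRHS](Rintegral_probability_cst P).
  apply: le_Rintegral => //.
  - exact: unit_valued_integrable.
  - exact: finite_measure_integrable_cst.
  - by move=> z _; have /andP[] := f01 (x + phi z).
apply/measurable_EFinP.
have -> : EFin \o shift_avg P phi f =
    (fun x => \int[P]_z ((fun p : R * T => (f (p.1 + phi p.2))%:E) (x, z)))%E.
  by apply/funext => x /=; rewrite shift_avgE.
apply: (@measurable_fun_fubini_tonelli_F _ _ _ _ _ P
  (fun p : R * T => (f (p.1 + phi p.2))%:E)).
  apply/measurable_EFinP; apply: measurableT_comp => //.
  by apply: measurable_funD => //; exact: measurableT_comp.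
by move=> p; rewrite lee_fin; have /andP[] := f01 (p.1 + phi p.2).
Qed.

Lemma unit_valued_iter_shift_avg m f : unit_valued f ->
  unit_valued (iter m (shift_avg P phi) f).
Proof. by move=> uf; elim: m => //= m ih; exact: unit_valued_shift_avg. Qed.

Lemma shift_avg_dist f g e : unit_valued f -> unit_valued g ->
  (forall x, `|f x - g x| <= e) ->
  forall x, `|shift_avg P phi f x - shift_avg P phi g x| <= e.
Proof.
move=> uf ug fg x.
have fi := unit_valued_integrable x uf; have gi := unit_valued_integrable x ug.
rewrite /shift_avg -RintegralB//.
apply: (le_trans (le_normr_Rintegral measurableT (integrableB measurableT fi gi))).
rewrite -[leRHS](Rintegral_probability_cst P).
apply: le_Rintegral => //; first exact: integrable_norm (integrableB measurableT fi gi).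
exact: finite_measure_integrable_cst.
Qed.

(* Matching the first two moments, only the Taylor remainder contributes. *)
Lemma shift_avg_taylor (f : R -> R) x A B v (r : R -> R) K rho :
  unit_valued f -> measurable_fun setT r -> (forall y, 0 <= r y) -> 0 <= K ->
  (forall y, `|f (x + y) - f x - A * y - B * y ^+ 2| <= K * r y) ->
  P.-integrable setT (EFin \o phi) -> (\int[P]_z (phi z)%:E = 0)%E ->
  (\int[P]_z (phi z ^+ 2)%:E = v%:E)%E ->
  (\int[P]_z (r (phi z))%:E <= rho%:E)%E ->
  `|shift_avg P phi f x - (f x + B * v)| <= K * rho.
Proof.
move=> uf mr r0 K0 fr iphi phi0 phi2 rrho.
have fi := unit_valued_integrable x uf.
have i2 : P.-integrable setT (fun z => (phi z ^+ 2)%:E).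
  apply/integrableP; split; first by apply/measurable_EFinP; exact: measurable_funX.
  under eq_integral do rewrite gee0_abs ?lee_fin ?sqr_ge0//.
  by rewrite phi2 ltry.
have mrphi : measurable_fun setT (fun z => r (phi z)) by exact: measurableT_comp.
have ir : P.-integrable setT (fun z => (K * r (phi z))%:E).
  under eq_fun do rewrite EFinM.
  apply: integrableZl => //; apply/integrableP; split.
    exact/measurable_EFinP.
  under eq_integral do rewrite gee0_abs ?lee_fin//.
  by apply: (le_lt_trans rrho); rewrite ltry.
have icst c : P.-integrable setT (fun=> c%:E).
  exact: finite_measure_integrable_cst.
have iA : P.-integrable setT (fun z => (A * phi z)%:E).
  by under eq_fun do rewrite EFinM; exact: integrableZl.
have iB : P.-integrable setT (fun z => (B * phi z ^+ 2)%:E).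
  by under eq_fun do rewrite EFinM; exact: integrableZl.
have i1 := integrableB measurableT fi (icst (f x)).
have i3 := integrableB measurableT i1 iA.
have i4 := integrableB measurableT i3 iB.
have -> : shift_avg P phi f x - (f x + B * v) =
    \int[P]_z (f (x + phi z) - f x - A * phi z - B * phi z ^+ 2).
  rewrite (RintegralB measurableT i3 iB) (RintegralB measurableT i1 iA).
  rewrite (RintegralB measurableT fi (icst (f x))) Rintegral_probability_cst.
  rewrite !RintegralZl//.
  have -> : \int[P]_z phi z = 0 by rewrite /Rintegral phi0.
  have -> : \int[P]_z (phi z ^+ 2) = v by rewrite /Rintegral phi2.
  by rewrite mulr0 subr0 opprD addrA.
apply: (le_trans (le_normr_Rintegral measurableT i4)).
apply: (le_trans (@le_Rintegral _ _ _ P setT _ (fun z => K * r (phi z)) _ _ _ _)) => //.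
- exact: integrable_norm i4.
rewrite RintegralZl//; last first.
  apply/integrableP; split; first exact/measurable_EFinP.
  under eq_integral do rewrite gee0_abs ?lee_fin//.
  by apply: (le_lt_trans rrho); rewrite ltry.
apply: ler_wpM2l => //; rewrite /Rintegral -[leRHS]/(fine rho%:E).
apply: fine_le => //; apply/fin_numPlt; rewrite (le_lt_trans rrho) ?ltry// andbT.
by rewrite (lt_le_trans ltNy0)// integral_ge0// => z _; rewrite lee_fin.
Qed.

End shift_average_step.

Section shift_average_comm.
Context d d' (T : measurableType d) (T' : measurableType d').
Variables (P : probability T R) (Q : probability T' R).
Variables (phi : T -> R) (psi : T' -> R).
Hypotheses (mphi : measurable_fun setT phi) (mpsi : measurable_fun setT psi).

Lemma shift_avgC f : unit_valued f ->
  shift_avg P phi (shift_avg Q psi f) = shift_avg Q psi (shift_avg P phi f).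
Proof.
move=> uf; apply/funext => x; apply: EFin_inj.
rewrite !shift_avgE//; [|exact: unit_valued_shift_avg..].
under eq_integral do rewrite shift_avgE//.
under [RHS]eq_integral do rewrite shift_avgE//.
have [mf f01] := uf.
have /= -> := @fubini_tonelli _ _ _ _ R P Q
  (fun p : T * T' => (f (x + phi p.1 + psi p.2))%:E).
- by apply: eq_integral => z _; apply: eq_integral => y _; rewrite addrAC.
- apply/measurable_EFinP; apply: measurableT_comp => //.
  apply: measurable_funD; last exact: measurableT_comp.
  by apply: measurable_funD => //; exact: measurableT_comp.
- by move=> p; rewrite lee_fin; have /andP[] := f01 (x + phi p.1 + psi p.2).
Qed.

(** For the two operators T and G, T^m - G^m telescopes into m terms with one factor T - G each. The
    operators commute by Fubini's theorem and do not increase the sup distance, so the one-step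
    bound is needed for [f] alone and not for its intermediate averages. *)
Lemma iter_shift_avg_dist e m f : unit_valued f ->
  (forall x, `|shift_avg P phi f x - shift_avg Q psi f x| <= e) ->
  forall x, `|iter m (shift_avg P phi) f x - iter m (shift_avg Q psi) f x| <=
    m%:R * e.
Proof.
elim: m f => [|m ih] f uf fe x; first by rewrite /= subrr normr0 mul0r.
have uT := unit_valued_shift_avg P mphi uf.
have uG := unit_valued_shift_avg Q mpsi uf.
rewrite !iterSr -(subrKA (iter m (shift_avg P phi) (shift_avg Q psi f) x)).
rewrite (le_trans (ler_normD _ _))// mulrS mulrDl mul1r lerD//.
  elim: m x {ih} => [|m ih] x; first exact: fe.
  by rewrite !iterS; apply: shift_avg_dist => //; exact: unit_valued_iter_shift_avg.
apply: ih => // y.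
by rewrite shift_avgC//; apply: shift_avg_dist.
Qed.

End shift_average_comm.

End shift_average.

Section lindeberg.
Variable R : realType.

Lemma iter_normal_shift_avg (s : R) m (f : R -> R) : 0 < s -> unit_valued f ->
  continuous f -> iter m.+1 (shift_avg (normal_prob 0 s) (fun y => y)) f =
  shift_avg (normal_prob 0 (Num.sqrt m.+1%:R * s)) (fun y => y) f.
Proof.
move=> s0 uf cf; elim: m => [|m ih]; first by rewrite sqrtr1 mul1r.
have t0 k : 0 < Num.sqrt k.+1%:R * s by rewrite mulr_gt0// sqrtr_gt0.
rewrite iterS ih; apply/funext => x; apply: EFin_inj.
have [mf f01] := uf.
have mid : measurable_fun setT (fun y : R => y) by exact: measurable_id.
have ug := unit_valued_shift_avg (normal_prob 0 (Num.sqrt m.+1%:R * s)) mid uf.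
apply: (etrans (shift_avgE (normal_prob 0 s) mid x ug)).
apply/esym/(etrans (shift_avgE (normal_prob 0 (Num.sqrt m.+2%:R * s)) mid x uf)).
transitivity (\int[normal_prob 0 s]_u \int[normal_prob 0 (Num.sqrt m.+1%:R * s)]_v
    (f (x + u + v))%:E)%E; last first.
  apply: eq_integral => u _.
  exact/esym/(shift_avgE (normal_prob 0 (Num.sqrt m.+1%:R * s)) mid (x + u) uf).
apply/esym.
have cfx : continuous (fun y => f (x + y)).
  move=> y; apply: (@continuous_comp _ _ _ (fun y => x + y) f); last exact: cf.
  by apply: cvgD; [exact: cvg_cst|exact: cvg_id].
have r2 : (Num.sqrt m.+2%:R * s) ^+ 2 = s ^+ 2 + (Num.sqrt m.+1%:R * s) ^+ 2.
  rewrite (exprMn _ _ s) [in RHS]exprMn (sqr_sqrtr (ler0n R m.+2)).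
  by rewrite (sqr_sqrtr (ler0n R m.+1)) [in LHS]mulrS mulrDl mul1r.
have fx0 y : 0 <= f (x + y) by have /andP[] := f01 (x + y).
apply: (etrans _ (normal_convolution s0 (t0 m) (t0 m.+1) r2 cfx fx0)).
by apply: eq_integral => u _; apply: eq_integral => v _; rewrite addrA.
Qed.

Lemma unit_valued_smooth_step (a b : R) : unit_valued (smooth_step a b).
Proof.
split; last exact: smooth_step_itv.
apply: continuous_measurable_fun; exact: continuous_smooth_step.
Qed.

Let rem_measurable : measurable_fun setT (fun y : R => Num.min (y ^+ 2) (`|y| ^+ 3)).
Proof.
apply: measurable_minr; first exact: measurable_funX.
by apply: measurable_funX; exact: normr_measurable.
Qed.

(* Splitting at |y| = eps. *)
Let rem_le (eps delta y : R) : 0 < eps -> 0 < delta ->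
  Num.min (y ^+ 2) (`|y| ^+ 3) <=
  eps * y ^+ 2 + eps `^ (- delta) * `|y| `^ (2 + delta).
Proof.
move=> e0 d0; have y2 := sqr_ge0 y; rewrite ge_min.
have p0 : 0 <= eps `^ (- delta) * `|y| `^ (2 + delta).
  by rewrite mulr_ge0// powR_ge0.
have [ye|ye] := leP `|y| eps.
  apply/orP; right; rewrite exprS real_normK ?num_real//.
  by rewrite (le_trans (ler_wpM2r y2 ye))// lerDl.
apply/orP; left; have y0 : 0 < `|y| by exact: lt_trans ye.
apply: (@le_trans _ _ (eps `^ (- delta) * `|y| `^ (2 + delta))); last first.
  by rewrite lerDr mulr_ge0// ltW.
rewrite powRD ?(gt_eqF y0) ?implybT// powR_mulrn ?(ltW y0)//.
rewrite real_normK ?num_real// mulrCA ler_peMr// powRN mulrC.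
rewrite ler_pdivlMr ?powR_gt0// mul1r ge0_ler_powR ?nnegrE ?(ltW ye)//.
- exact: ltW.
- exact: ltW.
Qed.

(** There are n replacements of phi by a normal variable of variance 1/n. Each costs two Taylor
    remainders: that of phi, at most eps / n + eps^(-delta) L after splitting at level eps, and the
    normal one, at most 4 n^(-3/2). *)
Lemma lindeberg_smooth_step d (T : measurableType d) (P : probability T R)
  (phi : T -> R) n a b delta eps L : (0 < n)%N -> measurable_fun setT phi ->
  P.-integrable setT (EFin \o phi) -> (\int[P]_z (phi z)%:E = 0)%E ->
  (\int[P]_z (phi z ^+ 2)%:E = (n%:R^-1)%:E)%E ->
  (\int[P]_z (`|phi z| `^ (2 + delta))%:E <= L%:E)%E ->
  0 < b -> 0 < delta -> 0 < eps ->
  `|iter n (shift_avg P phi) (smooth_step a b) 0 -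
    \int[normal_prob 0 1]_y smooth_step a b y| <=
  n%:R * (3 * (b ^+ 2 + b ^+ 3) * (eps / n%:R + eps `^ (- delta) * L +
    4 * (Num.sqrt n%:R)^-1 ^+ 3)).
Proof.
move=> n0 mphi iphi phi0 phi2 phiL b0 d0 e0.
have N0 : 0 < n%:R :> R by rewrite ltr0n.
have us := unit_valued_smooth_step a b.
pose s : R := (Num.sqrt n%:R)^-1.
have s0 : 0 < s by rewrite invr_gt0 sqrtr_gt0.
have -> : \int[normal_prob 0 1]_y smooth_step a b y =
    iter n (shift_avg (normal_prob 0 s) (fun y => y)) (smooth_step a b) 0.
  have := iter_normal_shift_avg n.-1 s0 us (@continuous_smooth_step _ a b).
  rewrite (prednK n0) => ->; rewrite /s divff ?gt_eqF ?sqrtr_gt0//.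
  by rewrite /shift_avg; apply: eq_Rintegral => y _; rewrite add0r.
apply: iter_shift_avg_dist => // x.
have [A [B AB]] := smooth_step_taylor a x b0.
pose r (y : R) := Num.min (y ^+ 2) (`|y| ^+ 3).
have r0 y : 0 <= r y by rewrite /r le_min sqr_ge0 exprn_ge0.
have K0 : 0 <= 3 * (b ^+ 2 + b ^+ 3).
  by rewrite mulr_ge0// addr_ge0// exprn_ge0// ltW.
have m2 : measurable_fun setT (fun z => phi z ^+ 2) by exact: measurable_funX.
have mp : measurable_fun setT (fun z => `|phi z| `^ (2 + delta)).
  apply: (measurableT_comp (measurable_powR _)).
  by apply: measurableT_comp => //; exact: normr_measurable.
have h1 : (\int[P]_z (r (phi z))%:E <=
    (eps / n%:R + eps `^ (- delta) * L)%:E)%E.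
  apply: (@le_trans _ _ (\int[P]_z ((eps * phi z ^+ 2)%:E +
      (eps `^ (- delta) * `|phi z| `^ (2 + delta))%:E))%E).
    apply: ge0_le_integral => //.
    - by move=> z _; rewrite lee_fin.
    - by apply/measurable_EFinP; exact: measurableT_comp.
    - by apply: emeasurable_funD; apply/measurable_EFinP; exact: measurable_funM.
    - by move=> z _; rewrite -EFinD lee_fin rem_le.
  rewrite ge0_integralD//=; first last.
  - by apply/measurable_EFinP; exact: measurable_funM.
  - by move=> z _; rewrite lee_fin mulr_ge0 ?powR_ge0.
  - by apply/measurable_EFinP; exact: measurable_funM.
  - by move=> z _; rewrite lee_fin mulr_ge0 ?sqr_ge0 ?ltW.
  under eq_integral do rewrite EFinM.
  under [X in (_ + X)%E]eq_integral do rewrite EFinM.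
  rewrite !ge0_integralZl//=; first last.
  - by rewrite lee_fin ltW.
  - by move=> z _; rewrite lee_fin sqr_ge0.
  - exact/measurable_EFinP.
  - by rewrite lee_fin powR_ge0.
  - exact/measurable_EFinP.
  rewrite phi2 -EFinM EFinD leeD2l// EFinM lee_wpmul2l// lee_fin.
  exact: powR_ge0.
have h2 : (\int[normal_prob 0 s]_z (r z)%:E <= (4 * s ^+ 3)%:E)%E.
  apply: le_trans (integral_normal_norm3 s0); apply: ge0_le_integral => //.
  - by move=> z _; rewrite lee_fin.
  - exact/measurable_EFinP.
  - apply/measurable_EFinP; apply: measurable_funX; exact: normr_measurable.
  - by move=> z _; rewrite lee_fin ge_min lexx orbT.
have t1 := shift_avg_taylor mphi us rem_measurable r0 K0 AB iphi phi0 phi2 h1.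
have s2 : s ^+ 2 = n%:R^-1 by rewrite exprVn sqr_sqrtr ?ltW.
have n2 := integral_normal_sqr s0; rewrite s2 in n2.
have t2 := @shift_avg_taylor R _ _ (normal_prob 0 s) (fun y => y) (@measurable_id _ _ _)
  _ x A B _ r _ _ us rem_measurable r0 K0 AB (integrable_normal_id s0)
  (integral_normal_id s0) n2 h2.
(* Both one-step laws have mean 0 and variance 1/n, hence the same second-order value, through which
   the two averages are compared. *)
rewrite -(subrKA (smooth_step a b x + B / n%:R)).
by rewrite (le_trans (ler_normD _ _))// mulrDr lerD// distrC.
Qed.

End lindeberg.

(** * Convergence in distribution from smoothed indicators *)

Section convergence_in_distribution.
Variable R : realType.

Lemma prob_le_smooth_step d (T : measurableType d) (P : probability T R)
  (Y : T -> R) a b : measurable_fun setT Y -> 0 < b ->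
  (P [set w | Y w <= a]%R <= (\int[P]_w smooth_step a b (Y w))%:E
    <= P [set w | Y w <= a + 4 / b]%R)%E.
Proof.
move=> mY b0.
have mle c : measurable [set w | Y w <= c].
  by rewrite -[X in measurable X]setTI; exact: measurable_fun_le.
have us := unit_valued_smooth_step a b.
have := unit_valued_integrable P mY 0 us.
under eq_fun do rewrite add0r.
move=> si; rewrite /Rintegral fineK ?integrable_fin_num//.
have ind c : P [set w | Y w <= c] = (\int[P]_w (\1_[set w | Y w <= c] w)%:E)%E.
  by rewrite integral_indic// setIT.
have s01 := smooth_step_itv a b.
rewrite !ind; apply/andP; split; apply: ge0_le_integral => //.
- exact/measurable_EFinP/measurable_indic.
- exact: measurable_int si.
- move=> w _; rewrite lee_fin indicE; case: (boolP (w \in _)) => [|_].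
    by rewrite inE/= => Ya; rewrite smooth_step_le// ltW.
  by have /andP[] := s01 (Y w).
- by move=> w _; rewrite lee_fin; have /andP[] := s01 (Y w).
- exact: measurable_int si.
- exact/measurable_EFinP/measurable_indic.
- move=> w _; rewrite lee_fin indicE; case: (boolP (w \in _)) => [_|].
    by have /andP[] := s01 (Y w).
  rewrite notin_setE/= => /negP; rewrite -ltNge => /ltW aY.
  by rewrite smooth_step_ge.
Qed.

(** The step starting its descent at x lies above the indicator of y <= x, and the one starting at x
    - eta/2 lies below it. Their limits lie between the values of the limiting distribution function
    at x - eta/2 and x + eta/2, and continuity at x closes the gap. *)
Lemma cvg_in_distribution_smooth d (T : measurableType d) (P : probability T R)
  (X : nat -> {RV P >-> R}) (mu : probability (measurableTypeR R) R) :
  (forall a b, 0 < b -> \int[P]_w smooth_step a b (X m w) @[m --> \oo] -->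
    \int[mu]_y smooth_step a b y) ->
  cvg_in_distribution X mu.
Proof.
move=> h x cx.
pose G t : R := fine (mu `]-oo, t]%classic).
have GE t : mu `]-oo, t]%classic = (G t)%:E by rewrite /G fineK ?fin_num_measure.
have cE m t : cdf (X m) t = (fine (cdf (X m) t))%:E.
  by rewrite fineK// fin_num_measure.
have muE t : mu [set y | y <= t] = (G t)%:E.
  by rewrite -GE; congr (mu _); apply/seteqP; split => y /=; rewrite in_itv.
have cdfE m t : P [set w | X m w <= t] = (fine (cdf (X m) t))%:E.
  by rewrite -cE /cdf /distribution/= /pushforward; congr (P _);
    apply/seteqP; split => y /=; rewrite in_itv.
rewrite GE; under eq_fun do rewrite cE.
apply: cvg_EFin; first by near=> m.
apply/cvgrPdist_le => e e0 /=.
have e2 : 0 < e / 2 by rewrite divr_gt0.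
have : G t @[t --> x] --> G x.
  have : (G t)%:E @[t --> x] --> (G x)%:E.
    by rewrite -GE; under eq_fun do rewrite -GE.
  by move=> /fine_cvg.
move=> /cvgrPdist_le/(_ _ e2)/nbhs_ballP[eta /= eta0 heta].
(* With this steepness the descent has width 4/b = eta/2. *)
pose b := 4 / (eta / 2); have b0 : 0 < b by rewrite !divr_gt0.
have b4 : 4 / b = eta / 2 by rewrite /b; field; rewrite gt_eqF.
have near_x t : `|x - t| <= eta / 2 -> `|G x - G t| <= e / 2.
  move=> xt; apply: heta; rewrite /ball/= (le_lt_trans xt)//.
  by rewrite ltr_pdivrMr// ltr_pMr// ltr1n.
near=> m.
have up : `|\int[mu]_y smooth_step x b y - \int[P]_w smooth_step x b (X m w)| <= e / 2.
  by near: m; have /cvgrPdist_le := h x b b0; exact.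
have lo : `|\int[mu]_y smooth_step (x - eta / 2) b y -
    \int[P]_w smooth_step (x - eta / 2) b (X m w)| <= e / 2.
  by near: m; have /cvgrPdist_le := h (x - eta / 2) b b0; exact.
have mX : measurable_fun setT (X m) by exact: measurable_funPT.
have mid : measurable_fun setT (fun y : R => y) by exact: measurable_id.
have /andP[u1 _] := prob_le_smooth_step P x mX b0.
have /andP[_ u2] := prob_le_smooth_step mu x mid b0.
have /andP[_ l1] := prob_le_smooth_step P (x - eta / 2) mX b0.
have /andP[l2 _] := prob_le_smooth_step mu (x - eta / 2) mid b0.
rewrite cdfE lee_fin in u1; rewrite muE lee_fin b4 in u2.
rewrite b4 subrK cdfE lee_fin in l1; rewrite muE lee_fin in l2.
have g1 : `|G x - G (x + eta / 2)| <= e / 2.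
  apply: near_x; rewrite opprD addNKr normrN gtr0_norm//.
  by rewrite divr_gt0.
have g2 : `|G x - G (x - eta / 2)| <= e / 2.
  by apply: near_x; rewrite opprB addrC subrK gtr0_norm// divr_gt0.
move: up lo g1 g2; rewrite !ler_norml => /andP[? ?] /andP[? ?] /andP[? ?] /andP[? ?].
by apply/andP; split; lra.
Unshelve. all: by end_near. Qed.

End convergence_in_distribution.

(** * Integrals over iid samples *)

Section tuple_measure_unique.
Context d (T : measurableType d) (R : realType) (n : nat).

Definition box (B : 'I_n -> set T) : set (n.-tuple T) :=
  [set z | forall i, B i (tnth z i)].

Lemma measurable_box B : (forall i, measurable (B i)) -> measurable (box B).
Proof.
move=> mB; have -> : box B = \bigcap_(i in [set: 'I_n]) ((@tnth _ T ^~ i) @^-1` B i).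
  by apply/seteqP; split => z /= zB i; [move=> _|]; exact: zB.
apply: fin_bigcap_measurable => // i _.
by rewrite -[X in measurable X]setTI; exact: measurable_tnth.
Qed.

(** Boxes form a pi-system generating the product sigma-algebra: they are stable under intersection,
    and every preimage under a coordinate is a box. *)
Lemma tuple_measure_unique (m1 m2 : {measure set (n.-tuple T) -> \bar R}) :
  (m1 setT < +oo)%E ->
  (forall B, (forall i, measurable (B i)) -> m1 (box B) = m2 (box B)) ->
  forall A, measurable A -> m1 A = m2 A.
Proof.
move=> m1oo m12.
pose G := [set A | exists2 B, (forall i, measurable (B i)) & A = box B].
apply: (measure_unique G (fun=> setT)) => //.
- apply/seteqP; split.
    apply: smallest_sub; first exact: smallest_sigma_algebra.
    move=> A; rewrite -bigcup_seq/= => -[i _ [C mC <-]].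
    apply: sub_sigma_algebra; exists (fun j => if j == i then C else setT).
      by move=> j; case: ifP.
    rewrite setTI; apply/seteqP; split => z /=.
      by move=> Cz j; case: eqP => // ->.
    by move=> /(_ i); rewrite eqxx.
  apply: smallest_sub; first exact: sigma_algebra_measurable.
  by move=> _ [B mB ->]; exact: measurable_box.
- move=> _ _ [B mB ->] [C mC ->]; exists (fun i => B i `&` C i).
    by move=> i; exact: measurableI.
  apply/seteqP; split => z /=; first by move=> [zB zC] i; split.
  by move=> zBC; split => i; have [] := zBC i.
- move=> _; exists (fun=> setT); first by [].
  by apply/seteqP; split.
- by apply/seteqP; split => // z _; exists 0%N.
- by move=> _ [B mB ->]; exact: m12.
Qed.

End tuple_measure_unique.

Lemma integral_distributed d d' (T : measurableType d) (T' : measurableType d')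
  (R : realType) (P : probability T R) (F : probability T' R)
  (Y : {RV P >-> T'}) (f : T' -> \bar R) :
  (forall B, measurable B -> distribution P Y B = F B) ->
  measurable_fun setT f -> (\int[P]_w f (Y w) = \int[F]_z f z)%E.
Proof.
move=> YF mf.
have dist h : measurable_fun setT h -> (forall z, 0 <= h z)%E ->
    (\int[P]_w h (Y w) = \int[F]_z h z)%E.
  move=> mh h0; rewrite -(@ge0_integral_distribution _ _ _ _ _ P Y)//.
  by apply: eq_measure_integral => A mA _; exact: YF.
rewrite integralE [RHS]integralE.
rewrite -!dist//; [|exact: measurable_funeneg|exact: measurable_funepos].
congr (_ - _)%E; apply: eq_integral => w _.
- exact: (congr1 (fun h => h w) (funepos_comp f Y)).
- exact: (congr1 (fun h => h w) (funeneg_comp f Y)).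
Qed.

Section iid_sample.
Context (R : realType) d d' (T : measurableType d) (Xi : measurableType d').
Variables (P : probability T R) (F : probability Xi R).
Variable xi : nat -> {RV P >-> Xi}.

Definition sample n (s : n.-tuple nat) (w : T) : n.-tuple Xi :=
  map_tuple (fun i => xi i w) s.

Lemma measurable_sample n (s : n.-tuple nat) : measurable_fun setT (sample s).
Proof.
apply/measurable_fun_tnthP => i.
rewrite (_ : _ \o _ = xi (tnth s i)); first exact: measurable_funPT.
by apply/funext => w /=; rewrite tnth_map.
Qed.

HB.instance Definition _ n (s : n.-tuple nat) :=
  isMeasurableFun.Build _ _ _ _ (sample s) (measurable_sample s).

Definition law n (s : n.-tuple nat) : probability (n.-tuple Xi) R :=
  distribution P (sample s).

Lemma integral_law n (s : n.-tuple nat) (f : n.-tuple Xi -> \bar R) :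
  measurable_fun setT f ->
  (\int[P]_w f (sample s w) = \int[law s]_z f z)%E.
Proof. by move=> mf; exact: (integral_distributed (Y := sample s)). Qed.

Hypothesis xi_iid : iid F xi.

Lemma law_box n (s : n.-tuple nat) (B : 'I_n -> set Xi) : uniq s ->
  (forall i, measurable (B i)) ->
  law s (box B) = \big[*%E/1%E]_(i < n) F (B i).
Proof.
move=> us mB; have [ind id] := xi_iid.
(* The sets [B] are transported to the indices occurring in [s], with the whole space elsewhere;
   this is unambiguous because [s] has no duplicates. *)
pose B' j := oapp B setT (insub (index j s)).
have B'E (i : 'I_n) : B' (tnth s i) = B i.
  by rewrite /B' (tnth_nth 0%N) index_uniq ?size_tuple// valK.
have mB' j : measurable (B' j) by rewrite /B'; case: insubP => //= *.
have [J JE] : exists J : {fset nat}, forall j, (j \in J) = (j \in s).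
  by exists (seq_fset tt s) => j; rewrite seq_fsetE.
have := ind J B' mB'.
have -> : \bigcap_(j in [set` J]) (xi j @^-1` B' j) =
    sample s @^-1` box B.
  apply/seteqP; split => w /=.
    move=> h i; rewrite tnth_map -B'E; apply: h => /=.
    by rewrite JE; exact: mem_tnth.
  move=> h j /=; rewrite JE => /tnthP[i ->].
  by rewrite B'E; have := h i; rewrite tnth_map.
rewrite /law/= /distribution/= /pushforward/= => ->.
rewrite (perm_big s)/=; last first.
  by apply: uniq_perm => [||j]; [exact: fset_uniq|exact: us|rewrite -JE].
rewrite big_tuple; apply: eq_bigr => i _; rewrite B'E.
by rewrite -(id (tnth s i)).
Qed.

(** Exchangeability: on boxes the law depends only on the indices being distinct. This brings any
    configuration of sample points to standard indices. *)
Lemma law_uniq n (s s' : n.-tuple nat) A : uniq s -> uniq s' -> measurable A ->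
  law s A = law s' A.
Proof.
move=> us us'; apply: tuple_measure_unique.
  exact: (le_lt_trans (probability_le1 (law s) measurableT) (ltry 1)).
by move=> B mB; exact: (etrans (law_box us mB) (esym (law_box us' mB))).
Qed.

Lemma integral_sample_uniq n (s s' : n.-tuple nat) (f : n.-tuple Xi -> \bar R) :
  uniq s -> uniq s' -> measurable_fun setT f ->
  (\int[P]_w f (sample s w) = \int[P]_w f (sample s' w))%E.
Proof.
move=> us us' mf; rewrite !integral_law//.
by apply: eq_measure_integral => A mA _; exact: law_uniq.
Qed.

Definition tuple_cat n m (p : n.-tuple Xi * m.-tuple Xi) : (n + m).-tuple Xi :=
  cat_tuple p.1 p.2.

Definition tuple_split n m (z : (n + m).-tuple Xi) : n.-tuple Xi * m.-tuple Xi :=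
  ([tuple tnth z (lshift m i) | i < n], [tuple tnth z (rshift n i) | i < m]).

Lemma tuple_catK n m : cancel (@tuple_cat n m) (@tuple_split n m).
Proof.
by move=> [a b]; congr pair; apply: eq_from_tnth => i;
  rewrite tnth_mktuple ?tnth_lshift ?tnth_rshift.
Qed.

Lemma measurable_tuple_cat n m : measurable_fun setT (@tuple_cat n m).
Proof.
apply/measurable_fun_tnthP => i; case: (split_ordP i) => j ->.
  rewrite (_ : _ \o _ = (@tnth _ _ ^~ j) \o fst).
    by apply: measurableT_comp => //; exact: measurable_tnth.
  by apply/funext => p /=; rewrite tnth_lshift.
rewrite (_ : _ \o _ = (@tnth _ _ ^~ j) \o snd).
  by apply: measurableT_comp => //; exact: measurable_tnth.
by apply/funext => p /=; rewrite tnth_rshift.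
Qed.

Lemma measurable_tuple_split n m : measurable_fun setT (@tuple_split n m).
Proof.
apply: measurable_fun_pair; apply/measurable_fun_tnthP => i.
  rewrite (_ : _ \o _ = @tnth _ _ ^~ (lshift m i)); first exact: measurable_tnth.
  by apply/funext => z /=; rewrite tnth_mktuple.
rewrite (_ : _ \o _ = @tnth _ _ ^~ (rshift n i)); first exact: measurable_tnth.
by apply/funext => z /=; rewrite tnth_mktuple.
Qed.

(** Subsamples along disjoint index lists are independent. All Fubini arguments on the sample rest
    on this. *)
Lemma law_cat n m (s : n.-tuple nat) (t : m.-tuple nat) A : uniq (s ++ t) ->
  measurable A ->
  law (cat_tuple s t) A = (law s \x law t)%E (@tuple_cat n m @^-1` A).
Proof.
move=> ust.
have mc := @measurable_tuple_cat n m.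
pose C := [the {mfun _ >-> _} of HB.pack_for {mfun _ >-> _} (@tuple_cat n m)
  (isMeasurableFun.Build _ _ _ _ _ mc)].
apply: (@tuple_measure_unique _ _ _ _ (law (cat_tuple s t))
   (pushforward (law s \x law t)%E C)).
  exact: (le_lt_trans (probability_le1 (law (cat_tuple s t)) measurableT) (ltry 1)).
move=> B mB; have /and3P[us _ ut] : [&& uniq s, ~~ has [in s] t & uniq t].
  by rewrite -cat_uniq.
have bE : @tuple_cat n m @^-1` box B =
    box (fun i => B (lshift m i)) `*` box (fun i => B (rshift n i)).
  apply/seteqP; split => -[a b] /=.
    move=> h; split => i; first by have := h (lshift m i); rewrite tnth_lshift.
    by have := h (rshift n i); rewrite tnth_rshift.
  move=> [h1 h2] i; case: (split_ordP i) => j ->.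
    by rewrite tnth_lshift; exact: h1.
  by rewrite tnth_rshift; exact: h2.
apply: (etrans (law_box ust mB)); apply/esym.
apply: (etrans (congr1 (law s \x law t)%E bE)).
rewrite product_measure1E; [|exact: measurable_box..].
rewrite big_split_ord/=; congr (_ * _)%E; exact: law_box.
Qed.

(** Positive and negative parts reduce the claim to nonnegative [f]. Applied to |f|, the formula
    also transfers integrability to the product of the two laws. *)
Lemma integral_sample_cat n m (s : n.-tuple nat) (t : m.-tuple nat)
  (f : n.-tuple Xi * m.-tuple Xi -> \bar R) : uniq (s ++ t) ->
  measurable_fun setT f ->
  (\int[P]_w f (sample s w, sample t w) = \int[law s \x law t]_p f p)%E.
Proof.
move=> ust; move: f.
suff main f : measurable_fun setT f -> (forall p, 0 <= f p)%E ->
    (\int[P]_w f (sample s w, sample t w) = \int[law s \x law t]_p f p)%E.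
  move=> f mf; rewrite integralE [RHS]integralE.
  rewrite -!main//; [|exact: measurable_funeneg|exact: measurable_funepos].
  pose S w := (sample s w, sample t w).
  congr (_ - _)%E; apply: eq_integral => w _.
  - exact: (congr1 (fun h => h w) (funepos_comp f S)).
  - exact: (congr1 (fun h => h w) (funeneg_comp f S)).
move=> mf f0.
have msp := @measurable_tuple_split n m; have mc := @measurable_tuple_cat n m.
have e w : (sample s w, sample t w) = tuple_split (sample (cat_tuple s t) w).
  rewrite -[LHS]tuple_catK; congr tuple_split; apply/val_inj => /=.
  by rewrite map_cat.
under eq_integral do rewrite e.
rewrite (integral_law (cat_tuple s t) (f := f \o @tuple_split n m)); last first.
  exact: measurableT_comp.
pose C := [the {mfun _ >-> _} of HB.pack_for {mfun _ >-> _} (@tuple_cat n m)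
  (isMeasurableFun.Build _ _ _ _ _ mc)].
rewrite (@eq_measure_integral _ _ _ setT (pushforward (law s \x law t)%E C)); last first.
  by move=> A mA _; exact: (law_cat ust mA).
rewrite ge0_integral_pushforward//.
- by rewrite preimage_setT; apply: eq_integral => p _; rewrite /= tuple_catK.
- exact: measurableT_comp.
- by move=> y _; exact: f0.
Qed.

End iid_sample.

Section iid_expectation.
Context (R : realType) d d' (T : measurableType d) (Xi : measurableType d').
Variables (P : probability T R) (F : probability Xi R).
Variable xi : nat -> {RV P >-> Xi}.
Hypothesis xi_iid : iid F xi.

Lemma integral_iid i (h : Xi -> \bar R) : measurable_fun setT h ->
  (\int[P]_w h (xi i w) = \int[F]_z h z)%E.
Proof. by apply: integral_distributed; case: xi_iid => _ id; exact: id. Qed.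

Lemma integrable_iid i (h : Xi -> \bar R) :
  F.-integrable setT h <-> measurable_fun setT h /\
  P.-integrable setT (fun w => h (xi i w)).
Proof.
split=> [hi|[mh /integrableP[_ hi]]].
  have mh := measurable_int _ hi; split=> //.
  have /integrableP[_ {}hi] := hi; apply/integrableP; split.
    exact: measurableT_comp.
  rewrite (@integral_iid i (fun z => `|h z|%E))//.
  exact: measurableT_comp.
apply/integrableP; split => //.
rewrite -(@integral_iid i (fun z => `|h z|%E))//.
exact: measurableT_comp.
Qed.

(** Integrating out the last point replaces [f] by [shift_avg F phi f], so the induction on m runs
    over all [f] at once. *)
Lemma expectation_shift_sum (phi : Xi -> R) (f : R -> R) m x :
  measurable_fun setT phi -> unit_valued f ->
  \int[P]_w f (x + \sum_(i < m) phi (xi i w)) = iter m (shift_avg F phi) f x.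
Proof.
move=> mphi; elim: m f => [|m ih] f uf.
  under eq_Rintegral do rewrite big_ord0 addr0.
  by rewrite Rintegral_probability_cst.
have uT := unit_valued_shift_avg F mphi uf.
have [mf f01] := uf.
rewrite iterSr -ih// /Rintegral; congr fine.
have mS : measurable_fun setT (fun a : m.-tuple Xi => \sum_(i < m) phi (tnth a i)).
  by apply: measurable_sum => i; apply: measurableT_comp => //; exact: measurable_tnth.
pose h (p : m.-tuple Xi * 1.-tuple Xi) :=
  (f (x + \sum_(i < m) phi (tnth p.1 i) + phi (tnth p.2 ord0)))%:E.
have mh : measurable_fun setT h.
  apply/measurable_EFinP; apply: measurableT_comp => //.
  apply: measurable_funD.
    by apply: measurable_funD => //; exact: (measurableT_comp mS measurable_fst).
  apply: measurableT_comp => //.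
  exact: (measurableT_comp (measurable_tnth (ord0 : 'I_1)) measurable_snd).
have h0 p : (0 <= h p)%E.
  by rewrite lee_fin; have /andP[] := f01 (x + \sum_(i < m) phi (tnth p.1 i) + phi (tnth p.2 ord0)).
pose s := iota_tuple m 0; pose t : 1.-tuple nat := [tuple m].
have ust : uniq (s ++ t).
  by rewrite /= -[[:: m]]/(iota (0 + m) 1) -iotaD iota_uniq.
transitivity (\int[P]_w h (sample xi s w, sample xi t w))%E.
  apply: eq_integral => w _; rewrite /h big_ord_recr/= addrA; congr (f (_ + _ + _))%:E.
  by apply: eq_bigr => i _; rewrite tnth_map (tnth_nth 0%N)/= nth_iota.
rewrite (integral_sample_cat xi_iid ust mh) fubini_tonelli1//.
pose k (a : m.-tuple Xi) := (shift_avg F phi f (x + \sum_(i < m) phi (tnth a i)))%:E.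
transitivity (\int[law xi s]_a k a)%E.
  apply: eq_integral => a _; rewrite /fubini_F /k shift_avgE//.
  rewrite -(@integral_iid m (fun z => (f (x + \sum_(i < m) phi (tnth a i) + phi z))%:E)); last first.
    apply/measurable_EFinP; apply: measurableT_comp => //.
    exact: measurable_funD.
  have mhb : measurable_fun setT (fun b => h (a, b)).
    exact: (measurableT_comp mh (pair1_measurable a)).
  by rewrite -(integral_law xi t mhb); apply: eq_integral.
have mk : measurable_fun setT k.
  apply/measurable_EFinP; apply: measurableT_comp; first by case: uT.
  exact: measurable_funD.
rewrite -(integral_law xi s mk); apply: eq_integral => w _; rewrite /k.
congr (shift_avg _ _ _ (_ + _))%:E.
by apply: eq_bigr => i _; rewrite tnth_map (tnth_nth 0%N)/= nth_iota.
Qed.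

End iid_expectation.

Section Rintegral_sums.
Context (R : realType) d (T : measurableType d) (P : probability T R).

Lemma integrable_sumr (I : eqType) (r : seq I) (p : pred I) (h : I -> T -> R) :
  (forall i, i \in r -> p i -> P.-integrable setT (EFin \o h i)) ->
  P.-integrable setT (EFin \o (fun w => \sum_(i <- r | p i) h i w)).
Proof.
elim: r => [|i r ih] hi.
  rewrite (_ : _ \o _ = cst 0%E); first exact: integrable0.
  by apply/funext => w /=; rewrite big_nil.
have {}ih : P.-integrable setT (EFin \o (fun w => \sum_(i <- r | p i) h i w)).
  by apply: ih => j jr; apply: hi; rewrite inE jr orbT.
rewrite (_ : _ \o _ = fun w => ((if p i then h i w else 0) +
    \sum_(i <- r | p i) h i w)%:E); last first.
  by apply/funext => w /=; rewrite big_cons; case: (p i); rewrite ?add0r.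
case: (boolP (p i)) => pi; last by under eq_fun do rewrite add0r.
under eq_fun do rewrite EFinD.
by apply: integrableD => //; apply: hi; rewrite ?inE ?eqxx.
Qed.

Lemma Rintegral_sum (I : eqType) (r : seq I) (p : pred I) (h : I -> T -> R) :
  (forall i, i \in r -> p i -> P.-integrable setT (EFin \o h i)) ->
  \int[P]_w (\sum_(i <- r | p i) h i w) =
  \sum_(i <- r | p i) \int[P]_w h i w.
Proof.
elim: r => [|i r ih] hi.
  rewrite big_nil; under eq_Rintegral do rewrite big_nil.
  by rewrite Rintegral_probability_cst.
have hr j : j \in r -> p j -> P.-integrable setT (EFin \o h j).
  by move=> jr; apply: hi; rewrite inE jr orbT.
rewrite big_cons -ih//; case: ifP => pi.
  under eq_Rintegral do rewrite big_cons pi.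
  rewrite RintegralD//; last exact: integrable_sumr.
  by apply: hi; rewrite ?inE ?eqxx.
by under eq_Rintegral do rewrite big_cons pi.
Qed.

Lemma integrable_mulr (f g : T -> R) : measurable_fun setT f ->
  measurable_fun setT g -> (\int[P]_w (f w ^+ 2)%:E < +oo)%E ->
  (\int[P]_w (g w ^+ 2)%:E < +oo)%E ->
  P.-integrable setT (EFin \o (fun w => f w * g w)).
Proof.
move=> mf mg f2 g2.
have sq (h : T -> R) : measurable_fun setT h -> (\int[P]_w (h w ^+ 2)%:E < +oo)%E ->
    P.-integrable setT (EFin \o (fun w => h w ^+ 2)).
  move=> mh h2; apply/integrableP; split.
    by apply/measurable_EFinP; exact: measurable_funX.
  by under eq_integral do rewrite /= ger0_norm ?sqr_ge0//.
apply: le_integrable (integrableD measurableT (sq f mf f2) (sq g mg g2)) => //.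
  by apply/measurable_EFinP; exact: measurable_funM.
move=> w _ /=; rewrite lee_fin [leRHS]ger0_norm ?addr_ge0 ?sqr_ge0//.
rewrite normrM -(real_normK (num_real (f w))) -(real_normK (num_real (g w))).
have := sqr_ge0 (`|f w| - `|g w|); have := sqr_ge0 (`|f w| + `|g w|).
rewrite sqrrB sqrrD -mulr_natr; lra.
Qed.

End Rintegral_sums.

(** * Second moment of a U-statistic with degenerate kernel *)

Section ustatistic_bound.
Context (R : realType) d d' (T : measurableType d) (Xi : measurableType d').
Variables (P : probability T R) (F : probability Xi R).
Variable xi : nat -> {RV P >-> Xi}.
Hypothesis xi_iid : iid F xi.
Variables (K : seq Xi -> R) (k : nat).
Hypothesis k0 : (0 < k)%N.
Hypothesis symK : forall (y : nat -> Xi) s s', perm_eq s s' ->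
  K [seq y i | i <- s] = K [seq y i | i <- s'].
Hypothesis mK : measurable_fun setT (fun z : k.-tuple Xi => K z).

Let KX (s : seq nat) (w : T) := K [seq xi i w | i <- s].

Let mKX s : size s = k -> measurable_fun setT (KX s).
Proof.
move=> /eqP sk; pose t := Tuple sk.
by apply: (measurableT_comp mK (measurable_sample xi t)).
Qed.

Hypothesis K2 : (\int[P]_w (KX (iota 0 k) w ^+ 2)%:E < +oo)%E.

Let KX2 s : uniq s -> size s = k -> (\int[P]_w (KX s w ^+ 2)%:E < +oo)%E.
Proof.
move=> us /eqP sk; pose t := Tuple sk.
have mK2 : measurable_fun setT (fun z : k.-tuple Xi => (K z ^+ 2)%:E).
  by apply/measurable_EFinP; exact: measurable_funX.
have := integral_sample_uniq xi_iid (s := t) (s' := iota_tuple k 0) us (iota_uniq 0 k) mK2.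
by rewrite /sample/= => ->.
Qed.

(** The covariance for one standard pair of index sets: the indices below k, and a k-set sharing
    with them exactly the indices below c. *)
Let zeta c : R :=
  \int[P]_w (KX (iota 0 k) w * KX (iota 0 c ++ iota k (k - c)) w).

Let iKX A B : uniq A -> size A = k -> uniq B -> size B = k ->
  P.-integrable setT (EFin \o (fun w => KX A w * KX B w)).
Proof. by move=> *; apply: integrable_mulr; [exact: mKX|exact: mKX|exact: KX2|exact: KX2]. Qed.

Let measurable_select (x0 : Xi) N (J : k.-tuple nat) :
  measurable_fun setT (fun z : N.-tuple Xi => K [seq nth x0 z j | j <- J]).
Proof.
apply: (measurableT_comp (f := fun z : k.-tuple Xi => K z)
   (g := fun z : N.-tuple Xi => map_tuple (nth x0 z) J)) => //.
apply/measurable_fun_tnthP => i.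
have [iN|Ni] := ltnP (tnth J i) N.
  rewrite (_ : _ \o _ = @tnth _ _ ^~ (Ordinal iN)); first exact: measurable_tnth.
  by apply/funext => z /=; rewrite tnth_map (tnth_nth x0).
rewrite (_ : _ \o _ = cst x0); first exact: measurable_cst.
by apply/funext => z /=; rewrite tnth_map nth_default// size_tuple.
Qed.

(** Symmetry of the kernel allows A and B to be listed with their common part S first. The distinct
    indices S ++ A' ++ B' are then replaced by 0, ..., N - 1 through exchangeability. *)
Let zetaE A B : uniq A -> size A = k -> uniq B -> size B = k ->
  \int[P]_w (KX A w * KX B w) = zeta (count [in A] B).
Proof.
move=> uA sA uB sB; set c := count _ _.
have ck : (c <= k)%N by rewrite -sB count_size.
(* A probability space is not empty; this yields a point of [Xi] to serve as the default value of
   [nth]. *)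
have [w0 _] : [set: T] !=set0.
  apply/set0P/negP => /eqP T0; have := probability_setT P.
  by rewrite T0 measure0 => /eqP; rewrite lt_eqF// lte01.
pose x0 := xi 0%N w0.
pose S := [seq i <- B | i \in A].
pose A' := [seq i <- A | i \notin B]; pose B' := [seq i <- B | i \notin A].
have pA : perm_eq A (S ++ A').
  rewrite -(perm_filterC [in B] A) perm_cat2r; apply: uniq_perm; rewrite ?filter_uniq// => i.
  by rewrite !mem_filter andbC.
have pB : perm_eq B (S ++ B').
  by rewrite -(perm_filterC [in A] B); exact: perm_refl.
have sS : size S = c by rewrite size_filter.
have sA' : size A' = (k - c)%N.
  by have := perm_size pA; rewrite size_cat sS sA => ->; rewrite addKn.
have sB' : size B' = (k - c)%N.
  by have := perm_size pB; rewrite size_cat sS sB => ->; rewrite addKn.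
have us : uniq (S ++ A' ++ B').
  rewrite catA cat_uniq -(perm_uniq pA) uA filter_uniq// andbT/=.
  apply/hasPn => i; rewrite mem_filter => /andP[iA _].
  by rewrite -(perm_mem pA).
pose N := (k + (k - c))%N.
have ss : size (S ++ A' ++ B') == N by rewrite !size_cat sS sA' sB' addnA subnKC.
pose s := Tuple ss; pose s0 := iota_tuple N 0.
have tB : size (iota 0 c ++ iota k (k - c)) == k by rewrite size_cat !size_iota subnKC.
pose A0 := iota_tuple k 0; pose B0 := Tuple tB.
pose f (z : N.-tuple Xi) :=
  (K [seq nth x0 z j | j <- A0] * K [seq nth x0 z j | j <- B0])%:E.
have mf : measurable_fun setT f.
  by apply/measurable_EFinP/measurable_funM; exact: measurable_select.
have A0N j : j \in iota 0 k -> (j < N)%N.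
  by rewrite mem_iota /= add0n => /leq_trans; apply; rewrite leq_addr.
have B0N j : j \in iota 0 c ++ iota k (k - c) -> (j < N)%N.
  rewrite mem_cat !mem_iota => /orP[/andP[_]|/andP[_]//].
  by rewrite add0n => jc; rewrite (leq_trans jc)// (leq_trans ck)// leq_addr.
have sel (t : N.-tuple nat) (J : seq nat) w : (forall j, j \in J -> (j < N)%N) ->
    [seq nth x0 (sample xi t w) j | j <- J] =
    [seq xi i w | i <- [seq nth 0%N t j | j <- J]].
  move=> JN; rewrite -map_comp; apply/eq_in_map => j /JN jN /=.
  by rewrite (nth_map 0%N)// size_tuple.
rewrite /zeta /Rintegral; congr fine.
transitivity (\int[P]_w f (sample xi s w))%E.
  apply: eq_integral => w _; rewrite /f (sel s A0)// (sel s B0)//; congr (_ * _)%:E.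
    apply: symK; rewrite (permPl pA) /= map_nth_iota0; last first.
      by rewrite (eqP ss) leq_addr.
    by rewrite catA take_size_cat// size_cat sS sA' subnKC.
  apply: symK; rewrite (permPl pB) /= map_cat map_nth_iota0; last first.
    by rewrite (eqP ss) (leq_trans ck)// leq_addr.
  rewrite map_nth_iota; last by rewrite (eqP ss) addKn.
  rewrite take_size_cat// catA drop_size_cat; last by rewrite size_cat sS sA' subnKC.
  by rewrite take_oversize// sB'.
rewrite (integral_sample_uniq xi_iid (s := s) (s' := s0) us (iota_uniq 0 N) mf).
apply: eq_integral => w _; rewrite /f (sel s0 A0)// (sel s0 B0)//.
have e0 J : (forall j, j \in J -> (j < N)%N) -> [seq nth 0%N s0 j | j <- J] = J.
  move=> JN; rewrite -[RHS]map_id; apply/eq_in_map => j /JN jN.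
  by rewrite nth_iota.
by rewrite !e0.
Qed.

(** The quadratic form is the second moment of the linear combination of kernel values with the
    given weights. *)
Let zeta_psd : subset_psd k zeta.
Proof.
move=> L Lk.
have iL p q : p \in L -> q \in L -> P.-integrable setT
    (EFin \o (fun w => (p.1 * KX p.2 w) * (q.1 * KX q.2 w))).
  move=> /Lk[up sp] /Lk[uq sq].
  rewrite (_ : _ \o _ = fun w => ((p.1 * q.1)%:E * (KX p.2 w * KX q.2 w)%:E)%E); last first.
    by apply/funext => w /=; rewrite -EFinM mulrACA.
  by apply: integrableZl => //; exact: iKX.
suff -> : \sum_(p <- L) \sum_(q <- L) p.1 * q.1 * zeta (count [in p.2] q.2) =
    \int[P]_w ((\sum_(p <- L) p.1 * KX p.2 w) ^+ 2).
  by apply: Rintegral_ge0 => w _; exact: sqr_ge0.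
under eq_Rintegral do rewrite expr2 big_distrlr/=.
rewrite Rintegral_sum; last by move=> p pL _; apply: integrable_sumr => q qL _; exact: iL.
apply: eq_big_seq => p pL; rewrite Rintegral_sum; last by move=> q qL _; exact: iL.
apply: eq_big_seq => q qL; have [up sp] := Lk p pL; have [uq sq] := Lk q qL.
rewrite -zetaE// -RintegralZl//; last exact: iKX.
by apply: eq_Rintegral => w _; rewrite mulrACA.
Qed.

Variable D : R.
Hypothesis lipK : \int[P]_w
  ((KX (iota 0 k) w - KX (iota 0 k.-1 ++ [:: k]) w) ^+ 2) <= D.

(** The index sets share k - 1 points, so expanding the square of the difference of the two kernel
    values gives twice the last difference of zeta. *)
Let zeta_diff : zeta k - zeta k.-1 <= D / 2.
Proof.
set A := iota 0 k; set B := iota 0 k.-1 ++ [:: k].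
have uA : uniq A by exact: iota_uniq.
have sA : size A = k by rewrite size_iota.
have sB : size B = k by rewrite size_cat size_iota addn1 prednK.
have uB : uniq B.
  by rewrite cat_uniq iota_uniq/= orbF andbT mem_iota add0n/= -leqNgt leq_pred.
have self J : count [in J] J = size J :> nat.
  by apply/eqP; rewrite -all_count; apply/allP.
have eAA : \int[P]_w (KX A w * KX A w) = zeta k by rewrite zetaE// self sA.
have eBB : \int[P]_w (KX B w * KX B w) = zeta k by rewrite zetaE// self sB.
have eAB : \int[P]_w (KX A w * KX B w) = zeta k.-1.
  rewrite /zeta; apply: eq_Rintegral => w _; congr (_ * KX _ w).
  by rewrite /B -subn1 subKn.
have : \int[P]_w ((KX A w - KX B w) ^+ 2) = 2 * (zeta k - zeta k.-1).
  have iAA := iKX uA sA uA sA; have iAB := iKX uA sA uB sB; have iBB := iKX uB sB uB sB.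
  have i2 : P.-integrable setT (EFin \o (fun w => 2 * (KX A w * KX B w))).
    rewrite (_ : _ \o _ = fun w => (2%:E * (KX A w * KX B w)%:E)%E)//.
    exact: integrableZl.
  have iAB2 := integrableB measurableT iAA i2.
  transitivity (\int[P]_w ((KX A w * KX A w - 2 * (KX A w * KX B w)) +
     KX B w * KX B w)); first by apply: eq_Rintegral => w _; ring.
  rewrite (RintegralD measurableT iAB2 iBB) (RintegralB measurableT iAA i2).
  by rewrite RintegralZl// eAA eBB eAB; ring.
by move: lipK; rewrite -/A -/B => h1 h2; lra.
Qed.

Hypothesis degK : zeta 1%N = 0.

(** The second moment is the average of zeta over pairs of k-subsets, at most (k/n)^2 zeta(k) by
    [subset_psd_avg]. By [subset_psd_top], zeta(k) is at most k times the last difference, itself at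
    most D/2. *)
Lemma ustatistic_sqr_le n : (k <= n)%N ->
  (\int[P]_w (ustatistic K n k (fun i => xi i w) ^+ 2)%:E <=
   ((k%:R / n%:R) ^+ 2 * (k%:R * (D / 2)))%:E)%E.
Proof.
move=> kn.
pose S (A : {set 'I_n}) := map val (enum A).
have uS (A : {set 'I_n}) : uniq (S A) by rewrite map_inj_uniq ?enum_uniq//; exact: val_inj.
have sS (A : {set 'I_n}) : #|A| == k -> size (S A) = k by rewrite size_map -cardE => /eqP.
have cS (A B : {set 'I_n}) : count [in S A] (S B) = #|A :&: B|.
  rewrite /S count_map -sum1_count -sum1_card big_enum_cond/=.
  by apply: eq_bigl => i; rewrite !inE mem_map ?mem_enum 1?andbC//; exact: val_inj.
have iS (A B : {set 'I_n}) : #|A| == k -> #|B| == k ->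
    P.-integrable setT (EFin \o (fun w => KX (S A) w * KX (S B) w)).
  by move=> /sS ? /sS ?; exact: iKX.
pose c : R := ('C(n, k)%:R ^+ 2)^-1.
have UE w : ustatistic K n k (fun i => xi i w) ^+ 2 =
    c * \sum_(A : {set 'I_n} | #|A| == k) \sum_(B : {set 'I_n} | #|B| == k)
      KX (S A) w * KX (S B) w.
  rewrite /ustatistic exprMn exprVn; congr (_ * _).
  rewrite expr2 big_distrlr/=; apply: eq_bigr => A _; apply: eq_bigr => B _.
  by rewrite /KX /S -!map_comp.
have iSum (A : {set 'I_n}) : #|A| == k -> P.-integrable setT (EFin \o
    (fun w => \sum_(B : {set 'I_n} | #|B| == k) KX (S A) w * KX (S B) w)).
  by move=> Ak; apply: integrable_sumr => B _ Bk; exact: iS.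
have iSums : P.-integrable setT (EFin \o
    (fun w => \sum_(A : {set 'I_n} | #|A| == k)
      \sum_(B : {set 'I_n} | #|B| == k) KX (S A) w * KX (S B) w)).
  by apply: integrable_sumr => A _ Ak; exact: iSum.
have -> : (\int[P]_w (ustatistic K n k (fun i => xi i w) ^+ 2)%:E)%E =
    (c * \sum_(A : {set 'I_n} | #|A| == k) \sum_(B : {set 'I_n} | #|B| == k)
      zeta #|A :&: B|)%:E.
  under eq_integral do rewrite UE.
  have iU : P.-integrable setT (EFin \o (fun w => c *
      \sum_(A : {set 'I_n} | #|A| == k) \sum_(B : {set 'I_n} | #|B| == k)
      KX (S A) w * KX (S B) w)).
    rewrite (_ : _ \o _ = fun w => (c%:E * (\sum_(A : {set 'I_n} | #|A| == k)
      \sum_(B : {set 'I_n} | #|B| == k) KX (S A) w * KX (S B) w)%:E)%E)//.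
    exact: integrableZl.
  rewrite -[LHS]fineK; last exact: integrable_fin_num iU.
  congr EFin; rewrite -[LHS]/(Rintegral _ _ _) RintegralZl//; congr (_ * _).
  rewrite Rintegral_sum; last by move=> A _; exact: iSum.
  apply: eq_bigr => A Ak; rewrite Rintegral_sum; last by move=> B _; exact: iS.
  by apply: eq_bigr => B Bk; rewrite zetaE ?sS// cS.
rewrite lee_fin.
have k1n : (0 < k <= n)%N by rewrite k0.
apply: (le_trans (subset_psd_avg k1n zeta_psd degK)).
apply: ler_wpM2l; first exact: sqr_ge0.
apply: (le_trans (subset_psd_top k0 zeta_psd degK)).
by apply: ler_wpM2l zeta_diff.
Qed.

End ustatistic_bound.

Section degenerate_kernel.
Context (R : realType) d d' (T : measurableType d) (Xi : measurableType d').
Variables (P : probability T R) (F : probability Xi R).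
Variable xi : nat -> {RV P >-> Xi}.
Hypothesis xi_iid : iid F xi.

Lemma ae_iid i (Q : Xi -> Prop) : {ae F, forall z, Q z} ->
  {ae P, forall w, Q (xi i w)}.
Proof.
move=> [N [mN N0 QN]]; have [_ id] := xi_iid.
exists (xi i @^-1` N); split.
- by rewrite -[X in measurable X]setTI; exact: measurable_funPT.
- by rewrite -N0 -(id i).
- by move=> w /= nQ; exact: QN.
Qed.

(** The two index sets share only the index 0. With all points of the second set frozen, [xi 0]
    among them, integration over the remaining points of the first set gives 0 almost surely by
    degeneracy. This is zeta(1) = 0. *)
Lemma degenerate_pair (K : seq Xi -> R) k : (0 < k)%N ->
  measurable_fun setT (fun z : k.-tuple Xi => K z) ->
  (\int[P]_w (K [seq xi i w | i <- iota 0 k] ^+ 2)%:E < +oo)%E ->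
  {ae F, forall z,
    P.-integrable setT (EFin \o (fun w => K (z :: [seq xi i w | i <- iota 1 k.-1]))) /\
    (\int[P]_w (K (z :: [seq xi i w | i <- iota 1 k.-1]))%:E = 0)%E} ->
  \int[P]_w (K [seq xi i w | i <- iota 0 k] *
    K [seq xi i w | i <- iota 0 1 ++ iota k (k - 1)]) = 0.
Proof.
case: k => // p _ mK K2 deg; rewrite subn1 /=.
have ss : size (0%N :: iota p.+1 p) == p.+1 by rewrite /= size_iota.
pose s := Tuple ss; pose t := iota_tuple p 1.
have us : uniq s by rewrite /= mem_iota/= iota_uniq.
have ust : uniq (s ++ t).
  rewrite cat_uniq us iota_uniq andbT; apply/hasPn => i /=.
  by rewrite !inE !mem_iota; lia.
pose h (q : p.+1.-tuple Xi * p.-tuple Xi) : \bar R :=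
  (K (tnth q.1 ord0 :: q.2) * K q.1)%:E.
have mcons : measurable_fun setT
    (fun q : p.+1.-tuple Xi * p.-tuple Xi => K (tnth q.1 ord0 :: q.2)).
  apply: (measurableT_comp mK); apply: measurable_cons => //.
  exact: (measurableT_comp (measurable_tnth ord0) measurable_fst).
have mh : measurable_fun setT h.
  apply/measurable_EFinP/measurable_funM => //.
  exact: (measurableT_comp mK measurable_fst).
have hE w : h (sample xi s w, sample xi t w) =
    (K [seq xi i w | i <- iota 0 p.+1] * K [seq xi i w | i <- s])%:E.
  by rewrite /h (tnth_nth (xi 0%N w)).
have sqr2 (r : p.+1.-tuple nat) : uniq r ->
    (\int[P]_w (K [seq xi i w | i <- r] ^+ 2)%:E < +oo)%E.
  move=> ur; have mK2 : measurable_fun setT (fun z : p.+1.-tuple Xi => (K z ^+ 2)%:E).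
    by apply/measurable_EFinP; exact: measurable_funX.
  have := integral_sample_uniq xi_iid (s := r) (s' := iota_tuple p.+1 0) ur (iota_uniq 0 p.+1) mK2.
  by rewrite /sample/= => ->.
have ih : P.-integrable setT (fun w => h (sample xi s w, sample xi t w)).
  under eq_fun do rewrite hE.
  apply: integrable_mulr => //.
  - exact: (measurableT_comp mK (measurable_sample xi (iota_tuple p.+1 0))).
  - exact: (measurableT_comp mK (measurable_sample xi s)).
  - exact: (sqr2 s us).
have ihp : (law xi s \x law xi t)%E.-integrable setT h.
  apply/integrableP; split => //.
  have mah : measurable_fun setT (abse \o h) by exact: measurableT_comp.
  by rewrite -(integral_sample_cat xi_iid ust mah); have /integrableP[] := ih.
rewrite /Rintegral; have -> : (\int[P]_w (K [seq xi i w | i <- iota 0 p.+1] *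
    K [seq xi i w | i <- s])%:E = \int[law xi s \x law xi t]_q h q)%E.
  by rewrite -(integral_sample_cat xi_iid ust mh); apply: eq_integral => w _; rewrite hE.
rewrite -(integral12_prod_meas1 ihp).
have mF := measurable_int _ (integrable_fubini_F ihp).
rewrite -(integral_law xi s mF).
rewrite (ae_eq_integral (cst 0%E))//; [by rewrite integral0| |].
  exact: (measurableT_comp mF (measurable_sample xi s)).
apply: filterS (ae_iid 0 deg) => w [iK K0] _ /=.
have mKt : measurable_fun setT (fun b : p.-tuple Xi => (K (xi 0%N w :: b))%:E).
  apply/measurable_EFinP.
  exact: (measurableT_comp mK (measurable_cons (measurable_cst _) (@measurable_id _ _ _))).
rewrite /fubini_F -(integral_law xi t (f := fun b => h (sample xi s w, b))); last first.
  exact: (measurableT_comp mh (pair1_measurable _)).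
rewrite /h/=; under eq_integral => v _.
  rewrite (tnth_nth (xi 0%N w))/= EFinM; over.
by rewrite integralZr// K0 mul0e.
Qed.

End degenerate_kernel.

(** * Sample average approximation values *)

Section infimum.
Variables (R : realType) (X : Type).
Hypothesis X0 : [set: X] !=set0.

Lemma inf_norm_le (f : X -> R) b : (forall x, `|f x| <= b) ->
  `|inf [set f x | x in [set: X]]| <= b.
Proof.
move=> fb; have [x0 _] := X0.
have lbf : lbound [set f x | x in [set: X]] (- b).
  by move=> _ [x _ <-]; have := fb x; rewrite ler_norml => /andP[].
rewrite ler_norml; apply/andP; split.
  by apply: lb_le_inf => //; exists (f x0); exists x0.
apply: (@le_trans _ _ (f x0)).
  by apply: ge_inf; [exists (- b)|exists x0].
by have := fb x0; rewrite ler_norml => /andP[].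
Qed.

Lemma esup_ge0 (f : X -> R) : (forall x, 0 <= f x) ->
  (0 <= esup f)%E.
Proof.
move=> f0; have [x0 _] := X0; apply: (@le_trans _ _ (f x0)%:E).
  by rewrite lee_fin.
by apply: ereal_sup_ubound; exists x0.
Qed.

(* If one infimum is not finite then neither is the other, and both have the
   conventional value 0. *)
Lemma inf_dist_le (f g : X -> R) b : (forall x, `|f x - g x| <= b) ->
  `|inf [set f x | x in [set: X]] - inf [set g x | x in [set: X]]| <= b.
Proof.
have [x0 _] := X0.
have main (u v : X -> R) : has_lbound [set u x | x in [set: X]] ->
    (forall x, `|u x - v x| <= b) -> has_lbound [set v x | x in [set: X]] /\
    inf [set u x | x in [set: X]] - b <= inf [set v x | x in [set: X]].
  move=> hu uv.
  have lbv : lbound [set v x | x in [set: X]] (inf [set u x | x in [set: X]] - b).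
    move=> _ [x _ <-]; have := uv x; rewrite ler_distlC => /andP[+ _].
    by apply: le_trans; rewrite lerB//; apply: ge_inf => //; exists x.
  split; first by exists (inf [set u x | x in [set: X]] - b).
  by apply: lb_le_inf => //; exists (v x0); exists x0.
move=> fg; have gf x : `|g x - f x| <= b by rewrite distrC.
have b0 : 0 <= b by apply: le_trans (fg x0).
have [hf|nf] := pselect (has_lbound [set f x | x in [set: X]]).
  have [hg fgi] := main _ _ hf fg; have [_ gfi] := main _ _ hg gf.
  by rewrite ler_norml; apply/andP; split; lra.
have ng : ~ has_lbound [set g x | x in [set: X]].
  by move=> hg; apply: nf; have [] := main _ _ hg gf.
by rewrite !inf_out ?subrr ?normr0// => -[_].
Qed.

End infimum.

Section saa_value_bounds.
Variables (R : realType) (X : Type) (Xi : eqType) (h : X -> Xi -> R).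
Hypothesis X0 : [set: X] !=set0.

Lemma saa_value_perm (y : nat -> Xi) s s' : perm_eq s s' ->
  saa_value h [seq y i | i <- s] = saa_value h [seq y i | i <- s'].
Proof.
move=> ss'; rewrite /saa_value !size_map (perm_size ss'); congr inf.
by apply: eq_imagel => x _; rewrite !big_map (perm_big _ ss').
Qed.

(** Every |h(x, y)| is at most the square root of the whole sum, hence so is their average. The
    bound is crude but enough for finiteness of the second moment. *)
Lemma saa_value_sqr_le (m : Xi -> R) (s : seq Xi) : (0 < size s)%N ->
  (forall y x, y \in s -> `|h x y| ^+ 2 <= m y) ->
  saa_value h s ^+ 2 <= \sum_(y <- s) m y.
Proof.
move=> s0 hm.
have [x0 _] := X0.
have m0 y : y \in s -> 0 <= m y by move=> ys; apply: le_trans (hm y x0 ys); exact: sqr_ge0.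
have S0 : 0 <= \sum_(y <- s) m y by rewrite big_seq sumr_ge0.
rewrite -real_normK ?num_real// -[leRHS]sqr_sqrtr// ler_sqr ?nnegrE//.
apply: inf_norm_le => // x.
rewrite normrM normfV normr_nat ler_pdivrMl ?ltr0n//.
apply: (le_trans (ler_norm_sum _ _ _)).
apply: (@le_trans _ _ (\sum_(y <- s) Num.sqrt (\sum_(y <- s) m y))).
  rewrite [leLHS]big_seq [leRHS]big_seq; apply: ler_sum => y ys.
  rewrite -[leLHS]sqrtr_sqr ler_wsqrtr//.
  rewrite -real_normK ?num_real// (le_trans (hm y x ys))//.
  rewrite (big_rem y)//= lerDl big_seq; apply: sumr_ge0 => z zs.
  by apply: m0; exact: mem_rem zs.
by rewrite big_const_seq count_predT iter_addr_0 mulr_natl.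
Qed.

Lemma saa_value_lip z z' s D : (forall x, `|h x z - h x z'| <= D) ->
  `|saa_value h (z :: s) - saa_value h (z' :: s)| <= (size s).+1%:R^-1 * D.
Proof.
move=> hD; apply: inf_dist_le => // x.
rewrite !big_cons -mulrBr normrM normfV normr_nat ler_wpM2l ?invr_ge0//.
by rewrite opprD addrACA subrr addr0.
Qed.

End saa_value_bounds.

(** * Projection of the SAA kernel *)

Section square_integrable.
Context (R : realType) d (T : measurableType d) (P : probability T R).

Definition sqintegrable (f : T -> R) :=
  measurable_fun setT f /\ (\int[P]_w (f w ^+ 2)%:E < +oo)%E.

Lemma sqintegrable_cst c : sqintegrable (fun=> c).
Proof.
split; first exact: measurable_cst.
by rewrite integral_cst//= probability_setT mule1 ltry.
Qed.

Lemma sqintegrableB f g : sqintegrable f -> sqintegrable g ->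
  sqintegrable (fun w => f w - g w).
Proof.
move=> [mf f2] [mg g2]; split; first exact: measurable_funB.
have mf2 : measurable_fun setT (fun w => (f w ^+ 2)%:E).
  by apply/measurable_EFinP; exact: measurable_funX.
have mg2 : measurable_fun setT (fun w => (g w ^+ 2)%:E).
  by apply/measurable_EFinP; exact: measurable_funX.
have f20 w : (0 <= (f w ^+ 2)%:E)%E by rewrite lee_fin sqr_ge0.
have g20 w : (0 <= (g w ^+ 2)%:E)%E by rewrite lee_fin sqr_ge0.
apply: (@le_lt_trans _ _
    (\int[P]_w (2%:E * (f w ^+ 2)%:E + 2%:E * (g w ^+ 2)%:E))%E).
  apply: ge0_le_integral => //.
  - by move=> w _; rewrite lee_fin sqr_ge0.
  - apply/measurable_EFinP; apply: measurable_funX; exact: measurable_funB.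
  - by apply: emeasurable_funD; apply: emeasurable_funM.
  - move=> w _; rewrite -!EFinM -EFinD lee_fin.
    by have := sqr_ge0 (f w + g w); nra.
rewrite ge0_integralD//; last 4 first.
- by move=> w _; rewrite mule_ge0.
- exact: emeasurable_funM.
- by move=> w _; rewrite mule_ge0.
- exact: emeasurable_funM.
by rewrite !ge0_integralZl// lte_add_pinfty// lte_mul_pinfty.
Qed.

Lemma sqintegrable_sum (I : Type) (r : seq I) (f : I -> T -> R) :
  (forall i, sqintegrable (f i)) -> sqintegrable (fun w => \sum_(i <- r) f i w).
Proof.
move=> fi; elim: r => [|i r ih].
  by under eq_fun do rewrite big_nil; exact: sqintegrable_cst.
rewrite (_ : (fun _ => _) = fun w => f i w - (0 - \sum_(i <- r) f i w)).
  by do 2?apply: sqintegrableB => //; exact: sqintegrable_cst.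
by apply/funext => w; rewrite big_cons; ring.
Qed.

Lemma sqintegrable_integrable f : sqintegrable f -> P.-integrable setT (EFin \o f).
Proof.
move=> [mf f2]; have [m1 h1] := sqintegrable_cst 1.
have := integrable_mulr mf m1 f2 h1.
by under eq_fun do rewrite mulr1.
Qed.

Lemma sqintegrable_le (f g : T -> R) : measurable_fun setT f ->
  measurable_fun setT g -> {ae P, forall w, f w ^+ 2 <= g w} ->
  (\int[P]_w `|(g w)%:E| < +oo)%E -> sqintegrable f.
Proof.
move=> mf mg fg g2; split=> //; apply: le_lt_trans g2.
apply: ae_ge0_le_integral => //.
- by move=> w _; rewrite lee_fin sqr_ge0.
- by apply/measurable_EFinP; exact: measurable_funX.
- by apply: measurableT_comp => //; exact/measurable_EFinP.
- by apply: filterS fg => w fgw _; rewrite lee_fin (le_trans fgw)// ler_norm.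
Qed.

End square_integrable.

Lemma sqintegrable_iid (R : realType) d d' (T : measurableType d)
  (Xi : measurableType d') (P : probability T R) (F : probability Xi R)
  (xi : nat -> {RV P >-> Xi}) (phi : Xi -> R) : iid F xi -> sqintegrable F phi ->
  forall i, sqintegrable P (fun w => phi (xi i w)).
Proof.
move=> xi_iid [mphi phi2] i; split; first exact: measurableT_comp.
rewrite (integral_iid xi_iid _ (h := fun z => (phi z ^+ 2)%:E))//.
by apply/measurable_EFinP; exact: measurable_funX.
Qed.

(** Jensen's inequality for the power q, obtained from Hoelder's inequality against the constant
    1. *)
Lemma powR_Rintegral_le (R : realType) d (T : measurableType d)
  (P : probability T R) (u : T -> R) q : 1 < q -> measurable_fun setT u ->
  (forall w, 0 <= u w) ->
  ((\int[P]_w (u w)%:E) `^ q <= \int[P]_w (u w `^ q)%:E)%E.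
Proof.
move=> q1 mu u0; have q0 : 0 < q by exact: lt_trans q1.
pose r := q / (q - 1); have r0 : 0 < r by rewrite divr_gt0// subr_gt0.
have qr : q^-1 + r^-1 = 1.
  by rewrite /r; field; rewrite !gt_eqF// subr_gt0.
have := @hoelder _ _ _ P u (cst 1) q r mu (measurable_cst _) q0 r0 qr.
rewrite (_ : EFin \o cst (1 : R) = cst 1%E)// Lnorm_cst1.
rewrite [X in (X `^ _)%E](probability_setT P) poweR1r mule1 Lnorm1 => h1.
have -> : (\int[P]_w (u w `^ q)%:E = 'N[P]_q%:E[EFin \o u] `^ q)%E.
  rewrite (poweR_Lnorm P (EFin \o u) (lt0r_neq0 q0)); apply: eq_integral => w _ /=.
  by rewrite ger0_norm.
apply: gt0_ler_poweR; rewrite ?in_itv/= ?leey ?andbT ?(ltW q0)//.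
- by apply: integral_ge0 => w _; rewrite lee_fin.
- exact: Lnorm_ge0.
apply: le_trans h1; rewrite le_eqVlt; apply/orP; left; apply/eqP.
by apply: eq_integral => w _ /=; rewrite mulr1 ger0_norm.
Qed.

Section saa_sampling.
Context (R : realType) (dXi : measure_display) (Xi : measurableType dXi).
Variables (F : probability Xi R) (X : Type) (h : X -> Xi -> R).
Context (dO : measure_display) (Omega : measurableType dO).
Variables (P : probability Omega R) (xi : nat -> {RV P >-> Xi}).
Hypotheses (X0 : [set: X] !=set0) (xi_iid : iid F xi).
Hypothesis msup : measurable_fun [set: Xi] (fun z => esup (fun x => `|h x z| ^+ 2)).
Hypothesis moment2 : (\int[F]_z esup (fun x => `|h x z| ^+ 2)%R < +oo)%E.

(** A real-valued envelope of h^2. Where the supremum is infinite, [fine] returns 0 and the envelope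
    property fails; integrability confines this to a null set. *)
Definition sup_sqr z : R := fine (esup (fun x => `|h x z| ^+ 2)).

Let sup_ge0 z : (0 <= esup (fun x => `|h x z| ^+ 2)%R)%E.
Proof. by apply: esup_ge0 => // x; exact: sqr_ge0. Qed.

Lemma ae_sup_sqr : {ae F, forall z, forall x, `|h x z| ^+ 2 <= sup_sqr z}.
Proof.
have : F.-integrable setT (fun z => esup (fun x => `|h x z| ^+ 2)).
  by apply/integrableP; split => //; under eq_integral do rewrite gee0_abs//.
move=> /integrable_ae -/(_ measurableT); apply: filterS => z /(_ Logic.I) fz x.
rewrite -lee_fin /sup_sqr fineK//; apply: ereal_sup_ubound; exists x => //.
Qed.

Lemma sup_sqr_ge0 z : 0 <= sup_sqr z. Proof. exact: fine_ge0. Qed.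

Lemma measurable_sup_sqr : measurable_fun setT sup_sqr.
Proof. by apply: measurableT_comp. Qed.

Lemma integral_sup_sqr : (\int[F]_z (sup_sqr z)%:E < +oo)%E.
Proof.
apply: le_lt_trans moment2; apply: ge0_le_integral => //.
- by move=> z _; rewrite lee_fin sup_sqr_ge0.
- by apply/measurable_EFinP; exact: measurable_sup_sqr.
- move=> z _; rewrite /sup_sqr; have := sup_ge0 z.
  by case: (esup _) => //= *; rewrite leey.
Qed.

Let ae_xi : {ae P, forall w, forall i x, `|h x (xi i w)| ^+ 2 <= sup_sqr (xi i w)}.
Proof. by apply: ae_foralln => i; exact: ae_iid xi_iid i _ ae_sup_sqr. Qed.

Let integrable_sup_sqr : F.-integrable setT (EFin \o sup_sqr).
Proof.
apply/integrableP; split; first by apply/measurable_EFinP; exact: measurable_sup_sqr.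
under eq_integral do rewrite /= ger0_norm ?sup_sqr_ge0//.
exact: integral_sup_sqr.
Qed.

Let integrable_sup_sqr_xi i : P.-integrable setT (fun w => (sup_sqr (xi i w))%:E).
Proof. by have [_] := (integrable_iid xi_iid i (EFin \o sup_sqr)).1 integrable_sup_sqr. Qed.

Variable p : nat.
Hypothesis mH : measurable_fun setT (fun z : p.+1.-tuple Xi => saa_value h z).

Let H (s : seq nat) w := saa_value h [seq xi i w | i <- s].

Let sqH s : size s = p.+1 -> sqintegrable P (H s).
Proof.
move=> sp; apply: (@sqintegrable_le _ _ _ _ _ (fun w => \sum_(i <- s) sup_sqr (xi i w))).
- move/eqP : sp => sp; pose t := Tuple sp.
  exact: (measurableT_comp mH (measurable_sample xi t)).
- apply: measurable_sum => i.
  exact: (measurableT_comp measurable_sup_sqr (measurable_funPT (xi i))).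
- apply: filterS ae_xi => w hw; rewrite -[leRHS](big_map (xi^~ w) xpredT sup_sqr).
  apply: saa_value_sqr_le => //; first by rewrite size_map sp.
  by move=> y x /mapP[i _ ->]; exact: hw.
- have /integrableP[_] := integrable_sumr (P := P) (r := s) (p := xpredT)
    (h := fun i w => sup_sqr (xi i w)) (fun i _ _ => integrable_sup_sqr_xi i).
  by [].
Qed.

Let Hz (z : Xi) w := saa_value h (z :: [seq xi i w | i <- iota 1 p]).

Let mcons : measurable_fun setT
  (fun q : Xi * p.-tuple Xi => saa_value h (q.1 :: q.2)).
Proof. by apply: (measurableT_comp mH); apply: measurable_cons. Qed.

Let sqHz z : (forall x, `|h x z| ^+ 2 <= sup_sqr z) -> sqintegrable P (Hz z).
Proof.
move=> hz; pose t := iota_tuple p 1.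
apply: (@sqintegrable_le _ _ _ _ _
  (fun w => sup_sqr z + \sum_(i <- iota 1 p) sup_sqr (xi i w))).
- exact: (measurableT_comp mcons (measurableT_comp (pair1_measurable z)
    (measurable_sample xi t))).
- apply: measurable_funD => //; apply: measurable_sum => i.
  exact: (measurableT_comp measurable_sup_sqr (measurable_funPT (xi i))).
- apply: filterS ae_xi => w hw.
  have -> : sup_sqr z + \sum_(i <- iota 1 p) sup_sqr (xi i w) =
      \sum_(y <- z :: [seq xi i w | i <- iota 1 p]) sup_sqr y.
    by rewrite big_cons big_map.
  apply: saa_value_sqr_le => //.
  move=> y x; rewrite inE => /predU1P[->|]; first exact: hz.
  by move=> /mapP[i _ ->]; exact: hw.
- have i1 : P.-integrable setT (EFin \o (fun w => \sum_(i <- iota 1 p) sup_sqr (xi i w))).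
    exact: integrable_sumr (fun i _ _ => integrable_sup_sqr_xi i).
  have i2 : P.-integrable setT (fun=> (sup_sqr z)%:E).
    exact: finite_measure_integrable_cst.
  by have /integrableP[_] := integrableD measurableT i2 i1.
Qed.

(** The explicit version of the conditional expectation, with the other p points integrated out.
    Unlike an abstract version it can be estimated at individual points. *)
Definition saa_proj z := \int[P]_w Hz z w.

Lemma saa_proj_lip z z' D : (forall x, `|h x z| ^+ 2 <= sup_sqr z) ->
  (forall x, `|h x z'| ^+ 2 <= sup_sqr z') -> (forall x, `|h x z - h x z'| <= D) ->
  `|saa_proj z - saa_proj z'| <= p.+1%:R^-1 * D.
Proof.
move=> hz hz' hD.
have iz := sqintegrable_integrable (sqHz hz).
have iz' := sqintegrable_integrable (sqHz hz').
rewrite /saa_proj -RintegralB//.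
apply: (le_trans (le_normr_Rintegral measurableT (integrableB measurableT iz iz'))).
rewrite -[leRHS](Rintegral_probability_cst P); apply: le_Rintegral => //.
- exact: integrable_norm (integrableB measurableT iz iz').
- exact: finite_measure_integrable_cst.
move=> w _; have := saa_value_lip X0 [seq xi i w | i <- iota 1 p] hD.
by rewrite size_map size_iota.
Qed.

Variable g : Xi -> R.
Hypothesis g_cond : is_cond_expectation (H (iota 0 p.+1)) (xi 0%N) g.

Let mg : measurable_fun setT g. Proof. by case: g_cond. Qed.

Let ig : F.-integrable setT (EFin \o g).
Proof.
apply/(integrable_iid xi_iid 0); split; first exact/measurable_EFinP.
have [_ /integrableP[mEg gi] _] := g_cond.
apply/integrableP; split.
  by apply: (measurableT_comp mEg); exact: measurable_funPT.
move: gi; rewrite ge0_integral_distribution//.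
exact: measurableT_comp.
Qed.

(** The first point is independent of the others, so by Fubini's theorem the inner integral has the
    same integral as [g] over every measurable set; two such functions agree almost everywhere. *)
Lemma cond_expectation_saa : {ae F, forall z, g z = saa_proj z}.
Proof.
have [_ _ gE] := g_cond; have [_ dist] := xi_iid.
pose s : 1.-tuple nat := [tuple 0%N]; pose t := iota_tuple p 1.
have ust : uniq (s ++ t) by exact: (iota_uniq 0 p.+1).
pose hh (q : 1.-tuple Xi * p.-tuple Xi) := (saa_value h (tnth q.1 ord0 :: q.2))%:E.
have mt0 : measurable_fun setT (fun q : 1.-tuple Xi * p.-tuple Xi => tnth q.1 ord0).
  exact: (measurableT_comp (measurable_tnth ord0) measurable_fst).
have mhh : measurable_fun setT hh.
  apply/measurable_EFinP; apply: (measurableT_comp mcons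
    (g := fun q : 1.-tuple Xi * p.-tuple Xi => (tnth q.1 ord0, q.2))).
  exact: measurable_fun_pair.
have hhE w : hh (sample xi s w, sample xi t w) = (H (iota 0 p.+1) w)%:E.
  by rewrite /hh (tnth_nth (xi 0%N w)).
have iH := sqintegrable_integrable (sqH (size_iota 0 p.+1)).
have ihh : (law xi s \x law xi t)%E.-integrable setT hh.
  apply/integrableP; split => //.
  have mah : measurable_fun setT (abse \o hh) by exact: measurableT_comp.
  rewrite -(integral_sample_cat xi_iid ust mah).
  by have /integrableP[_] := iH.
have mF := measurable_int _ (integrable_fubini_F ihh).
pose tup (z : Xi) : 1.-tuple Xi := [tuple z].
have mtup : measurable_fun setT tup.
  apply/measurable_fun_tnthP => i; rewrite (_ : _ \o _ = id)//.
  by apply/funext => z /=; rewrite (tnth_nth z) ord1.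
have tupE w : sample xi s w = tup (xi 0%N w) by apply/val_inj.
pose GE z := fubini_F (law xi t) hh (tup z).
have mGE : measurable_fun setT GE by exact: (measurableT_comp mF mtup).
have : ae_eq F setT (EFin \o g) GE.
  apply: integral_ae_eq => // E _ mE.
  transitivity (\int[P]_w (H (iota 0 p.+1) w * \1_E (xi 0%N w))%:E)%E.
    rewrite (@eq_measure_integral _ _ _ E (distribution P (xi 0%N))); last first.
      by move=> A mA _; exact/esym/dist.
    rewrite gE// integral_mkcond; apply: eq_integral => w _.
    rewrite patchE /indic; have -> : (w \in xi 0%N @^-1` E) = (xi 0%N w \in E).
      by apply/idP/idP; rewrite !inE.
    by case: (_ \in E); rewrite ?mulr1 ?mulr0.
  pose hE (q : 1.-tuple Xi * p.-tuple Xi) := (hh q * (\1_E (tnth q.1 ord0))%:E)%E.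
  have mhE : measurable_fun setT hE.
    apply: emeasurable_funM => //; apply/measurable_EFinP.
    exact: (measurableT_comp (measurable_indic mE) mt0).
  have ihE : (law xi s \x law xi t)%E.-integrable setT hE.
    apply: le_integrable ihh => // q _; rewrite /hE abseM.
    rewrite [X in (_ * X)%E]gee0_abs ?lee_fin//.
    by rewrite ler_piMr// /indic; case: (_ \in _).
  transitivity (\int[law xi s \x law xi t]_q hE q)%E.
    rewrite -(integral_sample_cat xi_iid ust mhE); apply: eq_integral => w _.
    by rewrite /hE hhE/= (tnth_nth (xi 0%N w)) EFinM.
  rewrite -(integral12_prod_meas1 ihE).
  have mFE := measurable_int _ (integrable_fubini_F ihE).
  rewrite -(integral_law xi s mFE).
  transitivity (\int[P]_w (GE (xi 0%N w) * (\1_E (xi 0%N w))%:E))%E.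
    apply: eq_integral => w _; rewrite tupE /GE /fubini_F /hE/=.
    under eq_integral do rewrite (tnth_nth (xi 0%N w))/=.
    rewrite /indic; case: (xi 0%N w \in E).
      by rewrite mule1; apply: eq_integral => b _; rewrite mule1.
    by rewrite mule0 integral0_eq// => b _; rewrite mule0.
  have mGI : measurable_fun setT (fun z => (GE z * (\1_E z)%:E)%E).
    by apply: emeasurable_funM => //; apply/measurable_EFinP; exact: measurable_indic.
  rewrite (integral_iid xi_iid 0 mGI) [RHS]integral_mkcond.
  by apply: eq_integral => z _; rewrite epatch_indic.
move=> gGE; apply: filterS2 gGE ae_sup_sqr => z /(_ Logic.I)/= gz hz.
have iz := sqintegrable_integrable (sqHz hz).
apply: EFin_inj; rewrite gz /GE /fubini_F /saa_proj /Rintegral fineK; last first.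
  exact: integrable_fin_num iz.
have mhz : measurable_fun setT (fun b => hh (tup z, b)).
  exact: (measurableT_comp mhh (pair1_measurable _)).
by rewrite -(integral_law xi t mhz); apply: eq_integral => w _; rewrite /hh (tnth_nth z).
Qed.

Definition saa_mean : R := \int[P]_w H (iota 0 p.+1) w.

Definition saa_score z : R := g z - saa_mean.

Lemma measurable_saa_score : measurable_fun setT saa_score.
Proof. exact: measurable_funB. Qed.

Lemma integrable_saa_score : F.-integrable setT (EFin \o saa_score).
Proof.
have ic : F.-integrable setT (fun=> saa_mean%:E).
  exact: finite_measure_integrable_cst.
exact: (integrableB measurableT ig ic).
Qed.

Lemma Rintegral_saa_cond : \int[F]_z g z = saa_mean.
Proof.
have [_ _ gE] := g_cond; have [_ dist] := xi_iid.
rewrite /saa_mean /Rintegral; congr fine.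
have := gE setT measurableT; rewrite preimage_setT => <-.
by apply: eq_measure_integral => A mA _; exact/esym/dist.
Qed.

Lemma Rintegral_saa_score : \int[F]_z saa_score z = 0.
Proof.
have ic : F.-integrable setT (fun=> saa_mean%:E).
  exact: finite_measure_integrable_cst.
by rewrite /saa_score RintegralB// Rintegral_probability_cst Rintegral_saa_cond subrr.
Qed.

(** Almost every point is regular. There the envelope is valid and [g] has its explicit value, so
    Lipschitz estimates for scores hold pointwise. *)
Definition regular_point z :=
  (forall x, `|h x z| ^+ 2 <= sup_sqr z) /\ g z = saa_proj z.

Lemma ae_regular_point : {ae F, forall z, regular_point z}.
Proof. exact: filterI ae_sup_sqr cond_expectation_saa. Qed.

Lemma saa_score_lip z z' D : regular_point z -> regular_point z' ->
  (forall x, `|h x z - h x z'| <= D) ->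
  `|saa_score z - saa_score z'| <= p.+1%:R^-1 * D.
Proof.
move=> [hz gz] [hz' gz'] hD.
have -> : saa_score z - saa_score z' = saa_proj z - saa_proj z'.
  by rewrite /saa_score gz gz'; ring.
exact: saa_proj_lip.
Qed.

Let dist_sqrt z z' x : (forall x, `|h x z| ^+ 2 <= sup_sqr z) ->
  (forall x, `|h x z'| ^+ 2 <= sup_sqr z') ->
  `|h x z - h x z'| <= Num.sqrt (2 * sup_sqr z + 2 * sup_sqr z').
Proof.
move=> /(_ x) hz /(_ x) hz'; rewrite -[leLHS]sqrtr_sqr ler_wsqrtr//.
move: hz hz'; rewrite !real_normK ?num_real//.
by have := sqr_ge0 (h x z + h x z'); nra.
Qed.

Let sqrt_sqr z z' : Num.sqrt (2 * sup_sqr z + 2 * sup_sqr z') ^+ 2 =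
  2 * sup_sqr z + 2 * sup_sqr z'.
Proof. by rewrite sqr_sqrtr// addr_ge0// mulr_ge0// sup_sqr_ge0. Qed.

Let score_sqr_lip z z' : regular_point z -> regular_point z' ->
  (saa_score z - saa_score z') ^+ 2 <=
  p.+1%:R^-1 ^+ 2 * (2 * sup_sqr z + 2 * sup_sqr z').
Proof.
move=> rz rz'; rewrite -real_normK ?num_real// -sqrt_sqr -exprMn.
rewrite lerXn2r ?nnegrE ?mulr_ge0 ?invr_ge0 ?sqrtr_ge0//.
by apply: saa_score_lip => // x; apply: dist_sqrt; [case: rz|case: rz'].
Qed.

Lemma ae_exists (Q : Xi -> Prop) : {ae F, forall z, Q z} -> exists z, Q z.
Proof.
move=> [N [mN N0 QN]]; apply: contrapT => /forallNP nQ.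
have : N = setT by apply/seteqP; split => // z _; apply: QN => /nQ.
move=> NT; have := probability_setT F; rewrite -NT N0 => /eqP.
by rewrite lt_eqF// lte01.
Qed.

(** Comparison with one fixed regular point z0: the Lipschitz estimate bounds the difference of the
    scores by the envelopes at z and z0. *)
Lemma sqintegrable_saa_score : sqintegrable F saa_score.
Proof.
have [z0 r0] := ae_exists ae_regular_point.
pose c := p.+1%:R^-1 ^+ 2 : R.
apply: (@sqintegrable_le _ _ _ _ _ (fun z => 2 * saa_score z0 ^+ 2 +
  2 * c * (2 * sup_sqr z0) + 4 * c * sup_sqr z)).
- exact: measurable_saa_score.
- by apply: measurable_funD => //; apply: measurable_funM => //; exact: measurable_sup_sqr.
- apply: filterS ae_regular_point => z rz.
  have := score_sqr_lip rz r0; rewrite -/c.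
  by have := sqr_ge0 (saa_score z - 2 * saa_score z0); nra.
- have i1 : F.-integrable setT (fun z => (4 * c * sup_sqr z)%:E).
    by under eq_fun do rewrite EFinM; exact: integrableZl.
  have i2 : F.-integrable setT (fun=> (2 * saa_score z0 ^+ 2 + 2 * c * (2 * sup_sqr z0))%:E).
    exact: finite_measure_integrable_cst.
  by have /integrableP[_] := integrableD measurableT i2 i1.
Qed.

Let K (s : seq Xi) : R := saa_value h s - saa_mean - \sum_(y <- s) saa_score y.

Let symK (y : nat -> Xi) s s' : perm_eq s s' ->
  K [seq y i | i <- s] = K [seq y i | i <- s'].
Proof.
move=> ss'; rewrite /K (saa_value_perm h y ss'); congr (_ - _).
by rewrite !big_map (perm_big _ ss').
Qed.

Let mK : measurable_fun setT (fun z : p.+1.-tuple Xi => K z).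
Proof.
apply: measurable_funB; first exact: measurable_funB.
under eq_fun do rewrite big_tuple; apply: measurable_sum => i.
exact: (measurableT_comp measurable_saa_score (measurable_tnth i)).
Qed.

Let sq_score i : sqintegrable P (fun w => saa_score (xi i w)).
Proof. exact: (sqintegrable_iid xi_iid sqintegrable_saa_score). Qed.

Let sqK : sqintegrable P (fun w => K [seq xi i w | i <- iota 0 p.+1]).
Proof.
apply: sqintegrableB; first apply: sqintegrableB.
- exact: sqH (size_iota 0 p.+1).
- exact: sqintegrable_cst.
- by under eq_fun do rewrite big_map; exact: sqintegrable_sum.
Qed.

(** With z frozen, the SAA value has mean [saa_proj z] = g(z) and the scores of the other points
    have mean zero. What remains is g(z) minus the mean minus the score of z, which is 0. *)
Let degK : {ae F, forall z,
    P.-integrable setT (EFin \o (fun w => K (z :: [seq xi i w | i <- iota 1 p]))) /\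
    (\int[P]_w (K (z :: [seq xi i w | i <- iota 1 p]))%:E = 0)%E}.
Proof.
apply: filterS ae_regular_point => z [hz gz].
have iz := sqintegrable_integrable (sqHz hz).
have isum : P.-integrable setT (EFin \o (fun w => \sum_(i <- iota 1 p) saa_score (xi i w))).
  by apply: integrable_sumr => i _ _; exact/sqintegrable_integrable/sq_score.
have ic : P.-integrable setT (fun=> (saa_mean + saa_score z)%:E).
  exact: finite_measure_integrable_cst.
have iB := integrableB measurableT iz ic.
have KE : EFin \o (fun w => K (z :: [seq xi i w | i <- iota 1 p])) =
    EFin \o (fun w => Hz z w - (saa_mean + saa_score z) - \sum_(i <- iota 1 p) saa_score (xi i w)).
  by apply/funext => w /=; rewrite /K /Hz big_cons big_map; congr EFin; ring.
have iK : P.-integrable setT (EFin \o (fun w => K (z :: [seq xi i w | i <- iota 1 p]))).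
  by rewrite KE; exact: (integrableB measurableT iB isum).
split=> //; rewrite -[LHS]fineK; last exact: integrable_fin_num iK.
congr EFin.
transitivity (\int[P]_w (Hz z w - (saa_mean + saa_score z) -
    \sum_(i <- iota 1 p) saa_score (xi i w))).
  by rewrite /Rintegral; congr fine; apply: eq_integral => w _; exact: (congr1 (fun f => f w) KE).
rewrite (RintegralB measurableT iB isum) (RintegralB measurableT iz ic).
rewrite Rintegral_probability_cst -/(saa_proj z) -gz Rintegral_sum; last first.
  by move=> i _ _; exact/sqintegrable_integrable/sq_score.
rewrite big1 => [|i _].
  by rewrite /saa_score; ring.
have ms : measurable_fun setT (fun z => (saa_score z)%:E).
  by apply/measurable_EFinP; exact: measurable_saa_score.
by rewrite /Rintegral (integral_iid xi_iid i ms); exact: Rintegral_saa_score.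
Qed.

Definition mean_sup_sqr : R := \int[F]_z sup_sqr z.

(** Write m for [sup_sqr] and k = p + 1. SAA values and scores both change by at most k^-1 sup_x
    |h(x, z) - h(x, z')|, whose square is at most k^-2 (2 m(z) + 2 m(z')). Squaring the difference
    of the two changes gives at most 8 k^-2 (m(z) + m(z')), and both envelopes have the same
    mean. *)
Let lipK : \int[P]_w ((K [seq xi i w | i <- iota 0 p.+1] -
    K [seq xi i w | i <- iota 0 p ++ [:: p.+1]]) ^+ 2) <=
  16 * p.+1%:R^-1 ^+ 2 * mean_sup_sqr.
Proof.
pose c := p.+1%:R^-1 ^+ 2 : R.
have mean i : \int[P]_w sup_sqr (xi i w) = mean_sup_sqr.
  rewrite /Rintegral; have ms : measurable_fun setT (fun z => (sup_sqr z)%:E).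
    by apply/measurable_EFinP; exact: measurable_sup_sqr.
  by rewrite (integral_iid xi_iid i ms).
have i8 i : P.-integrable setT (EFin \o (fun w => 8 * c * sup_sqr (xi i w))).
  rewrite (_ : _ \o _ = fun w => ((8 * c)%:E * (sup_sqr (xi i w))%:E)%E)//.
  exact: integrableZl.
have -> : 16 * p.+1%:R^-1 ^+ 2 * mean_sup_sqr =
    \int[P]_w (8 * c * sup_sqr (xi p w) + 8 * c * sup_sqr (xi p.+1 w)).
  have mean8 i : \int[P]_w (8 * c * sup_sqr (xi i w)) = 8 * c * mean_sup_sqr.
    by rewrite -(mean i) RintegralZl//; exact: integrable_sup_sqr_xi.
  rewrite (RintegralD measurableT (i8 p) (i8 p.+1)) !mean8 /c; ring.
have mKs s : size s = p.+1 -> measurable_fun setT (fun w => K [seq xi i w | i <- s]).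
  move=> /eqP sp; exact: (measurableT_comp mK (measurable_sample xi (Tuple sp))).
have bound : {ae P, forall w, (K [seq xi i w | i <- iota 0 p.+1] -
    K [seq xi i w | i <- iota 0 p ++ [:: p.+1]]) ^+ 2 <=
    8 * c * sup_sqr (xi p w) + 8 * c * sup_sqr (xi p.+1 w)}.
  apply: filterS2 (ae_iid xi_iid p ae_regular_point)
    (ae_iid xi_iid p.+1 ae_regular_point) => w r1 r2.
  rewrite -(addn1 p) iotaD/= add0n addn1.
  have p1 q : perm_eq (iota 0 p ++ [:: q]) (q :: iota 0 p) by rewrite perm_catC.
  rewrite (symK (xi^~ w) (p1 p)) (symK (xi^~ w) (p1 p.+1)) /= /K !big_cons.
  set s := [seq xi i w | i <- iota 0 p].
  have d1 : (saa_value h (xi p w :: s) - saa_value h (xi p.+1 w :: s)) ^+ 2 <=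
      c * (2 * sup_sqr (xi p w) + 2 * sup_sqr (xi p.+1 w)).
    rewrite -real_normK ?num_real// -sqrt_sqr -exprMn.
    rewrite lerXn2r ?nnegrE ?mulr_ge0 ?invr_ge0 ?sqrtr_ge0//.
    have := @saa_value_lip R X Xi h X0 (xi p w) (xi p.+1 w) s.
    rewrite size_map size_iota; apply => x.
    by apply: dist_sqrt; [case: r1|case: r2].
  have := score_sqr_lip r1 r2; rewrite -/c.
  move: d1; set a := saa_value h _; set b := saa_value h _.
  set u := saa_score _; set v := saa_score _; set m1 := sup_sqr _; set m2 := sup_sqr _.
  set S := \sum_(_ <- _) _.
  have -> : a - saa_mean - (u + S) - (b - saa_mean - (v + S)) = (a - b) - (u - v) by ring.
  by have := sqr_ge0 ((a - b) + (u - v)); nra.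
have i2 : P.-integrable setT (EFin \o (fun w => 8 * c * sup_sqr (xi p w) + 8 * c * sup_sqr (xi p.+1 w))).
  exact: (integrableD measurableT (i8 p) (i8 p.+1)).
have le2 : (\int[P]_w ((K [seq xi i w | i <- iota 0 p.+1] -
    K [seq xi i w | i <- iota 0 p ++ [:: p.+1]]) ^+ 2)%:E <=
    \int[P]_w (8 * c * sup_sqr (xi p w) + 8 * c * sup_sqr (xi p.+1 w))%:E)%E.
  apply: ae_ge0_le_integral => //.
  - by move=> w _; rewrite lee_fin sqr_ge0.
  - apply/measurable_EFinP/measurable_funX/measurable_funB; apply: mKs.
    + by rewrite size_iota.
    + by rewrite size_cat size_iota addn1.
  - move=> w _; rewrite lee_fin; have c0 : 0 <= 8 * c by rewrite mulr_ge0// sqr_ge0.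
    by rewrite addr_ge0// mulr_ge0// sup_sqr_ge0.
  - exact: (measurable_int _ i2).
  - by apply: filterS bound => w hw _; rewrite lee_fin.
have fin2 := integrable_fin_num measurableT i2.
apply: fine_le => //; rewrite ge0_fin_numE; last first.
  by apply: integral_ge0 => w _; rewrite lee_fin sqr_ge0.
by apply: (le_lt_trans le2); rewrite ltey_eq fin2.
Qed.

(** Each sample point lies in 'C(n - 1, k - 1) of the 'C(n, k) subsets, where k = p + 1, so its
    score enters with weight k/n. *)
Lemma ustatistic_saa_decomp n (y : nat -> Xi) : (p.+1 <= n)%N ->
  ustatistic K n p.+1 y = ustatistic (saa_value h) n p.+1 y - saa_mean -
    p.+1%:R / n%:R * \sum_(i < n) saa_score (y i).
Proof.
move=> pn; have n0 : (0 < n)%N by exact: leq_trans pn.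
have C0 : 'C(n, p.+1)%:R != 0 :> R by rewrite pnatr_eq0 -lt0n bin_gt0.
rewrite /ustatistic /K 2![in LHS]sumrB sumr_const mulrBr mulrBr.
have -> : #|[pred A : {set 'I_n} | #|A| == p.+1]| = 'C(n, p.+1).
  by rewrite -[in RHS](card_ord n) -card_draws cardsE.
rewrite -(mulr_natl saa_mean) (mulrA _ _ saa_mean) mulVf// mul1r; congr (_ - _).
transitivity ('C(n, p.+1)%:R^-1 * \sum_(i < n) ('C(n.-1, p)%:R * saa_score (y i))).
  congr (_ * _).
  transitivity (\sum_(A : {set 'I_n} | #|A| == p.+1) \sum_(i < n)
      (i \in A)%:R * saa_score (y i)).
    apply: eq_bigr => A _; rewrite big_map big_enum/= big_mkcond/=.
    by apply: eq_bigr => i _; case: (i \in A); rewrite ?mul1r ?mul0r.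
  rewrite exchange_big/=; apply: eq_bigr => i _; rewrite -mulr_suml; congr (_ * _).
  rewrite -natr_sum; congr (_%:R).
  rewrite -big_mkcondr/= sum1dep_card.
  have := @card_supersets _ [set i]%SET p.+1; rewrite cards1 card_ord => /(_ pn isT).
  rewrite !subn1/= => <-; rewrite -cardsE; apply: eq_card => A.
  by rewrite !inE finset.sub1set.
rewrite -mulr_sumr mulrA; congr (_ * _).
apply: (mulfI C0); rewrite mulrA mulfV// mul1r mulrA.
apply: (@mulIf _ n%:R); first by rewrite pnatr_eq0 -lt0n.
rewrite mulfVK ?pnatr_eq0 -?lt0n// -!natrM mulnC mulnC.
by rewrite [in LHS]mulnC mul_bin_diag mulnC.
Qed.

(** With k = p + 1 the bound simplifies to 8 k n^-2 [mean_sup_sqr]; multiplied by n it is of order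
    k/n. *)
Lemma hajek_remainder_le n : (p.+1 <= n)%N ->
  (\int[P]_w ((ustatistic (saa_value h) n p.+1 (fun i => xi i w) - saa_mean -
     p.+1%:R / n%:R * \sum_(i < n) saa_score (xi i w)) ^+ 2)%:E <=
   ((p.+1%:R / n%:R) ^+ 2 * (p.+1%:R *
     (16 * p.+1%:R^-1 ^+ 2 * mean_sup_sqr / 2)))%:E)%E.
Proof.
move=> pn; have [_ K2] := sqK.
have deg := degenerate_pair xi_iid (ltn0Sn p) mK K2 degK.
have := ustatistic_sqr_le xi_iid (ltn0Sn p) symK mK K2 lipK deg pn.
by under eq_integral do rewrite ustatistic_saa_decomp//.
Qed.

(** * The q-th absolute moment of the score *)

Section higher_moment.
Variable q : R.
Hypothesis q1 : 1 < q.
Hypothesis msup_diff : measurable_fun [set: Xi * Xi]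
  (fun z : Xi * Xi => esup (fun x => `|h x z.1 - h x z.2| `^ q)).
Hypothesis momentq :
  (\int[F \x F]_z esup (fun x => `|h x z.1 - h x z.2| `^ q)%R < +oo)%E.

Let dd (z : Xi * Xi) : \bar R := esup (fun x => `|h x z.1 - h x z.2| `^ q).

Let dd_ge0 z : (0 <= dd z)%E.
Proof. by apply: esup_ge0 => // x; exact: powR_ge0. Qed.

Definition mean_sup_diff : R := fine (\int[F \x F]_z dd z).

(** Having mean zero, the score at z is the mean over an independent z' of the difference of the
    scores at z and z', to which the Lipschitz estimate applies. Jensen's inequality in z' and
    integration over z conclude. *)
Lemma saa_score_moment : (\int[F]_z (`|saa_score z| `^ q)%:E <=
  (p.+1%:R^-1 `^ q * mean_sup_diff)%:E)%E.
Proof.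
have q0 : 0 < q by exact: lt_trans q1.
pose I z := (\int[F]_z' dd (z, z'))%E.
have mI : measurable_fun setT I by exact: (measurable_fun_fubini_tonelli_F (m2 := F) dd).
have I0 z : (0 <= I z)%E by apply: integral_ge0.
have EI : (\int[F]_z I z = \int[F \x F]_z dd z)%E by rewrite fubini_tonelli1.
have ddfin : (\int[F \x F]_z dd z)%E = mean_sup_diff%:E.
  by rewrite /mean_sup_diff fineK// ge0_fin_numE//; exact: integral_ge0.
have iI : F.-integrable setT I.
  apply/integrableP; split => //; under eq_integral do rewrite gee0_abs//.
  by rewrite EI ddfin ltry.
rewrite EFinM -ddfin -EI -ge0_integralZl_EFin ?powR_ge0//.
apply: ae_ge0_le_integral => //.
- apply/measurable_EFinP; apply: (measurableT_comp (measurable_powR _)).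
  by apply: measurableT_comp => //; exact: measurable_saa_score.
- by move=> z _; rewrite mule_ge0// lee_fin powR_ge0.
- exact: measurable_funeM.
have := integrable_ae measurableT iI.
apply: filterS2 ae_regular_point => z rz /(_ Logic.I) Ifin _.
have mddz : measurable_fun setT (fun z' => dd (z, z')).
  exact: (measurableT_comp msup_diff (pair1_measurable z)).
have iddz : F.-integrable setT (fun z' => dd (z, z')).
  apply/integrableP; split => //; under eq_integral do rewrite gee0_abs//.
  by rewrite -/(I z) -ge0_fin_numE.
(* The q-th root recovers the supremum of the differences from that of their q-th powers. *)
pose u z' := p.+1%:R^-1 * fine (dd (z, z')) `^ q^-1.
have u0 z' : 0 <= u z' by rewrite mulr_ge0 ?powR_ge0 ?invr_ge0.
have mu : measurable_fun setT u.
  apply: measurable_funM => //; apply: (measurableT_comp (measurable_powR _)).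
  by apply: measurableT_comp.
have score_le : (`|saa_score z|%:E <= \int[F]_z' (u z')%:E)%E.
  have icz : F.-integrable setT (fun=> (saa_score z)%:E).
    exact: finite_measure_integrable_cst.
  have idiff := integrableB measurableT icz integrable_saa_score.
  have -> : saa_score z = \int[F]_z' (saa_score z - saa_score z').
    rewrite (RintegralB measurableT icz integrable_saa_score).
    by rewrite Rintegral_probability_cst Rintegral_saa_score subr0.
  apply: (@le_trans _ _ (\int[F]_z' `|saa_score z - saa_score z'|%:E)%E).
    rewrite -[leRHS]fineK.
      by rewrite lee_fin; exact: le_normr_Rintegral.
    exact: (integrable_fin_num measurableT (integrable_norm idiff)).
  apply: ae_ge0_le_integral => //.
  - apply/measurable_EFinP; apply: measurableT_comp => //.
    by apply: measurable_funB => //; exact: measurable_saa_score.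
  - by move=> z' _; rewrite lee_fin.
  - exact/measurable_EFinP.
  have := integrable_ae measurableT iddz.
  apply: filterS2 ae_regular_point => z' rz' /(_ Logic.I) dfin _.
  rewrite lee_fin; apply: saa_score_lip => // x.
  have : `|h x z - h x z'| `^ q <= fine (dd (z, z')).
    rewrite -lee_fin fineK//; apply: ereal_sup_ubound; exists x => //.
  have qi0 : 0 <= q^-1 by rewrite invr_ge0 ltW.
  move=> /(ge0_ler_powR qi0); rewrite !nnegrE powR_ge0 fine_ge0// => /(_ isT isT).
  by rewrite -powRrM mulfV ?gt_eqF// powRr1.
apply: (@le_trans _ _ (\int[F]_z' (u z' `^ q)%:E)%E).
  apply: le_trans (powR_Rintegral_le F q1 mu u0).
  rewrite -poweR_EFin; apply: gt0_ler_poweR;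
    rewrite ?in_itv/= ?leey ?andbT ?(ltW q0) ?lee_fin//.
  by apply: integral_ge0 => z' _; rewrite lee_fin.
rewrite /I -ge0_integralZl_EFin ?powR_ge0//.
apply: ge0_le_integral => //.
- by move=> z' _; rewrite lee_fin powR_ge0.
- by apply/measurable_EFinP; exact: (measurableT_comp (measurable_powR _)).
- exact: measurable_funeM.
move=> z' _; rewrite /u powRM ?powR_ge0 ?invr_ge0// EFinM.
apply: lee_wpmul2l; first by rewrite lee_fin powR_ge0.
rewrite -powRrM mulVf ?gt_eqF// powRr1 ?fine_ge0//.
by have := dd_ge0 (z, z'); case: (dd _) => //= *; rewrite leey.
Qed.

End higher_moment.

End saa_sampling.

(** * Normalised sums and the limit *)

Section product_marginals.
Context (R : realType) d d' (T : measurableType d) (T' : measurableType d').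
Variables (P : probability T R) (Q : probability T' R).

Lemma integral_fst (f : T -> \bar R) : measurable_fun setT f ->
  (\int[P \x Q]_w f w.1 = \int[P]_z f z)%E.
Proof.
pose Y := [the {mfun _ >-> _} of HB.pack_for {mfun (T * T')%type >-> T} fst
  (isMeasurableFun.Build _ _ _ _ fst measurable_fst)].
apply: (@integral_distributed _ _ _ _ _ (P \x Q)%E P Y) => B mB.
rewrite /distribution/= /pushforward.
rewrite (_ : Y @^-1` B = B `*` setT); last by apply/seteqP; split => -[a b]//= [].
by rewrite product_measure1E// [X in (_ * X)%E](probability_setT Q) mule1.
Qed.

Lemma integral_snd (f : T' -> \bar R) : measurable_fun setT f ->
  (\int[P \x Q]_w f w.2 = \int[Q]_z f z)%E.
Proof.
pose Y := [the {mfun _ >-> _} of HB.pack_for {mfun (T * T')%type >-> T'} snd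
  (isMeasurableFun.Build _ _ _ _ snd measurable_snd)].
apply: (@integral_distributed _ _ _ _ _ (P \x Q)%E Q Y) => B mB.
rewrite /distribution/= /pushforward.
rewrite (_ : Y @^-1` B = setT `*` B); last by apply/seteqP; split => -[a b]//= [].
by rewrite product_measure1E// [X in (X * _)%E](probability_setT P) mul1e.
Qed.

End product_marginals.

Lemma tail_le_sqr (R : realType) d (T : measurableType d) (P : probability T R)
  (Y : T -> R) e : measurable_fun setT Y -> 0 < e ->
  (P [set w | (e <= `|Y w|)%R] <= (e ^- 2)%:E * \int[P]_w (Y w ^+ 2)%:E)%E.
Proof.
move=> mY e0; have e20 : 0 < e ^+ 2 by rewrite exprn_gt0.
rewrite lee_pdivlMl//.
have m2 : measurable_fun setT (EFin \o (fun w => Y w ^+ 2)).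
  by apply/measurable_EFinP; exact: measurable_funX.
have := le_integral_comp_abse P measurableT (f := id)
  (@measurable_id _ _ setT) (fun r r0 => r0) (fun _ _ _ _ h => h) m2 e20.
rewrite setTI => h1; rewrite (_ : [set w | _] = [set w | ((e ^+ 2)%:E <= `|(Y w ^+ 2)%:E|)%E]).
  apply: le_trans h1 _; rewrite le_eqVlt; apply/orP; left; apply/eqP.
  by apply: eq_integral => w _ /=; rewrite ger0_norm ?sqr_ge0.
apply/seteqP; split => w /=; rewrite lee_fin normrX ler_pXn2r ?nnegrE ?(ltW e0)//.
Qed.

(** * Mean and variance of sums of centred iid terms *)

Section iid_sums.
Context (R : realType) d d' (T : measurableType d) (Xi : measurableType d').
Variables (P : probability T R) (F : probability Xi R).
Variable xi : nat -> {RV P >-> Xi}.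
Hypothesis xi_iid : iid F xi.
Variable phi : Xi -> R.
Hypothesis sqphi : sqintegrable F phi.

Hypothesis phi0 : \int[F]_z phi z = 0.

Lemma Rintegral_iid_pair i j : i != j ->
  \int[P]_w (phi (xi i w) * phi (xi j w)) = 0.
Proof.
move=> ij; have [mphi phi2] := sqphi.
pose s := [tuple i]; pose t := [tuple j].
pose f (p : 1.-tuple Xi * 1.-tuple Xi) : R := phi (tnth p.1 ord0) * phi (tnth p.2 ord0).
have ust : uniq (s ++ t) by rewrite /= inE ij.
have m1 : measurable_fun setT (fun z : 1.-tuple Xi => phi (tnth z ord0)).
  by apply: (measurableT_comp mphi); exact: measurable_tnth.
have mf : measurable_fun setT f.
  by apply: measurable_funM; apply: (measurableT_comp m1).
have [mi i2] := sqintegrable_iid xi_iid sqphi i.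
have [mj j2] := sqintegrable_iid xi_iid sqphi j.
have ij_int := integrable_mulr mi mj i2 j2.
have fi : (law xi s \x law xi t)%E.-integrable setT (EFin \o f).
  apply/integrableP; split; first exact/measurable_EFinP.
  rewrite -(integral_sample_cat xi_iid ust (f := fun p => `|(f p)%:E|%E)).
    by have /integrableP[_] := ij_int.
  by apply: measurableT_comp => //; exact/measurable_EFinP.
have phiF0 : (\int[F]_z (phi z)%:E = 0)%E.
  rewrite -(fineK (integrable_fin_num measurableT (sqintegrable_integrable sqphi))).
  exact: (congr1 EFin phi0).
rewrite /Rintegral.
transitivity (fine (\int[P]_w (EFin \o f) (sample xi s w, sample xi t w))%E).
  by congr fine; apply: eq_integral => w _.
rewrite (integral_sample_cat xi_iid ust); last exact/measurable_EFinP.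
rewrite -integral12_prod_meas1// integral0_eq// => z _ /=.
rewrite /fubini_F -(integral_law xi t (f := fun y => (f (z, y))%:E)); last first.
  by apply/measurable_EFinP; exact: (measurableT_comp mf (pair1_measurable z)).
rewrite /f/=; under eq_integral do rewrite EFinM.
rewrite integralZl//=.
  by rewrite (integral_iid xi_iid _ (h := EFin \o phi)) ?phiF0 ?mule0//; exact/measurable_EFinP.
exact: (sqintegrable_integrable (sqintegrable_iid xi_iid sqphi j)).
Qed.

Lemma Rintegral_iid_sum n : \int[P]_w (\sum_(i < n) phi (xi i w)) = 0.
Proof.
have [mphi _] := sqphi.
rewrite Rintegral_sum; last first.
  by move=> i _ _; exact: (sqintegrable_integrable (sqintegrable_iid xi_iid sqphi i)).
rewrite big1// => i _; rewrite -[RHS]phi0 /Rintegral; congr fine.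
by apply: (integral_iid xi_iid i (h := EFin \o phi)); exact/measurable_EFinP.
Qed.

Lemma Rintegral_iid_sum_sqr n :
  \int[P]_w ((\sum_(i < n) phi (xi i w)) ^+ 2) = n%:R * \int[F]_z (phi z ^+ 2).
Proof.
have [mphi phi2] := sqphi.
have im (i j : nat) : P.-integrable setT (EFin \o (fun w => phi (xi i w) * phi (xi j w))).
  have [mi i2] := sqintegrable_iid xi_iid sqphi i.
  have [mj j2] := sqintegrable_iid xi_iid sqphi j.
  exact: integrable_mulr.
under eq_Rintegral do rewrite expr2 big_distrlr/=.
rewrite Rintegral_sum; last by move=> i _ _; apply: integrable_sumr => j _ _; exact: im.
transitivity (\sum_(i < n) \int[F]_z (phi z ^+ 2)); last first.
  by rewrite sumr_const card_ord mulr_natl.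
apply: eq_bigr => i _; rewrite Rintegral_sum; last by move=> j _ _; exact: im.
rewrite (bigD1 i)//= big1 ?addr0; last first.
  by move=> j ji; apply: Rintegral_iid_pair; rewrite eq_sym.
rewrite /Rintegral; congr fine.
transitivity (\int[P]_w (phi (xi i w) ^+ 2)%:E)%E; first exact: eq_integral.
apply: (integral_iid xi_iid i (h := fun z => (phi z ^+ 2)%:E)).
by apply/measurable_EFinP; exact: measurable_funX.
Qed.

End iid_sums.

Lemma variance_sqr (R : realType) d (T : measurableType d) (P : probability T R)
  (Y : T -> R) :
  ('V_P[Y] = \int[P]_w ((Y w - fine 'E_P[Y]) ^+ 2)%:E)%E.
Proof. by rewrite /variance !unlock; apply: eq_integral => w _. Qed.

(** With q = 2 + delta and y = sigma sqrt(n) p, the left-hand side is n / y^q. Since delta / q = 1 -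
    2/q, a = y^2 n^(-2/q), so n / y^q = a^(-q/2), which is at most 1/a because a >= 1 and q >= 2. *)
Lemma lindeberg_rate (R : realType) (p sigma n delta : R) :
  0 < p -> 0 < sigma -> 0 < n -> 0 < delta ->
  let a := p ^+ 2 * sigma ^+ 2 * n `^ (delta / (2 + delta)) in 1 <= a ->
  n * ((sigma * Num.sqrt n)^-1 `^ (2 + delta) * p^-1 `^ (2 + delta)) <= a^-1.
Proof.
move=> p0 s0 n0 d0 a a1; set q := 2 + delta; have q0 : 0 < q by rewrite /q; lra.
have a0 : 0 < a by exact: lt_le_trans a1.
have r0 : 0 < Num.sqrt n by rewrite sqrtr_gt0.
pose y := sigma * Num.sqrt n * p; have y0 : 0 < y by rewrite !mulr_gt0.
have -> : (sigma * Num.sqrt n)^-1 `^ q * p^-1 `^ q = (y `^ q)^-1.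
  have i1 : 0 <= (sigma * Num.sqrt n)^-1 by rewrite invr_ge0 ltW// mulr_gt0.
  have i2 : 0 <= p^-1 by rewrite invr_ge0 ltW.
  by rewrite -powRM// -invfM -(powR_inv1 (ltW y0)) -powRrM mulN1r powRN.
have e : a `^ (q / 2) = y `^ q / n.
  have c0 : 0 <= p ^+ 2 * sigma ^+ 2 by rewrite mulr_ge0// sqr_ge0.
  have -> : a = y ^+ 2 * n `^ (- (2 / q)).
    rewrite /y !exprMn sqr_sqrtr ?(ltW n0)// /a -/q.
    have -> : delta / q = 1 + - (2 / q) by rewrite /q; field; rewrite gt_eqF.
    rewrite powRD; last by rewrite (gt_eqF n0) implybT.
    by rewrite powRr1 ?(ltW n0)//; ring.
  rewrite powRM ?sqr_ge0 ?powR_ge0// -powR_mulrn ?(ltW y0)// -!powRrM.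
  have -> : 2 * (q / 2) = q by field.
  have -> : - (2 / q) * (q / 2) = -1 by field; rewrite gt_eqF.
  by rewrite powR_inv1// ltW.
have yq0 : 0 < y `^ q by rewrite powR_gt0.
have -> : n * (y `^ q)^-1 = (a `^ (q / 2))^-1 by rewrite e invf_div.
rewrite lef_pV2 ?posrE ?powR_gt0//; apply: le1r_powR => //.
by rewrite ler_pdivlMr//; rewrite /q; lra.
Qed.

Section standardized_sum.
Context (R : realType) d d' (T : measurableType d) (Xi : measurableType d').
Variables (P : probability T R) (F : probability Xi R).
Variable xi : nat -> {RV P >-> Xi}.

Definition standardized_sum (phi : Xi -> R) (sigma : R) n (w : T * measurableTypeR R) : R :=
  if 0 < sigma then (sigma * Num.sqrt n%:R)^-1 * \sum_(i < n) phi (xi i w.1)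
  else w.2.

Variables (phi : Xi -> R) (sigma : R).
Hypothesis mphi : measurable_fun setT phi.

Lemma measurable_iid_sum n : measurable_fun setT (fun w => \sum_(i < n) phi (xi i w)).
Proof. by apply: measurable_sum => i; exact: measurableT_comp. Qed.

Lemma measurable_standardized_sum n : measurable_fun setT (standardized_sum phi sigma n).
Proof.
rewrite /standardized_sum; have [s0|s0] := ltP 0 sigma; last exact: measurable_snd.
apply: measurable_funM => //.
exact: (measurableT_comp (measurable_iid_sum n) measurable_fst).
Qed.

Hypothesis xi_iid : iid F xi.
Hypothesis sqphi : sqintegrable F phi.
Hypothesis phi0 : \int[F]_z phi z = 0.
Hypothesis sigma0 : 0 <= sigma.
Hypothesis sigma2 : \int[F]_z (phi z ^+ 2) = sigma ^+ 2.

Let N01 : probability (measurableTypeR R) R := normal_prob 0 1.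

Lemma expectation_standardized_sum n :
  ('E_(P \x N01)[standardized_sum phi sigma n] = 0)%E.
Proof.
rewrite unlock /standardized_sum; have [s0|s0] := ltP 0 sigma; last first.
  apply: (etrans (integral_snd P N01 (f := EFin) _)); first exact: EFin_measurable.
  exact: integral_normal_id.
pose c := (sigma * Num.sqrt n%:R)^-1.
have mS := measurable_iid_sum n.
apply: (etrans (integral_fst P N01 (f := fun z => (c * \sum_(i < n) phi (xi i z))%:E) _)).
  by apply/measurable_EFinP; exact: measurable_funM.
have iS : P.-integrable setT (EFin \o (fun z => \sum_(i < n) phi (xi i z))).
  apply: integrable_sumr => i _ _; apply: sqintegrable_integrable.
  exact: (sqintegrable_iid xi_iid).
under eq_integral do rewrite EFinM.
rewrite integralZl//= -(fineK (integrable_fin_num measurableT iS)).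
by rewrite [fine _](Rintegral_iid_sum xi_iid sqphi phi0) mule0.
Qed.

Lemma variance_standardized_sum n : (0 < n)%N ->
  ('V_(P \x N01)[standardized_sum phi sigma n] = 1)%E.
Proof.
move=> n0; rewrite variance_sqr expectation_standardized_sum.
under eq_integral do rewrite subr0.
rewrite /standardized_sum; have [s0|s0] := ltP 0 sigma; last first.
  apply: (etrans (integral_snd P N01 (f := fun x => (x ^+ 2)%:E) _)).
    by apply/measurable_EFinP; exact: measurable_funX.
  by rewrite integral_normal_sqr// expr1n.
pose c := (sigma * Num.sqrt n%:R)^-1.
have mS := measurable_iid_sum n.
have sqS : sqintegrable P (fun z => \sum_(i < n) phi (xi i z)).
  by apply: sqintegrable_sum => i; exact: (sqintegrable_iid xi_iid).
have [_ S2] := sqS.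
have S2fin : (\int[P]_z ((\sum_(i < n) phi (xi i z)) ^+ 2)%:E \is a fin_num)%E.
  by rewrite ge0_fin_numE//; apply: integral_ge0 => z _; rewrite lee_fin sqr_ge0.
apply: (etrans (integral_fst P N01
  (f := fun z => ((c * \sum_(i < n) phi (xi i z)) ^+ 2)%:E) _)).
  by apply/measurable_EFinP/measurable_funX; exact: measurable_funM.
under eq_integral do rewrite exprMn EFinM.
rewrite ge0_integralZl_EFin ?sqr_ge0//; last first.
- by apply/measurable_EFinP; exact: measurable_funX.
- by move=> z _; rewrite lee_fin sqr_ge0.
rewrite -(fineK S2fin) [fine _](Rintegral_iid_sum_sqr xi_iid sqphi phi0) sigma2 -EFinM.
have N0 : 0 < n%:R :> R by rewrite ltr0n.
rewrite /c exprVn exprMn sqr_sqrtr ?ler0n// [sigma ^+ 2 * _]mulrC mulVf//.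
by rewrite mulf_neq0 ?gt_eqF// exprn_gt0.
Qed.

Lemma Rintegral_standardized_sum n (f : R -> R) : 0 < sigma -> unit_valued f ->
  \int[(P \x N01)%E]_w f (standardized_sum phi sigma n w) =
  iter n (shift_avg F (fun z => (sigma * Num.sqrt n%:R)^-1 * phi z)) f 0.
Proof.
move=> s0 uf; set c := (_ * _)^-1.
have [mf _] := uf.
rewrite -(expectation_shift_sum xi_iid n 0 (measurable_funM (measurable_cst c) mphi) uf).
rewrite /Rintegral /standardized_sum s0; congr fine.
apply: (etrans (integral_fst P N01
  (f := fun z => (f (c * \sum_(i < n) phi (xi i z)))%:E) _)).
  apply/measurable_EFinP; apply: (measurableT_comp mf); apply: measurable_funM => //.
  exact: measurable_iid_sum.
by apply: eq_integral => w _; rewrite add0r mulr_sumr.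
Qed.

(** This is Lindeberg's bound for phi / (sigma sqrt n). Over n steps, eps / n adds up to eps, the
    normal remainder 4 n^(-3/2) to 4 n^(-1/2), and the moment term is at most a multiple of 1/t by
    [lindeberg_rate]. *)
Lemma standardized_sum_smooth_le n p delta C a b eps : (0 < n)%N -> 0 < sigma ->
  0 < p -> 0 < delta -> 0 <= C -> 0 < b -> 0 < eps ->
  (\int[F]_z (`|phi z| `^ (2 + delta))%:E <= (p^-1 `^ (2 + delta) * C)%:E)%E ->
  let t := p ^+ 2 * sigma ^+ 2 * n%:R `^ (delta / (2 + delta)) in 1 <= t ->
  `|\int[(P \x N01)%E]_w smooth_step a b (standardized_sum phi sigma n w) -
    \int[N01]_y smooth_step a b y| <=
  3 * (b ^+ 2 + b ^+ 3) *
    (eps + eps `^ (- delta) * C * t^-1 + 4 * (Num.sqrt n%:R)^-1).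
Proof.
move=> n0 s0 p0 d0 C0 b0 e0 phiC t t1.
have N0 : 0 < n%:R :> R by rewrite ltr0n.
have r0 : 0 < Num.sqrt n%:R :> R by rewrite sqrtr_gt0.
rewrite Rintegral_standardized_sum//; last exact: unit_valued_smooth_step.
set c := (sigma * _)^-1.
have c0 : 0 <= c by rewrite invr_ge0 ltW// mulr_gt0.
have mc : measurable_fun setT (fun z => c * phi z) by exact: measurable_funM.
have iphi := sqintegrable_integrable sqphi.
have [_ phi2] := sqphi.
have phi2fin : (\int[F]_z (phi z ^+ 2)%:E \is a fin_num)%E.
  by rewrite ge0_fin_numE//; apply: integral_ge0 => z _; rewrite lee_fin sqr_ge0.
have mpow : measurable_fun setT (fun z => (`|phi z| `^ (2 + delta))%:E).
  apply/measurable_EFinP; apply: (measurableT_comp (measurable_powR _)).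
  exact: measurableT_comp.
pose L := c `^ (2 + delta) * (p^-1 `^ (2 + delta) * C).
apply: (le_trans (@lindeberg_smooth_step _ _ _ F (fun z => c * phi z) n a b delta eps L
  n0 mc _ _ _ _ b0 d0 e0)).
- rewrite (_ : _ \o _ = fun z => (c%:E * (phi z)%:E)%E)//.
  exact: integrableZl.
- under eq_integral do rewrite EFinM.
  rewrite integralZl//= -(fineK (integrable_fin_num measurableT iphi)).
  by rewrite [fine _]phi0 mule0.
- under eq_integral do rewrite exprMn EFinM.
  rewrite ge0_integralZl_EFin ?sqr_ge0//; last first.
  + by apply/measurable_EFinP; exact: measurable_funX.
  + by move=> z _; rewrite lee_fin sqr_ge0.
  rewrite -(fineK phi2fin) [fine _]sigma2 -EFinM /c exprVn exprMn sqr_sqrtr ?ler0n//.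
  by congr EFin; field; rewrite !gt_eqF.
- under eq_integral do rewrite normrM (ger0_norm c0) powRM// EFinM.
  rewrite ge0_integralZl_EFin ?powR_ge0// /L EFinM lee_wpmul2l// lee_fin powR_ge0//.
set K := 3 * _; have K0 : 0 <= K by rewrite /K mulr_ge0// addr_ge0// exprn_ge0// ltW.
rewrite mulrCA ler_wpM2l//.
have rate := lindeberg_rate p0 s0 N0 d0 t1.
have E1 : 0 <= eps `^ (- delta) * C by rewrite mulr_ge0// powR_ge0.
have -> : n%:R * (eps / n%:R + eps `^ (- delta) * L + 4 * (Num.sqrt n%:R)^-1 ^+ 3) =
    eps + eps `^ (- delta) * C *
      (n%:R * (c `^ (2 + delta) * p^-1 `^ (2 + delta))) + 4 * (Num.sqrt n%:R)^-1.
  have := sqr_sqrtr (ler0n R n).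
  rewrite /L; move: (c `^ (2 + delta)) (p^-1 `^ (2 + delta)) (eps `^ (- delta)).
  move=> u v w; move: (Num.sqrt _) r0 => r r0 <-.
  by field; rewrite gt_eqF.
by rewrite lerD2r lerD2l ler_wpM2l.
Qed.

End standardized_sum.

Lemma measurable_ustatistic (R : realType) d d' (T : measurableType d)
  (Xi : measurableType d') (P : probability T R) (xi : nat -> {RV P >-> Xi})
  (K : seq Xi -> R) n k : measurable_fun setT (fun z : k.-tuple Xi => K z) ->
  measurable_fun setT (fun w => ustatistic K n k (fun i => xi i w)).
Proof.
move=> mK; apply: measurable_funM => //.
suff h (s : seq {set 'I_n}) : measurable_fun setT (fun w =>
  \sum_(A <- s | #|A| == k) K [seq xi (val i) w | i <- enum A]) by exact: h.
elim: s => [|A s ih]; first by under eq_fun do rewrite big_nil; exact: measurable_cst.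
have [Ak|nAk] := boolP (#|A| == k); last by under eq_fun do rewrite big_cons (negbTE nAk).
under eq_fun do rewrite big_cons Ak; apply: measurable_funD => //.
have sA : size [seq val i | i <- enum A] == k by rewrite size_map -cardE.
have := measurableT_comp mK (measurable_sample xi (Tuple sA)).
congr measurable_fun; apply/funext => w.
by rewrite /= /sample/= -map_comp.
Qed.

Section saa_limit.
Context (R : realType) (dXi : measure_display) (Xi : measurableType dXi).
Variables (F : probability Xi R) (X : Type) (h : X -> Xi -> R).
Context (dO : measure_display) (Omega : measurableType dO).
Variables (P : probability Omega R) (xi : nat -> {RV P >-> Xi}).
Hypotheses (X0 : [set: X] !=set0) (xi_iid : iid F xi).
Hypothesis msup : measurable_fun [set: Xi] (fun z => esup (fun x => `|h x z| ^+ 2)).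
Hypothesis moment2 : (\int[F]_z esup (fun x => `|h x z| ^+ 2)%R < +oo)%E.
Variable p : nat.
Hypothesis mH : measurable_fun setT (fun z : p.+1.-tuple Xi => saa_value h z).
Variable g : Xi -> R.
Hypothesis g_cond : is_cond_expectation
  (fun w => saa_value h [seq xi i w | i <- iota 0 p.+1]) (xi 0%N) g.

Let phi := saa_score h xi p g.
Let sigma := Num.sqrt (fine 'V_F[g])%E.
Let N01 : probability (measurableTypeR R) R := normal_prob 0 1.

Let mphi : measurable_fun setT phi. Proof. exact: measurable_saa_score g_cond. Qed.
Let sqphi : sqintegrable F phi.
Proof. exact: sqintegrable_saa_score X0 xi_iid msup moment2 _ mH _ g_cond. Qed.
Let phi0 : \int[F]_z phi z = 0. Proof. exact: Rintegral_saa_score xi_iid _ _ g_cond. Qed.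

Lemma Rintegral_saa_score_sqr :
  \int[F]_z (phi z ^+ 2) = Num.sqrt (fine 'V_F[g])%E ^+ 2.
Proof.
have -> : (fine 'V_F[g])%E = \int[F]_z (phi z ^+ 2).
  rewrite variance_sqr unlock -[fine (\int[F]_w (g w)%:E)%E]/(\int[F]_w g w).
  by rewrite (Rintegral_saa_cond xi_iid g_cond).
by rewrite sqr_sqrtr// Rintegral_ge0// => z _; exact: sqr_ge0.
Qed.

(** When sigma > 0 it cancels against the normalisation and leaves (k / sqrt n) times the sum of the
    scores, so the residual is sqrt n times the Hoeffding remainder; Chebyshev's inequality
    concludes. *)
Lemma saa_residual_tail n (e : R) : (p < n)%N -> 0 < e ->
  ((P \x N01)%E [set w | (e <= `|Num.sqrt n%:R *
    (ustatistic (saa_value h) n p.+1 (fun i => xi i w.1) -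
     fine ('E_P[fun v => saa_value h [seq xi i v | i <- iota 0 p.+1]])%E) -
    p.+1%:R * sigma * standardized_sum xi phi sigma n w|)%R] <=
  (e ^- 2 * (8 * mean_sup_sqr F h * (p.+1%:R / n%:R)))%:E)%E.
Proof.
move=> pn e0; have n0 : 0 < n%:R :> R by rewrite ltr0n (leq_trans _ pn).
have r0 : 0 < Num.sqrt n%:R :> R by rewrite sqrtr_gt0.
have -> : fine ('E_P[fun v => saa_value h [seq xi i v | i <- iota 0 p.+1]])%E =
    saa_mean h xi p by rewrite unlock.
pose U v := ustatistic (saa_value h) n p.+1 (fun i => xi i v) - saa_mean h xi p.
have mU : measurable_fun setT U.
  by apply: measurable_funB => //; exact: measurable_ustatistic.
pose S v := \sum_(i < n) phi (xi i v).
have mS : measurable_fun setT S by exact: measurable_iid_sum.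
(* When sigma = 0 the auxiliary variable is multiplied by 0 and no sum appears. The scores then
   vanish almost everywhere, so [Y] still agrees almost surely with sqrt n times the remainder. *)
pose Y v := Num.sqrt n%:R * U v -
  (if 0 < sigma then p.+1%:R / Num.sqrt n%:R * S v else 0).
have mY : measurable_fun setT Y.
  apply: measurable_funB; first exact: measurable_funM.
  by have [s0|s0] := ltP 0 sigma => //; exact: measurable_funM.
have mY2 : measurable_fun setT (fun v => (Y v ^+ 2)%:E).
  by apply/measurable_EFinP; exact: measurable_funX.
have YE w : Num.sqrt n%:R * U w.1 -
    p.+1%:R * sigma * standardized_sum xi phi sigma n w = Y w.1.
  rewrite /Y /standardized_sum; have [s0|s0] := ltP 0 sigma.
    by congr (_ - _); rewrite -/(S w.1); field; rewrite !gt_eqF.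
  have -> : sigma = 0 by apply/eqP; rewrite eq_le s0 sqrtr_ge0.
  by rewrite mulr0 mul0r.
under eq_set do rewrite YE.
apply: (le_trans (tail_le_sqr (P \x N01)%E (measurableT_comp mY measurable_fst) e0)).
rewrite EFinM lee_wpmul2l ?lee_fin ?invr_ge0 ?sqr_ge0//=.
rewrite (integral_fst P N01 mY2).
pose r v := U v - p.+1%:R / n%:R * S v.
have mr : measurable_fun setT (fun v => (r v ^+ 2)%:E).
  apply/measurable_EFinP/measurable_funX/measurable_funB => //.
  exact: measurable_funM.
have -> : (\int[P]_v (Y v ^+ 2)%:E = \int[P]_v (n%:R%:E * (r v ^+ 2)%:E))%E.
  apply: ae_eq_integral => //; first exact: measurable_funeM.
  have Yr v : (if 0 < sigma then p.+1%:R / Num.sqrt n%:R * S v else 0) =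
      p.+1%:R / Num.sqrt n%:R * S v -> Y v = Num.sqrt n%:R * r v.
    rewrite /Y /r => ->; rewrite [RHS]mulrBr; congr (_ - _).
    rewrite -{3}(sqr_sqrtr (ltW n0)); move: (Num.sqrt _) r0 => c c0.
    by field; rewrite gt_eqF.
  have Yr2 v : Y v = Num.sqrt n%:R * r v -> (Y v ^+ 2)%:E = (n%:R%:E * (r v ^+ 2)%:E)%E.
    by move=> ->; rewrite exprMn sqr_sqrtr ?EFinM// ltW.
  have [s0|s0] := ltP 0 sigma.
    by apply: aeW => v _; apply: Yr2; apply: Yr; rewrite s0.
  have sigma0 : sigma = 0 by apply/eqP; rewrite eq_le s0 sqrtr_ge0.
  have phi_ae : {ae F, forall z, phi z = 0}.
    have mphi2 : measurable_fun setT (fun z => (phi z ^+ 2)%:E).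
      by apply/measurable_EFinP; exact: measurable_funX.
    have [_ phi2] := sqphi.
    have [/(_ _)+ _] := ae_eq_integral_abs F measurableT mphi2.
    have -> : (\int[F]_z `|(phi z ^+ 2)%:E| = 0)%E.
      under eq_integral do rewrite gee0_abs ?lee_fin ?sqr_ge0//.
      rewrite -[LHS]fineK; last first.
        by rewrite ge0_fin_numE//; apply: integral_ge0 => z _; rewrite lee_fin sqr_ge0.
      by rewrite [fine _]Rintegral_saa_score_sqr -/sigma sigma0 expr0n.
    move=> /(_ erefl); apply: filterS => z /(_ Logic.I)/(congr1 fine)/=/eqP.
    by rewrite sqrf_eq0 => /eqP.
  have : {ae P, forall v, forall i, phi (xi i v) = 0}.
    by apply: ae_foralln => i; exact: ae_iid xi_iid i _ phi_ae.
  apply: filterS => v phiv _; apply: Yr2; apply: Yr.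
  by rewrite ltNge s0/= /S big1 ?mulr0.
rewrite ge0_integralZl_EFin ?ler0n//; last by move=> v _; rewrite lee_fin sqr_ge0.
have := hajek_remainder_le X0 xi_iid msup moment2 mH g_cond pn.
move=> /(lee_wpmul2l (x := n%:R%:E)); rewrite lee_fin ler0n => /(_ isT).
move=> /le_trans; apply; rewrite -EFinM lee_fin le_eqVlt; apply/orP; left; apply/eqP.
by field; rewrite gt_eqF//= addrC natr1 pnatr_eq0.
Qed.

End saa_limit.

Theorem theorem3 (R : realType)
    (dXi : measure_display) (Xi : measurableType dXi) (F : probability Xi R)
    (X : Type) (h : X -> Xi -> R)
    (dO : measure_display) (Omega : measurableType dO)
    (P : probability Omega R) (xi : nat -> {RV P >-> Xi})
    (g : nat -> Xi -> R) (delta : R) (k : nat -> nat)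
    (X_nonempty : [set: X] !=set0)
    (xi_iid : iid F xi)
    (* measurability of the cost, of the SAA values and of the suprema *)
    (mh : forall x, measurable_fun [set: Xi] (h x))
    (mH : forall j, (0 < j)%N ->
      measurable_fun [set: j.-tuple Xi] (fun z : j.-tuple Xi => saa_value h z))
    (msup : measurable_fun [set: Xi]
      (fun z => esup (fun x => `|h x z| ^+ 2)))
    (msup_diff : measurable_fun [set: Xi * Xi]
      (fun z : Xi * Xi => esup (fun x => `|h x z.1 - h x z.2| `^ (2 + delta))))
    (* g j = g_j is the conditional expectation of H_j given xi_1 *)
    (g_cond : forall j, (0 < j)%N ->
      is_cond_expectation
        (fun w => saa_value h [seq xi i w | i <- iota 0 j]) (xi 0%N) (g j))
    (delta_gt0 : 0 < delta)
    (moment2 : (\int[F]_z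
      esup (fun x => `|h x z| ^+ 2)%R < +oo)%E)
    (moment2delta : (\int[F \x F]_z
      esup (fun x => `|h x z.1 - h x z.2| `^ (2 + delta))%R < +oo)%E)
    (k_range : forall n, (0 < n)%N -> (1 <= k n <= n)%N)
    (k_small : (k n)%:R / n%:R @[n --> \oo] --> (0 : R)) :
  (* Omega * A is the data space enlarged by independent randomness in A *)
  exists (dA : measure_display) (A : measurableType dA) (Q : probability A R)
         (Z : nat -> {RV (P \x Q)%E >-> R}),
  [/\ forall n, (0 < n)%N ->
        ('E_(P \x Q)[Z n] = 0 /\ 'V_(P \x Q)[Z n] = 1)%E,
      little_op1 (P \x Q)%E (fun n (w : Omega * A) =>
        Num.sqrt n%:R *
          (ustatistic (saa_value h) n (k n) (fun i => xi i w.1)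
           - fine ('E_P[fun v =>
                saa_value h [seq xi i v | i <- iota 0 (k n)]])%E)
        - (k n)%:R * Num.sqrt (fine ('V_F[g (k n)])%E) * Z n w) &
      forall s : nat -> nat, increasing_seq s ->
        (k (s m))%:R ^+ 2 * fine ('V_F[g (k (s m))])%E
          * (s m)%:R `^ (delta / (2 + delta)) @[m --> \oo] --> +oo ->
        cvg_in_distribution (fun m => Z (s m)) (normal_prob 0 1)].

Proof.
(* Writing the sample size as (p n).+1 keeps it positive for every n, including n = 0 where k n is
   unconstrained; it equals k n as soon as n > 0. *)
pose p n := (k n).-1.
have kE n : (0 < n)%N -> k n = (p n).+1.
  by move=> /k_range/andP[k1 _]; rewrite /p prednK.
have pn n : (0 < n)%N -> (p n < n)%N.
  by move=> n0; have /andP[_] := k_range n n0; rewrite {1}(kE n n0).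
have mHp n := mH _ (ltn0Sn (p n)).
have gp n := g_cond _ (ltn0Sn (p n)).
pose phi n := saa_score h xi (p n) (g (p n).+1).
pose sigma n := Num.sqrt (fine 'V_F[g (p n).+1])%E.
have mphi n : measurable_fun setT (phi n) by exact: measurable_saa_score (gp n).
have sqphi n : sqintegrable F (phi n).
  exact: sqintegrable_saa_score X_nonempty xi_iid msup moment2 _ (mHp n) _ (gp n).
have phi0 n : \int[F]_z phi n z = 0 by exact: Rintegral_saa_score xi_iid _ _ (gp n).
have sigma0 n : 0 <= sigma n by exact: sqrtr_ge0.
have sigma2 n : \int[F]_z (phi n z ^+ 2) = sigma n ^+ 2.
  exact: (Rintegral_saa_score_sqr xi_iid (gp n)).
pose N01 : probability (measurableTypeR R) R := normal_prob 0 1.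
have mZ n : measurable_fun setT (standardized_sum xi (phi n) (sigma n) n).
  exact: measurable_standardized_sum.
pose Z n : {RV (P \x N01)%E >-> R} := [the {mfun _ >-> _} of
  HB.pack_for {mfun _ >-> _} (standardized_sum xi (phi n) (sigma n) n)
    (isMeasurableFun.Build _ _ _ _ _ (mZ n))].
exists _, (measurableTypeR R), N01, Z; split.
- move=> n n0; split.
    have e1 := expectation_standardized_sum (sigma n) (mphi n) xi_iid (sqphi n) (phi0 n) n.
    exact: e1.
  exact: (variance_standardized_sum (mphi n) xi_iid (sqphi n) (phi0 n) (sigma2 n)).
- move=> e e0.
  pose bound n : R := e ^- 2 * (8 * mean_sup_sqr F h * ((k n)%:R / n%:R)).
  have cbound : bound n @[n --> \oo] --> (0 : R).
    rewrite -[X in _ --> X](mulr0 (e ^- 2)); apply: cvgMl_tmp.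
    by rewrite -[X in _ --> X](mulr0 (8 * mean_sup_sqr F h)); apply: cvgMl_tmp.
  apply: (@squeeze_cvge _ _ _ _ (cst 0%E) _ (EFin \o bound)).
  + near=> n; have n0 : (0 < n)%N by near: n; exact: nbhs_infty_gt.
    rewrite measure_ge0/= /bound (kE n n0).
    exact: (saa_residual_tail X_nonempty xi_iid msup moment2 (mHp n) (gp n) (pn n n0) e0).
  + exact: cvg_cst.
  + by apply: cvg_EFin => //; exact: nearW.
move=> s incs grow; apply: (@cvg_in_distribution_smooth _ _ _ _ (fun m => Z (s m)) N01) => a b b0.
have sm m : (m <= s m)%N.
  elim: m => // m ih; apply: leq_ltn_trans ih _.
  by rewrite ltnNge -leEnat (incs m.+1 m) ltnn.
pose C := mean_sup_diff F h (2 + delta).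
have C0 : 0 <= C.
  by apply: fine_ge0; apply: integral_ge0 => z _; apply: esup_ge0 => // x; exact: powR_ge0.
have q1 : 1 < 2 + delta by lra.
pose K := 3 * (b ^+ 2 + b ^+ 3).
have K0 : 0 < K by rewrite /K mulr_gt0// addr_gt0// exprn_gt0.
apply/cvgrPdist_lt => eta eta0.
(* The error bound has three terms, each made at most eta/4: K eps by this choice, D/t by a rate of
   at least 4 D / eta, and the normal remainder by m >= (16 K / eta)^2, as s m >= m. *)
pose eps := eta / (4 * K).
have eps0 : 0 < eps by rewrite divr_gt0// mulr_gt0.
pose D := K * (eps `^ (- delta) * C).
have D0 : 0 <= D by rewrite mulr_ge0 ?(ltW K0)// mulr_ge0// powR_ge0.
pose rate m : R := (k (s m))%:R ^+ 2 * fine ('V_F[g (k (s m))])%E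
  * (s m)%:R `^ (delta / (2 + delta)).
have {}grow : forall A, \forall m \near \oo, A <= rate m by apply/cvgryPge.
near=> m.
have m1 : (0 < m)%N by near: m; exact: nbhs_infty_gt.
have s0 : (0 < s m)%N by exact: leq_trans (sm m).
pose t := rate m; have t1 : 1 + 4 * D / eta <= t by rewrite /t; near: m; exact: grow.
have t2 : (16 * K / eta) ^+ 2 + 1 <= m%:R by near: m; exact: nbhs_infty_ger.
have tE : (p (s m)).+1%:R ^+ 2 * sigma (s m) ^+ 2 * (s m)%:R `^ (delta / (2 + delta)) = t.
  rewrite /t /rate /sigma -(kE _ s0) sqr_sqrtr// kE// fine_ge0//.
  by rewrite variance_sqr; apply: integral_ge0 => z _; rewrite lee_fin sqr_ge0.
have De0 : 0 <= 4 * D / eta by rewrite divr_ge0 ?(ltW eta0)// mulr_ge0.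
have t0 : 1 <= t by apply: le_trans t1; rewrite lerDl.
(* A zero variance would make the rate 0, against t >= 1, so the auxiliary branch of [Z] does not
   occur far along the subsequence. *)
have sg0 : 0 < sigma (s m).
  rewrite lt_neqAle sigma0 andbT; apply/eqP => sz.
  by move: t0; rewrite -tE -sz expr0n/= mulr0 mul0r ler10.
have mom : (\int[F]_z (`|phi (s m) z| `^ (2 + delta))%:E <=
    ((p (s m)).+1%:R^-1 `^ (2 + delta) * C)%:E)%E.
  exact: (saa_score_moment X_nonempty xi_iid msup moment2 (mHp (s m)) (gp (s m)) q1 msup_diff).
have := standardized_sum_smooth_le (mphi (s m)) xi_iid (sqphi _) (phi0 _) (sigma2 _)
  a s0 sg0 (ltr0Sn R (p (s m))) delta_gt0 C0 b0 eps0 mom.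
rewrite tE => /(_ t0) le1.
rewrite distrC; apply: le_lt_trans le1 _; rewrite -/K.
have w0 : 0 < Num.sqrt (s m)%:R :> R by rewrite sqrtr_gt0 ltr0n.
have tt0 : 0 < t by exact: lt_le_trans t0.
have i1 : D * t^-1 <= eta / 4.
  rewrite ler_pdivrMr//; have : (4 * D / eta) * eta = 4 * D by rewrite mulfVK ?gt_eqF.
  by move: t1 eta0; nra.
have w1 : 16 * K / eta <= Num.sqrt (s m)%:R.
  have W0 : 0 <= 16 * K / eta by rewrite ltW// divr_gt0// mulr_gt0.
  rewrite -(ger0_norm W0) -sqrtr_sqr ler_wsqrtr//.
  apply: (@le_trans _ _ m%:R); last by rewrite ler_nat.
  by apply: le_trans t2; rewrite lerDl.
have i2 : 4 * K * (Num.sqrt (s m)%:R)^-1 <= eta / 4.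
  rewrite ler_pdivrMr//; have : (16 * K / eta) * eta = 16 * K by rewrite mulfVK ?gt_eqF.
  by move: w1 eta0; nra.
have i3 : K * eps = eta / 4 by rewrite /eps; field; rewrite gt_eqF.
rewrite (_ : K * _ = K * eps + D * t^-1 + 4 * K * (Num.sqrt (s m)%:R)^-1); last first.
  by rewrite /D; ring.
by rewrite i3; move: i1 i2 eta0; lra.
Unshelve. all: by end_near.
Qed.
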